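(* As $N\to\infty$, $$\begin{aligned}C_1(N)&=2N-4-\frac{20}{3N}+O(N^{-2}),\\ C_2(N)&=4N^2-\frac{46}{3}N-\frac{7729}{540}+O(N^{-1}),\\ C_3(N)&=8N^3-\frac{324}{7}N^2-\frac{30020}{4459}N+O(1).\end{aligned}$$
   Context: For an integer $N\ge1$, let $L_N$ be the non-negative combinatorial Laplacian on $\mathbb Z^N$, $(L_Nu)(n)=2Nu(n)-\sum_{|m-n|=1}u(m)$, where $|\cdot|$ is the Euclidean norm. $C_c(\mathbb Z^N)$ denotes the finitely supported complex-valued functions on $\mathbb Z^N$, and $\langle\cdot,\cdot\rangle$ is the $\ell^2(\mathbb Z^N)$ inner product. For an integer $\ell\ge1$, $$C_\ell(N)=\inf_{\substack{u\in C_c(\mathbb Z^N),\ u(0)=0\\ u\ne0}}\frac{\langle u,L_N^\ell u\rangle}{\sum_{n\ne0}|u(n)|^2/|n|^{2\ell}}.$$ Here $L_N^\ell$ is the $\ell$th power of the Laplacian of the whole lattice $\mathbb Z^N$ (the condition $u(0)=0$ is imposed only on the test functions). *)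

(* Defs.v *)
From HB Require Import structures.
From mathcomp Require Import all_boot all_order all_algebra.
From mathcomp Require Import complex.
From mathcomp Require Import all_classical all_reals all_analysis.
Set Implicit Arguments.
Unset Strict Implicit.
Unset Printing Implicit Defensive.
Import Order.TTheory GRing.Theory Num.Theory.
Import numFieldNormedType.Exports.
Local Open Scope classical_set_scope.
Local Open Scope ring_scope.
Local Open Scope complex_scope.

(* Points of Z^N are integer row vectors; every sum below is a finitely
   supported sum ([fsbigop]) whenever the functions are in [Cc]. *)

Definition enorm (R : realType) (N : nat) (n : 'rV[int]_N) : R :=
  Num.sqrt (\sum_(i < N) ((n ord0 i)%:~R : R) ^+ 2).

Definition laplacian (R : realType) (N : nat) (u : 'rV[int]_N -> R[i])
    (n : 'rV[int]_N) : R[i] :=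
  (2 * N)%:R * u n - \sum_(m \in [set m | enorm R (m - n) = 1]) u m.

Definition Cc (R : realType) (N : nat) : set ('rV[int]_N -> R[i]) :=
  [set u | finite_set [set n | u n != 0]].

Definition inner (R : realType) (N : nat) (u v : 'rV[int]_N -> R[i]) : R[i] :=
  \sum_(n \in [set: 'rV[int]_N]) (u n)^* * v n.

Definition hardy_weight (R : realType) (l N : nat)
    (u : 'rV[int]_N -> R[i]) : R :=
  \sum_(n \in [set n : 'rV[int]_N | n != 0])
    Normc.normc (u n) ^+ 2 / enorm R n ^+ (2 * l).

(* <u, L_N^l u> is real because L_N is symmetric, whence the real part.  For
   N >= 1 the set below is nonempty and bounded below by 0, so the real-valued
   [inf] is the genuine infimum. *)
Definition hardy_constant (R : realType) (l N : nat) : R :=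
  inf [set complex.Re (inner u (iter l (@laplacian R N) u)) / hardy_weight l u
      | u in [set u | [/\ @Cc R N u, u 0 = 0 & u <> (fun=> 0)]]].

(* Main.v *)
(* Write x = 1/N and L_N = 2N (1 - B), where B averages over the 2N neighbours, so
   that only the quadratic form of (1 - B)^l against |n|^(-2l) matters; its best
   constant has the form c = 1 + c1 x + c2 x^2 + O(x^3).  B costs a factor of order
   x^(1/2) in l^2 norm on functions supported near the origin.  Hence perturbing the
   indicator of the unit sphere by values at e_i + e_j, 2 e_i and e_i + e_j + e_k
   gives a function psi with (1 - B)^l psi = c |n|^(-2l) psi up to a residual e such
   that <psi, e> and |e|^2 are O(x^2), to be compared with |psi|^2 ~ 2N.  This psi is
   the trial function of the upper bound.  For the lower bound, write u = s psi + y
   with y of zero mean on the unit sphere.  Such y satisfy the inequality with room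
   to spare: away from the unit sphere this is a ground-state (Schur test) Hardy
   inequality with the supersolutions (|n|^2 + 20)^(-a), and on the unit sphere the
   zero mean divides the second-order correction by two.  The spare room absorbs the
   cross term 2 s <y, e>, at the price of s^2 O(x^2) = O(x^3) sum |u|^2 / |n|^(2l). *)

(* The order to which the equation for psi must be solved at a point is dictated by the number of
   such points, because <psi, e> has to be O(x^2). The roughly 2N^2 points e_i + e_j and (4/3)N^3
   points e_i + e_j + e_k need a residual O(x^3), while the 2N points 2 e_i tolerate O(x^2); this is
   why only the value at e_i + e_j carries two coefficients. Elsewhere beyond the unit sphere the
   automatic decay N x^|n|_1 is enough. At the origin the equation fails at order 1, harmlessly,
   since all functions involved vanish there. The radial mode is singled out because on the unit
   sphere |B y|^2 is about (3/2) x |y|^2 for constants but at most (1/2) x |y|^2 for zero mean: the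
   other modes have strictly larger energy at order x. No half-integer power of x appears, because B
   reverses the parity of |n|_1 and so <y, B y> vanishes for y on the unit sphere. The far region
   only needs non-sharp constants, but they must be uniform in N. Supersolutions of very high degree
   provide them: for large N their potential is close to 1 near the origin. *)
Require Import Defs.
From HB Require Import structures.
From mathcomp Require Import all_boot all_order all_algebra.
From mathcomp Require Import finmap mathcomp_extra boolp classical_sets functions.
From mathcomp Require Import cardinality fsbigop reals zify ring lra.
Set Implicit Arguments.
Unset Strict Implicit.
Unset Printing Implicit Defensive.
Import Order.TTheory GRing.Theory Num.Theory.
Local Open Scope classical_set_scope.
Local Open Scope ring_scope.

(** * Finitely supported sums and the neighbour average *)

Section FiniteSums.
Variables (R : realType) (T : choiceType).
Implicit Types f g h : T -> R.

Definition fsupp f := finite_set [set n | f n != 0].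
Definition zsum f : R := \sum_(n \in [set: T]) f n.

Lemma fsupp_sub f g : fsupp g -> (forall n, g n = 0 -> f n = 0) -> fsupp f.
Proof.
move=> fg h; apply: sub_finite_set fg => n /=.
by apply: contra_neq => /h.
Qed.

Lemma fsuppD f g : fsupp f -> fsupp g -> fsupp (fun n => f n + g n).
Proof.
move=> ff fg; apply: (@sub_finite_set _ _ ([set n | f n != 0] `|` [set n | g n != 0])).
  move=> n /= h; case: (eqVneq (f n) 0) h => [-> | ]; last by left.
  by rewrite add0r; right.
by rewrite finite_setU.
Qed.

Lemma fsupp0 : fsupp (fun=> 0).
Proof. by apply: (sub_finite_set _ (finite_set0 T)) => n /=; rewrite eqxx. Qed.

Lemma fsuppN f : fsupp f -> fsupp (fun n => - f n).
Proof. by move=> /fsupp_sub; apply => n ->; rewrite oppr0. Qed.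
Lemma fsuppMl f g : fsupp f -> fsupp (fun n => f n * g n).
Proof. by move=> /fsupp_sub; apply => n ->; rewrite mul0r. Qed.
Lemma fsuppMr f g : fsupp g -> fsupp (fun n => f n * g n).
Proof. by move=> /fsupp_sub; apply => n ->; rewrite mulr0. Qed.
Lemma fsuppX f k : fsupp f -> fsupp (fun n => f n ^+ k.+1).
Proof. by move=> /fsupp_sub; apply => n ->; rewrite expr0n. Qed.

Lemma fsupp_sum (I : finType) (F : I -> T -> R) :
  (forall i, fsupp (F i)) -> fsupp (fun n => \sum_i F i n).
Proof.
move=> hF.
suff H : forall s : seq I, fsupp (fun n => \sum_(i <- s) F i n) by exact: H.
elim=> [|i s IH].
  by apply: fsupp_sub fsupp0 _ => n _; rewrite big_nil.
apply: fsupp_sub (fsuppD (hF i) IH) _ => n h; rewrite big_cons; exact: h.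
Qed.

Lemma zsum_seq f (D : {fset T}) : (forall n, f n != 0 -> n \in D) ->
  zsum f = \sum_(n <- D) f n.
Proof.
move=> h; apply: fsbigTE => n hn; apply/eqP.
by apply: contraNT hn => /h.
Qed.

Lemma zsum_seq2 f g : fsupp f -> fsupp g ->
  exists D : {fset T}, (forall n, f n != 0 -> n \in D) /\
    (forall n, g n != 0 -> n \in D).
Proof.
move=> ff fg; exists (fset_set ([set n | f n != 0] `|` [set n | g n != 0])).
by split=> n hn; rewrite in_fset_set ?finite_setU // inE; [left | right].
Qed.

Lemma eq_zsum f g : (forall n, f n = g n) -> zsum f = zsum g.
Proof. by move=> h; congr zsum; apply: funext. Qed.

Lemma zsumD f g : fsupp f -> fsupp g -> zsum (fun n => f n + g n) = zsum f + zsum g.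
Proof.
move=> ff fg; have [D [hf hg]] := zsum_seq2 ff fg.
rewrite (zsum_seq hf) (zsum_seq hg) (@zsum_seq _ D) ?big_split //= => n hn.
case: (eqVneq (f n) 0) hn => [-> | /hf //]; by rewrite add0r => /hg.
Qed.

Lemma zsumZ c f : zsum (fun n => c * f n) = c * zsum f.
Proof. by rewrite /zsum mulr_fsumr. Qed.

Lemma zsumN f : zsum (fun n => - f n) = - zsum f.
Proof. by rewrite -mulN1r -zsumZ; apply: eq_zsum => n; rewrite mulN1r. Qed.

Lemma zsumB f g : fsupp f -> fsupp g -> zsum (fun n => f n - g n) = zsum f - zsum g.
Proof. by move=> ff fg; rewrite zsumD ?zsumN //; exact: fsuppN. Qed.

Lemma zsum0 : zsum (fun=> 0) = 0.
Proof. by rewrite /zsum fsbig1. Qed.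

Lemma zsum_ge0 f : (forall n, 0 <= f n) -> 0 <= zsum f.
Proof. by move=> h; apply: fsumr_ge0. Qed.

Lemma le_zsum f g : fsupp f -> fsupp g -> (forall n, f n <= g n) -> zsum f <= zsum g.
Proof.
move=> ff fg h; rewrite -subr_ge0 -zsumB //; apply: zsum_ge0 => n; by rewrite subr_ge0.
Qed.

Lemma zsum_sum (I : finType) (F : I -> T -> R) :
  (forall i, fsupp (F i)) -> zsum (fun n => \sum_i F i n) = \sum_i zsum (F i).
Proof.
move=> hF.
suff H : forall s : seq I, zsum (fun n => \sum_(i <- s) F i n) = \sum_(i <- s) zsum (F i) /\
   fsupp (fun n => \sum_(i <- s) F i n) by have [] := H (index_enum I).
elim=> [|i s [IH1 IH2]].
  split; first by rewrite big_nil (@eq_zsum _ (fun=> 0)) ?zsum0 // => n; rewrite big_nil.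
  by apply: fsupp_sub fsupp0 _ => n _; rewrite big_nil.
split.
  rewrite big_cons -IH1 -zsumD //; by apply: eq_zsum => n; rewrite big_cons.
by apply: fsupp_sub (fsuppD (hF i) IH2) _ => n h; rewrite big_cons; exact: h.
Qed.

Lemma zsum_reindex f (p q : T -> T) : cancel p q -> cancel q p ->
  zsum (fun n => f (p n)) = zsum f.
Proof.
move=> pq qp; rewrite /zsum; symmetry.
by apply: (@reindex_fsbigT _ _ _ _ _ p); exists q.
Qed.

Lemma fsupp_reindex f (p q : T -> T) : cancel p q -> fsupp f -> fsupp (fun n => f (p n)).
Proof.
move=> pq ff; apply: (sub_finite_set _ (finite_image q ff)) => n /= h.
by exists (p n).
Qed.

Lemma zsum_eq0 f : fsupp f -> (forall n, 0 <= f n) -> zsum f = 0 -> forall n, f n = 0.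
Proof.
move=> ff f0 h n; apply/eqP; apply: contraT => fn0.
have [D [hf _]] := zsum_seq2 ff ff.
have : \sum_(n <- D) f n == 0 by rewrite -(zsum_seq hf) h.
rewrite psumr_eq0; last by move=> *; exact: f0.
by move/allP => /(_ n (hf _ fn0)); rewrite implyTb (negbTE fn0).
Qed.

End FiniteSums.

Section Lattice.
Variables (R : realType) (N : nat).
Local Notation Z := 'rV[int]_N.
Implicit Types (f g v : Z -> R) (n m : Z).

Definition evec (i : 'I_N) : Z := delta_mx ord0 i.
Definition nbsum f n : R := \sum_i (f (n + evec i) + f (n - evec i)).
Definition invN : R := N%:R^-1.
Definition avg f n : R := invN / 2 * nbsum f n.

Lemma fsupp_shift f a : fsupp f -> fsupp (fun n => f (n + a)).
Proof. by apply: (@fsupp_reindex _ _ _ _ (fun n => n - a)) => n; rewrite addrK. Qed.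

Lemma zsum_shift f a : zsum (fun n => f (n + a)) = zsum f.
Proof. by apply: (@zsum_reindex _ _ _ _ (fun n => n - a)) => n; rewrite ?addrK ?subrK. Qed.

Lemma fsupp_nbsum f : fsupp f -> fsupp (nbsum f).
Proof. by move=> ff; apply: fsupp_sum => i; apply: fsuppD; apply: fsupp_shift. Qed.

Lemma fsupp_avg f : fsupp f -> fsupp (avg f).
Proof. by move=> /fsupp_nbsum; exact: fsuppMr. Qed.

End Lattice.

(** Hypotheses are matched syntactically, so that a wrong choice fails at once: a product needs only
    one finitely supported factor, and [fsupp_tac] backtracks from the left one to the right one. *)
Ltac fsupp_leaf := match goal with
  | H : fsupp ?f |- fsupp ?g => constr_eq f g; exact: H
  | H : forall a, fsupp _ |- _ => by apply: H
  end.
Ltac fsupp_tac := lazymatch goal with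
  | |- fsupp (fun n => - @?f n) => apply: (@fsuppN _ _ f); fsupp_tac
  | |- fsupp (fun n => @?f n + @?g n) => apply: (@fsuppD _ _ f g); fsupp_tac
  | |- fsupp (fun n => @?f n * @?g n) =>
      first [ apply: (@fsuppMl _ _ f g); fsupp_tac | apply: (@fsuppMr _ _ f g); fsupp_tac ]
  | |- fsupp (fun n => @?f n ^+ _) => apply: (@fsuppX _ _ f); fsupp_tac
  | |- fsupp (fun n => nbsum ?f n) => apply: (@fsupp_nbsum _ _ f); fsupp_tac
  | |- fsupp (fun n => avg ?f n) => apply: (@fsupp_avg _ _ f); fsupp_tac
  | |- fsupp (nbsum ?f) => apply: (@fsupp_nbsum _ _ f); fsupp_tac
  | |- fsupp (avg ?f) => apply: (@fsupp_avg _ _ f); fsupp_tac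
  | |- fsupp (fun n => ?f (n + ?a)) => apply: (@fsupp_shift _ _ f a); fsupp_tac
  | |- fsupp (fun n => ?f n) => change (fsupp f); fsupp_leaf
  | |- _ => fsupp_leaf
  end.

Section NeighbourSums.
Variables (R : realType) (N : nat).
Local Notation Z := 'rV[int]_N.
Local Notation hN := (invN R N).
Implicit Types (f g v : Z -> R) (n m : Z).

Lemma zsum_nbsum f : fsupp f -> zsum (nbsum f) = 2 * N%:R * zsum f.
Proof.
move=> ff; rewrite zsum_sum; last by move=> i; apply: fsuppD; apply: fsupp_shift.
rewrite (eq_bigr (fun=> 2 * zsum f)); last first.
  by move=> i _; rewrite zsumD ?zsum_shift -?mulr2n ?mulr_natl //; apply: fsupp_shift.
by rewrite sumr_const card_ord -[_ *+ N]mulr_natr; ring.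
Qed.

Lemma zsum_mul_nbsum f g : fsupp f -> zsum (fun n => f n * nbsum g n) = zsum (fun n => nbsum f n * g n).
Proof.
move=> ff; under eq_zsum => n do rewrite mulr_sumr.
under [RHS]eq_zsum => n do rewrite mulr_suml.
have h1 i : fsupp (fun n => f n * g (n + evec i)) by fsupp_tac.
have h2 i : fsupp (fun n => f n * g (n - evec i)) by fsupp_tac.
have h3 i : fsupp (fun n => f (n + evec i) * g n) by apply: fsuppMl; apply: fsupp_shift.
have h4 i : fsupp (fun n => f (n - evec i) * g n) by apply: fsuppMl; apply: fsupp_shift.
rewrite !zsum_sum; last 2 first.
- by move=> i; under eq_fun => n do rewrite mulrDl; apply: fsuppD.
- by move=> i; under eq_fun => n do rewrite mulrDr; apply: fsuppD.
apply: eq_bigr => i _.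
under eq_zsum => n do rewrite mulrDr.
under [RHS]eq_zsum => n do rewrite mulrDl.
rewrite !zsumD // addrC; congr (_ + _).
  rewrite -(zsum_shift _ (evec i)); by apply: eq_zsum => n; rewrite addrK.
rewrite -(zsum_shift _ (- evec i)); by apply: eq_zsum => n; rewrite subrK.
Qed.

Lemma nbsumD f g n : nbsum (fun m => f m + g m) n = nbsum f n + nbsum g n.
Proof. by rewrite /nbsum -big_split /=; apply: eq_bigr => i _; ring. Qed.
Lemma nbsumZ c f n : nbsum (fun m => c * f m) n = c * nbsum f n.
Proof. by rewrite /nbsum mulr_sumr; apply: eq_bigr => i _; ring. Qed.
Lemma avgD f g n : avg (fun m => f m + g m) n = avg f n + avg g n.
Proof. by rewrite /avg nbsumD mulrDr. Qed.
Lemma avgZ c f n : avg (fun m => c * f m) n = c * avg f n.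
Proof. by rewrite /avg nbsumZ mulrCA. Qed.
Lemma avgB f g n : avg (fun m => f m - g m) n = avg f n - avg g n.
Proof.
have -> : (fun m => f m - g m) = (fun m => f m + (-1) * g m).
  by apply: funext => m; ring.
by rewrite avgD avgZ mulN1r.
Qed.

Lemma invN_ge0 : 0 <= hN. Proof. by rewrite invr_ge0. Qed.

Lemma zsum_mul_avg f g : fsupp f -> zsum (fun n => f n * avg g n) = zsum (fun n => avg f n * g n).
Proof.
move=> ff.
rewrite (eq_zsum (g := fun n => hN / 2 * (f n * nbsum g n))); last by move=> n; rewrite /avg; ring.
rewrite [RHS](eq_zsum (g := fun n => hN / 2 * (nbsum f n * g n))); last by move=> n; rewrite /avg; ring.
by rewrite !zsumZ zsum_mul_nbsum.
Qed.

(* Schur's test: each edge contributes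
   2 v(n) f(m) <= v(n)^2 g(m)/g(n) + f(m)^2 g(n)/g(m). *)
Lemma schur (psi g f v : Z -> R) : fsupp f -> fsupp v ->
  (forall n, 0 <= psi n) -> (forall n, 0 < g n) ->
  zsum (fun n => psi n * v n * nbsum f n) + zsum (fun n => psi n * f n * nbsum v n) <=
  zsum (fun n => (v n ^+ 2 + f n ^+ 2) / 2 *
    ((psi n * nbsum g n + nbsum (fun m => psi m * g m) n) / g n)).
Proof.
move=> ff fv psi0 g0.
(* The right-hand side is split over directed edges from n to n + a; the factor in [psi] is
   symmetric in the two ends. *)
pose w a n := (psi n + psi (n + a)) * (g (n + a) / g n).
have -> : zsum (fun n => (v n ^+ 2 + f n ^+ 2) / 2 *
    ((psi n * nbsum g n + nbsum (fun m => psi m * g m) n) / g n)) =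
  zsum (fun n => \sum_i ((v n ^+ 2 + f n ^+ 2) / 2 * w (evec i) n
        + (v n ^+ 2 + f n ^+ 2) / 2 * w (- evec i) n)).
  apply: eq_zsum => n; rewrite /nbsum mulr_sumr -big_split /= mulr_suml mulr_sumr.
  by apply: eq_bigr => i _; rewrite /w; field; exact: lt0r_neq0.
have f2 : fsupp (fun n => (v n ^+ 2 + f n ^+ 2) / 2) by fsupp_tac.
have fa a : fsupp (fun n => f (n + a)) by exact: fsupp_shift.
have va a : fsupp (fun n => v (n + a)) by exact: fsupp_shift.
have h a (h1 h2 : Z -> R) : fsupp h1 -> fsupp (fun n => psi n * h1 n * h2 (n + a)).
  by move=> ?; fsupp_tac.
rewrite -zsumD; last 2 first.
- by fsupp_tac.
- by fsupp_tac.
rewrite (eq_zsum (g := fun n => \sum_i (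
   (psi n * v n * f (n + evec i) + psi n * v n * f (n - evec i)) +
   (psi n * f n * v (n + evec i) + psi n * f n * v (n - evec i))))); last first.
  move=> n; rewrite /nbsum !mulr_sumr -big_split /=.
  by apply: eq_bigr => i _; ring.
rewrite !zsum_sum; last 2 first.
- by move=> i; fsupp_tac.
- by move=> i; fsupp_tac.
apply: ler_sum => i _.
rewrite !zsumD; try by (exact: h || fsupp_tac).
(* A shift attaches both orientations of an edge to the same end, after which the comparison is
   pointwise. *)
have e1 (h1 h2 : Z -> R) : zsum (fun n => psi n * h1 n * h2 (n - evec i)) =
   zsum (fun n => psi (n + evec i) * h1 (n + evec i) * h2 n).
  by rewrite -(zsum_shift _ (evec i)); apply: eq_zsum => n; rewrite addrK.
rewrite !e1.
rewrite -(zsum_shift (fun n => (v n ^+ 2 + f n ^+ 2) / 2 * w (- evec i) n) (evec i)).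
rewrite -!zsumD; try by fsupp_tac.
apply: le_zsum; try by fsupp_tac.
move=> n; rewrite /w addrK.
set p := psi n; set p' := psi _; set G := g n; set G' := g _.
set V := v n; set V' := v _; set F := f n; set F' := f _.
have pp : 0 <= p + p' by rewrite addr_ge0 // psi0.
have G0 : 0 < G by exact: g0.
have G'0 : 0 < G' by exact: g0.
have key (X Y : R) : 2 * (X * Y) <= X ^+ 2 * (G' / G) + Y ^+ 2 * (G / G').
  rewrite -subr_ge0.
  have -> : X ^+ 2 * (G' / G) + Y ^+ 2 * (G / G') - 2 * (X * Y) =
     (X * G' - Y * G) ^+ 2 / (G * G').
    by field; rewrite !lt0r_neq0.
  by rewrite divr_ge0 ?sqr_ge0 // ltW // mulr_gt0.
have := ler_wpM2l pp (key V F').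
have := ler_wpM2l pp (key F V').
set q := G' / G; set q' := G / G'.
by lra.
Qed.

End NeighbourSums.

(** * A Hardy inequality away from the origin *)

Section ScalarBounds.
Variable R : realType.

(** The even and odd parts must be bounded together, since multiplication by 1 + y and 1 - y feeds
    each into the other. *)
Lemma pow_even_bound (a : nat) : exists c : R, 0 <= c /\ forall y : R, `|y| <= 1 ->
  (1 + y) ^+ a + (1 - y) ^+ a <= 2 + c * y ^+ 2 /\
  `|(1 + y) ^+ a - (1 - y) ^+ a| <= c * `|y|.
Proof.
elim: a => [|a [c [c0 IH]]].
  exists 0; split=> // y _; rewrite !expr0 subrr normr0 !mul0r addr0; split=> //.
exists (2 * c + 2); split=> [|y y1]; first by lra.
have [h1 h2] := IH y y1.
set P := (1 + y) ^+ a in h1 h2 *; set M := (1 - y) ^+ a in h1 h2 *.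
have yy : `|y| * `|y| = y ^+ 2 by rewrite -expr2 real_normK ?num_real.
have yo : y * (P - M) <= c * y ^+ 2.
  apply: le_trans (ler_norm _) _; rewrite normrM -yy mulrCA.
  by apply: ler_wpM2l.
have y2 : y ^+ 2 <= 1 by rewrite -yy mulr_ile1.
have e0 : 0 <= P + M.
  have [yl yr] : -1 <= y /\ y <= 1 by move: y1; rewrite ler_norml => /andP[].
  by rewrite addr_ge0 // exprn_ge0 //; lra.
have cy : c * y ^+ 2 <= c by rewrite ler_piMr.
have yy0 : 0 <= y ^+ 2 by rewrite sqr_ge0.
have cy0 : 0 <= c * y ^+ 2 by rewrite mulr_ge0.
split.
  rewrite !exprS -/P -/M.
  have -> : (1 + y) * P + (1 - y) * M = (P + M) + y * (P - M) by ring.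
  lra.
rewrite !exprS -/P -/M.
have -> : (1 + y) * P - (1 - y) * M = (P - M) + y * (P + M) by ring.
apply: le_trans (ler_normD _ _) _.
have : `|y * (P + M)| <= `|y| * (2 + c).
  by rewrite normrM (ger0_norm e0); apply: ler_wpM2l => //; lra.
lra.
Qed.

Lemma one_sub_pow (a : nat) (z : R) : 0 <= z -> z <= 1 -> 1 - a%:R * z <= (1 - z) ^+ a.
Proof.
move=> z0 z1; elim: a => [|a IH]; first by rewrite mul0r subr0 expr0.
rewrite exprS -natr1.
have h : (1 - z) * (1 - a%:R * z) <= (1 - z) * (1 - z) ^+ a by apply: ler_wpM2l => //; lra.
apply: le_trans _ h.
have : 0 <= a%:R * z ^+ 2 by rewrite mulr_ge0 // sqr_ge0.
by lra.
Qed.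

Lemma inv_pow_even_bound (a : nat) : exists c : R, 0 <= c /\ forall y : R, y ^+ 2 <= 1 / 2 ->
  (1 + y) ^- a + (1 - y) ^- a <= 2 + c * y ^+ 2.
Proof.
have [c [c0 h]] := pow_even_bound a.
(* Over the common denominator (1 - y^2)^a, Bernoulli's inequality loses 2 a y^2, and 2^a
   compensates for the denominator, which is at least 2^-a. *)
exists (2 ^+ a * (c + 2 * a%:R)); split=> [|y y2].
  by rewrite mulr_ge0 ?exprn_ge0 // addr_ge0 // mulr_ge0.
have y1 : `|y| <= 1.
  by rewrite -(@ler_pXn2r _ 2) ?nnegrE // real_normK ?num_real // expr1n; lra.
have [yl yr] : -1 <= y /\ y <= 1 by move: y1; rewrite ler_norml => /andP[].
have [h1 _] := h y y1.
have np : 1 + y != 0 by apply/eqP => e; nra.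
have nm : 1 - y != 0 by apply/eqP => e; nra.
have Pp : 0 < (1 + y) ^+ a by apply: exprn_gt0; rewrite lt0r np; lra.
have Mp : 0 < (1 - y) ^+ a by apply: exprn_gt0; rewrite lt0r nm; lra.
have -> : (1 + y) ^- a + (1 - y) ^- a =
   ((1 + y) ^+ a + (1 - y) ^+ a) / ((1 + y) ^+ a * (1 - y) ^+ a).
  by field; rewrite !lt0r_neq0.
rewrite ler_pdivrMr ?mulr_gt0 // -exprMn.
have -> : (1 + y) * (1 - y) = 1 - y ^+ 2 by ring.
have yy0 : 0 <= y ^+ 2 by rewrite sqr_ge0.
have k1 := @one_sub_pow a _ yy0 (le_trans y2 (ltac:(lra) : 1 / 2 <= 1 :> R)).
have k2 : 1 <= 2 ^+ a * (1 - y ^+ 2) ^+ a.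
  by rewrite -exprMn exprn_ege1 //; lra.
set Q := (1 - y ^+ 2) ^+ a in k1 k2 *; set t := 2 ^+ a in k2 *.
have k3 : 0 <= (c + 2 * a%:R) * y ^+ 2 by rewrite mulr_ge0 // addr_ge0 // mulr_ge0.
have := ler_wpM2l k3 k2.
by lra.
Qed.

(** Used with s = |n|^2 + 21 and z = 2 n_i: the neighbours n + e_i and n - e_i have shifted squared
    norms s + z and s - z. *)
Lemma inv_pow_sym_bound (a : nat) : exists c : R, 0 <= c /\ forall s z : R, 0 < s ->
  z ^+ 2 <= s ^+ 2 / 2 ->
  (s + z) ^- a + (s - z) ^- a <= s ^- a * (2 + c * z ^+ 2 / s ^+ 2).
Proof.
have [c [c0 h]] := inv_pow_even_bound a.
exists c; split=> // s z s0 zs; have sn := lt0r_neq0 s0.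
have e (w : R) : (s + w) ^- a = s ^- a * (1 + w / s) ^- a.
  rewrite -invfM -exprMn; congr ((_ ^+ a)^-1); by field.
rewrite e (e (- z)) mulNr -mulrDr; apply: ler_wpM2l.
  by rewrite invr_ge0 exprn_ge0 // ltW.
apply: le_trans (h _ _) _; last by rewrite expr_div_n mulrA.
by rewrite expr_div_n ler_pdivrMr ?exprn_gt0 //; lra.
Qed.

(** The source of the Hardy potential: a step raises |n|^2 by 1 on average, and the a-th inverse
    power then drops by a relative amount of at least a / (s + a). *)
Lemma bernoulli (a : nat) (s : R) : 0 < s -> (s / (s + 1)) ^+ a <= s / (s + a%:R).
Proof.
move=> s0; elim: a => [|a IH]; first by rewrite expr0 addr0 divff // lt0r_neq0.
rewrite exprS; apply: (@le_trans _ _ (s / (s + 1) * (s / (s + a%:R)))).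
  by apply: ler_wpM2l => //; apply: divr_ge0; lra.
have a0 : 0 <= a%:R :> R by [].
rewrite -subr_ge0 -natr1.
have -> : s / (s + (a%:R + 1)) - s / (s + 1) * (s / (s + a%:R)) =
   s * a%:R / ((s + (a%:R + 1)) * (s + 1) * (s + a%:R)).
  by field; apply/and3P; split; apply: lt0r_neq0; lra.
apply: divr_ge0; first by apply: mulr_ge0 => //; exact: ltW.
by apply: mulr_ge0; [apply: mulr_ge0|]; lra.
Qed.

End ScalarBounds.

(** * Coordinate statistics: the l1 norm and the squared Euclidean norm *)

Section Stat.
Variable (N : nat).
Local Notation Z := 'rV[int]_N.
Implicit Types (n m : Z) (h : int -> nat).

(** Common form of the l1 norm, the squared norm and the counts [abs_count], so that the effect of a
    step along an axis is computed once. *)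
Definition coord_sum h n : nat := (\sum_i h (n ord0 i))%N.

Lemma evecE (i j : 'I_N) : evec i ord0 j = (i == j)%:R.
Proof. by rewrite /evec mxE eqxx /= eq_sym. Qed.

(** Written without subtraction, which would be truncated on natural numbers. *)
Lemma coord_sum_move h n i a : (coord_sum h (n + a *: evec i)%R + h (n ord0 i) =
  coord_sum h n + h (n ord0 i + a)%R)%N.
Proof.
rewrite /coord_sum (bigD1 i) //= [in RHS](bigD1 i) //= !mxE !eqxx mulr1.
rewrite (eq_bigr (fun j => h (n ord0 j))) /=; last first.
  by move=> j ji; rewrite !mxE !eqxx (negbTE ji) mulr0 addr0.
set A := (\sum_(j | _) _)%N; set C := h _; set D := h _; lia.
Qed.

Lemma coord_sum_add h n i : (coord_sum h (n + evec i)%R + h (n ord0 i) =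
  coord_sum h n + h (n ord0 i + 1)%R)%N.
Proof. by rewrite -(coord_sum_move h n i 1) scale1r. Qed.

Lemma coord_sum_sub h n i : (coord_sum h (n - evec i)%R + h (n ord0 i) =
  coord_sum h n + h (n ord0 i - 1)%R)%N.
Proof. by rewrite -(coord_sum_move h n i (-1)) scaleN1r. Qed.

Definition l1norm := coord_sum absz.
Definition sqn := coord_sum (fun a => absz a ^ 2)%N.

Lemma l1norm_0 : l1norm 0 = 0%N.
Proof. by rewrite /l1norm /coord_sum big1 // => i _; rewrite mxE. Qed.
Lemma sqn0 : sqn 0 = 0%N.
Proof. by rewrite /sqn /coord_sum big1 // => i _; rewrite mxE. Qed.

Lemma l1norm_eq0 n : l1norm n = 0%N -> n = 0.
Proof.
move=> /eqP; rewrite /l1norm /coord_sum sum_nat_eq0 => /forallP h.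
apply/rowP => i; rewrite mxE; apply/eqP.
by have := h i; rewrite implyTb absz_eq0.
Qed.

Lemma l1norm_sqn n : (l1norm n <= sqn n)%N.
Proof. by apply: leq_sum => i _; case: absz => // k; nia. Qed.

Lemma sqn_l1norm n : (sqn n <= l1norm n ^ 2)%N.
Proof.
rewrite /l1norm /sqn /coord_sum; elim/big_rec2: _ => // i a b _ h.
by rewrite sqrnD; lia.
Qed.

Variable R : realType.

Lemma natr_absz_sqr (a : int) : ((`|a| ^ 2)%N)%:R = a%:~R ^+ 2 :> R.
Proof. by rewrite natrX -[RHS]real_normK ?num_real // -intr_norm -abszE. Qed.

Lemma sqn_real n : (sqn n)%:R = \sum_i ((n ord0 i)%:~R : R) ^+ 2.
Proof. by rewrite /sqn /coord_sum natr_sum; apply: eq_bigr => i _; exact: natr_absz_sqr. Qed.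

Lemma sqn_add n i : (sqn (n + evec i))%:R = (sqn n)%:R + 1 + 2 * (n ord0 i)%:~R :> R.
Proof.
have := congr1 (fun k : nat => k%:R : R) (coord_sum_add (fun a => absz a ^ 2)%N n i).
rewrite -!/(sqn _) !natrD !natr_absz_sqr intrD /= => h; lra.
Qed.

Lemma sqn_sub n i : (sqn (n - evec i))%:R = (sqn n)%:R + 1 - 2 * (n ord0 i)%:~R :> R.
Proof.
have := congr1 (fun k : nat => k%:R : R) (coord_sum_sub (fun a => absz a ^ 2)%N n i).
rewrite -!/(sqn _) !natrD !natr_absz_sqr intrB /= => h; lra.
Qed.

Lemma sqn_coord n i : ((n ord0 i)%:~R : R) ^+ 2 <= (sqn n)%:R.
Proof.
by rewrite sqn_real (bigD1 i) //= lerDl; apply: sumr_ge0 => j _; exact: sqr_ge0.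
Qed.

End Stat.

Section Far.
Variables (R : realType).

Section FixedN.
Variable (N : nat).
Local Notation Z := 'rV[int]_N.
Implicit Types (f g v : Z -> R) (n m : Z).

Definition lapn f n : R := f n - avg f n.

Lemma fsupp_lapn f : fsupp f -> fsupp (lapn f).
Proof. by move=> ff; apply: fsuppD => //; apply: fsuppN; apply: fsupp_avg. Qed.

Lemma zsum_mul_lapn f g : fsupp f ->
  zsum (fun n => f n * lapn g n) = zsum (fun n => lapn f n * g n).
Proof.
move=> ff.
rewrite (@eq_zsum _ _ _ (fun n => f n * g n - f n * avg g n)); last first.
  by move=> n; rewrite /lapn mulrBr.
rewrite [RHS](@eq_zsum _ _ _ (fun n => f n * g n - avg f n * g n)); last first.
  by move=> n; rewrite /lapn mulrBl.
by rewrite !zsumB ?zsum_mul_avg //; fsupp_tac.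
Qed.

(* Ground-state bound: [g] and [psi g] are supersolutions. *)
Lemma lapn_lower (psi g U v : Z -> R) : fsupp v ->
  (forall n, 0 <= psi n) -> (forall n, 0 < g n) ->
  (forall n, avg g n <= (1 - U n) * g n) ->
  (forall n, avg (fun m => psi m * g m) n <= (1 - U n) * (psi n * g n)) ->
  zsum (fun n => psi n * U n * v n ^+ 2) <= zsum (fun n => psi n * v n * lapn v n).
Proof.
move=> fv psi0 g0 h1 h2.
have := schur fv fv psi0 g0.
rewrite -mulr2n -mulr_natl => /(ler_wpM2l (divr_ge0 (invN_ge0 R N) (ltac:(by []) : 0 <= 4 :> R))).
set L := zsum _; set M := zsum _ => hL.
have fL : fsupp (fun n => psi n * v n * nbsum v n) by fsupp_tac.
have fv2 : fsupp (fun n => psi n * v n * v n) by fsupp_tac.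
have -> : zsum (fun n => psi n * v n * lapn v n) =
   zsum (fun n => psi n * v n * v n) - invN R N / 4 * (2 * L).
  rewrite mulrA -zsumZ -zsumB //; last by fsupp_tac.
  by apply: eq_zsum => n; rewrite /lapn /avg; field.
apply: le_trans (_ : zsum (fun n => psi n * v n * v n) - invN R N / 4 * M <= _); last by lra.
rewrite -zsumZ -zsumB //; last by fsupp_tac.
apply: le_zsum => [||n]; try by fsupp_tac.
have := h1 n; have := h2 n; rewrite /avg.
set A := nbsum g n; set A' := nbsum _ n; set y := invN R N / 2 => k2 k1.
have gn := g0 n.
have : y * A' / g n <= (1 - U n) * psi n.
  by rewrite ler_pdivrMr //; lra.
have : y * A / g n <= 1 - U n by rewrite ler_pdivrMr.
move=> /(ler_wpM2l (psi0 n)) k3 k4.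
have v2 : 0 <= v n ^+ 2 by exact: sqr_ge0.
have := ler_wpM2l v2 (lerD k3 k4).
have -> : v n ^+ 2 * (psi n * (y * A / g n) + y * A' / g n) = 
   2 * (invN R N / 4 * ((v n ^+ 2 + v n ^+ 2) / 2 * ((psi n * A + A') / g n))).
  by rewrite /y; field; exact: lt0r_neq0.
lra.
Qed.

Definition shifted_sqn (n : Z) : R := (sqn n)%:R + 20.

Lemma shifted_sqn_ge n : 20 <= shifted_sqn n. Proof. by rewrite /shifted_sqn lerDr. Qed.

End FixedN.

(** The first-order terms cancel between n + e_i and n - e_i, and the second-order ones add up to a
    multiple of sum_i (2 n_i)^2 = 4 |n|^2. The error is therefore free of the factor N that the main
    term carries. *)
Lemma nbsum_shifted_sqn (a : nat) : exists c : R, 0 <= c /\ forall N (n : 'rV[int]_N),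
  nbsum (fun m => shifted_sqn m ^- a) n <=
    (shifted_sqn n + 1) ^- a * (2 * N%:R + c / (shifted_sqn n + 1)).
Proof.
have [c [c0 h]] := inv_pow_sym_bound R a.
exists (4 * c); split=> [|N n]; first by lra.
set s := shifted_sqn n + 1; have s20 := shifted_sqn_ge n.
have s0 : 0 < s by rewrite /s; lra.
have hs (i : 'I_N) : (2 * (n ord0 i)%:~R) ^+ 2 <= s ^+ 2 / 2 :> R.
  have := sqn_coord R n i; have := sqr_ge0 (s - 4); rewrite /s /shifted_sqn => *; lra.
apply: (@le_trans _ _ (\sum_i s ^- a * (2 + c * (2 * (n ord0 i)%:~R) ^+ 2 / s ^+ 2))).
  apply: ler_sum => i _; apply: le_trans (h s _ s0 (hs i)).
  rewrite /s /shifted_sqn sqn_add sqn_sub le_eqVlt; apply/orP; left; apply/eqP.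
  by congr (_ ^- a + _ ^- a); ring.
rewrite -mulr_sumr; apply: ler_wpM2l; first by rewrite invr_ge0 exprn_ge0 // ltW.
rewrite big_split /= sumr_const card_ord -[_ *+ N]mulr_natr lerD2l.
have -> : \sum_(i < N) c * (2 * (n ord0 i)%:~R) ^+ 2 / s ^+ 2 = 4 * c / s ^+ 2 * (sqn n)%:R.
  by rewrite sqn_real mulr_sumr; apply: eq_bigr => i _; field; exact: lt0r_neq0.
rewrite expr2 invfM mulrA -[leRHS]mulr1 -[leLHS]mulrA; apply: ler_wpM2l.
  by rewrite divr_ge0 ?mulr_ge0 // ltW.
by rewrite mulrC ler_pdivrMr // mul1r /s /shifted_sqn; lra.
Qed.

Lemma avg_shifted_sqn (a : nat) (b : R) : 0 <= b -> b < a%:R -> exists N0, forall N, (N0 <= N)%N ->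
  forall n : 'rV[int]_N, avg (fun m => shifted_sqn m ^- a) n <=
     (1 - b / (shifted_sqn n + b)) * shifted_sqn n ^- a.
Proof.
move=> b0 ba; have [c [c0 h]] := nbsum_shifted_sqn a.
(* For N beyond this, the relative error [eta] = c / (2N) satisfies eta (1 + b) <= a - b, the slack
   between the available exponent and the wanted one. *)
pose N0 := (Num.truncn (c * (1 + b) / (a%:R - b))).+1.
exists N0 => N hN n.
have hN1 : c * (1 + b) / (a%:R - b) < N%:R.
  apply: lt_le_trans (_ : N0%:R <= _); last by rewrite ler_nat.
  by rewrite /N0 truncnS_gt.
have N1 : 0 < N%:R :> R by rewrite ltr0n; exact: leq_trans hN.
have ab : 0 < a%:R - b by lra.
have s20 := shifted_sqn_ge n; set s := shifted_sqn n in s20 *.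
have s0 : 0 < s by lra.
have sa0 : 0 < s + a%:R by apply: ltr_pwDl.
rewrite /avg /invN.
have := ler_wpM2l (divr_ge0 (invN_ge0 R N) (ltac:(by []) : 0 <= 2 :> R)) (h N n).
move/le_trans; apply; rewrite -/s /invN.
have -> : N%:R^-1 / 2 * ((s + 1) ^- a * (2 * N%:R + c / (s + 1))) =
   s ^- a * ((s / (s + 1)) ^+ a * (1 + c / (2 * N%:R) / (s + 1))).
  rewrite expr_div_n; field; rewrite !expf_neq0 //; last 2 first.
  - exact: lt0r_neq0.
  - by apply: lt0r_neq0; lra.
  by rewrite !lt0r_neq0 //; lra.
rewrite [leRHS]mulrC; apply: ler_wpM2l; first by rewrite invr_ge0 exprn_ge0 // ltW.
set eta := c / (2 * N%:R).
have e0 : 0 <= eta by rewrite divr_ge0 // mulr_ge0 // ltW.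
have e1 : eta * (1 + b) <= a%:R - b.
  move: hN1; rewrite ltr_pdivrMr // => hN1.
  rewrite /eta mulrAC ler_pdivrMr ?mulr_gt0 //.
  by rewrite (le_trans (ltW hN1)) // mulrC ler_pM2l //; lra.
have es : 0 <= 1 + eta / (s + 1) by rewrite addr_ge0 // divr_ge0 //; lra.
apply: le_trans (ler_wpM2r es (bernoulli a s0)) _.
have -> : 1 - b / (s + b) = s / (s + b) by field; apply: lt0r_neq0; lra.
rewrite -mulrA; apply: ler_wpM2l; first exact: ltW.
rewrite mulrC ler_pdivrMr // [leRHS]mulrC ler_pdivlMr; last by lra.
have : eta / (s + 1) * (s + b) <= eta * (1 + b).
  rewrite -mulrA; apply: ler_wpM2l => //; rewrite mulrC ler_pdivrMr; nra.
nra.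
Qed.

End Far.

Section FarBound.
Variables (R : realType).

(** Three consecutive exponents are needed because a multiplier of degree k turns the supersolution
    of exponent a into one of exponent a + k; both must admit the same potential. *)
Lemma avg_shifted_sqn_unif (b : R) : 0 <= b -> exists a N0, forall N, (N0 <= N)%N ->
  forall (k : nat) (n : 'rV[int]_N), (k <= 2)%N ->
  avg (fun m => shifted_sqn R m ^- (a + k)) n <= (1 - b / (shifted_sqn R n + b)) * shifted_sqn R n ^- (a + k).
Proof.
move=> b0; pose a := (Num.truncn b).+1.
have ba k : b < (a + k)%:R.
  by apply: lt_le_trans (truncnS_gt b) _; rewrite ler_nat leq_addr.
have [N0 h0] := avg_shifted_sqn b0 (ba 0%N).
have [N1 h1] := avg_shifted_sqn b0 (ba 1%N).
have [N2 h2] := avg_shifted_sqn b0 (ba 2%N).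
exists a, (N0 + N1 + N2)%N => N hN [|[|[|//]]] n _.
- by apply: h0; lia.
- by apply: h1; lia.
- by apply: h2; lia.
Qed.

Section FixedN.
Variable (N : nat).
Local Notation Z := 'rV[int]_N.
Implicit Types (f g v : Z -> R) (n m : Z).

(** The value at the origin is 0, the inverse of 0, in agreement with the exclusion of n = 0 in
    [hardy_weight]. *)
Definition hardy_wt (l : nat) (n : Z) : R := (sqn n)%:R ^- l.
(** The deficit b / (s + b) of [avg_shifted_sqn] for b = 1000, large enough to be almost 1 on the
    second sphere. *)
Definition hardy_pot (n : Z) : R := 1000 / (shifted_sqn R n + 1000).
(** Equal to 1 at |n|^2 = 2 and, thanks to the shift by 20, still (11/12)^k at |n|^2 = 4: nearly all
    the energy available on the second sphere is kept. *)
Definition power_hardy_wt (k : nat) (n : Z) : R := (22 / shifted_sqn R n) ^+ k.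

Lemma shifted_sqn_gt0 n : 0 < shifted_sqn R n. Proof. by have := shifted_sqn_ge R n; lra. Qed.
Lemma power_hardy_wt_ge0 k n : 0 <= power_hardy_wt k n.
Proof. by rewrite exprn_ge0 // divr_ge0 // ltW // shifted_sqn_gt0. Qed.
Lemma hardy_pot_gt0 n : 0 < hardy_pot n.
Proof. by rewrite divr_gt0 //; have := shifted_sqn_gt0 n; lra. Qed.

Lemma lapn_power_hardy_wt (a k : nat) v : (k <= 2)%N -> fsupp v ->
  (forall (k : nat) (n : 'rV[int]_N), (k <= 2)%N ->
  avg (fun m => shifted_sqn R m ^- (a + k)) n <=
     (1 - 1000 / (shifted_sqn R n + 1000)) * shifted_sqn R n ^- (a + k)) ->
  zsum (fun n => power_hardy_wt k n * hardy_pot n * v n ^+ 2) <= zsum (fun n => power_hardy_wt k n * v n * lapn v n).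
Proof.
move=> k2 fv h.
have e n : power_hardy_wt k n * shifted_sqn R n ^- (a + 0) = 22 ^+ k * shifted_sqn R n ^- (a + k).
  rewrite /power_hardy_wt expr_div_n exprD expr0 mulr1 exprD -mulrA -invfM; congr (_ / _).
  by rewrite mulrC.
(* Here g = s^-a, and psi g is a multiple of s^-(a + k); the exponent is written a + 0 so that [h]
   applies to g as well. *)
apply: (@lapn_lower _ _ (power_hardy_wt k) (fun n => shifted_sqn R n ^- (a + 0)) hardy_pot) => // n.
- exact: power_hardy_wt_ge0.
- by rewrite invr_gt0 exprn_gt0 // shifted_sqn_gt0.
- exact: h.
rewrite e (_ : (fun m => _) = (fun m => 22 ^+ k * shifted_sqn R m ^- (a + k))); last first.
  by apply: funext.
rewrite avgZ [leRHS]mulrCA; apply: ler_wpM2l; first exact: exprn_ge0.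
exact: h.
Qed.

End FixedN.

(* For the second and third powers, complete the square:
   [(T v)^2 >= 2 q v T v - q^2 v^2] with [q = power_wt 1], respectively
   [U (T v)^2 >= 2 q v T v - q^2 v^2 / U] with [q = power_wt 2]. *)
Lemma far_bound (k : nat) : (k <= 2)%N -> exists N0, forall N, (N0 <= N)%N ->
  forall v : 'rV[int]_N -> R, fsupp v -> (forall n, (sqn n <= 1)%N -> v n = 0) ->
  zsum (fun n => 95 / 100 * (power_hardy_wt k n * hardy_pot n) * v n ^+ 2) <=
  zsum (fun n => v n * iter k.+1 (@lapn R N) v n).
Proof.
move=> k2; have [a [N0 H]] := avg_shifted_sqn_unif (ltac:(by []) : 0 <= 1000 :> R).
exists N0 => N hN v fv v0.
have K j w (hj : (j <= 2)%N) (fw : fsupp w) := lapn_power_hardy_wt hj fw (H N hN).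
have fl := fsupp_lapn fv.
have v2 n : v n != 0 -> 22 <= shifted_sqn R n.
  move=> vn; have : (2 <= sqn n)%N.
    by rewrite ltnNge; apply: contra vn => /v0 ->.
  by rewrite -(ler_nat R) /shifted_sqn; lra.
case: k k2 => [|[|[|//]]] k2.
- apply: le_trans (_ : zsum (fun n => power_hardy_wt 0 n * hardy_pot n * v n ^+ 2) <= _).
    apply: le_zsum => [||n]; try by fsupp_tac.
    have := hardy_pot_gt0 n; have := sqr_ge0 (v n); rewrite /power_hardy_wt !mul1r => *; nra.
  apply: le_trans (K 0%N v _ fv) _ => //.
  by rewrite le_eqVlt; apply/orP; left; apply/eqP; apply: eq_zsum => n; rewrite /power_hardy_wt mul1r.
- rewrite /= zsum_mul_lapn //.
  have h1 := K 1%N v isT fv.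
  apply: le_trans (_ : zsum (fun n => 2 * (power_hardy_wt 1 n * v n * lapn v n)) -
      zsum (fun n => power_hardy_wt 1 n ^+ 2 * v n ^+ 2) <= _); last first.
    rewrite -zsumB; try by fsupp_tac.
    apply: le_zsum => [||n]; try by fsupp_tac.
    by have := sqr_ge0 (power_hardy_wt 1 n * v n - lapn v n); lra.
  rewrite zsumZ.
  apply: le_trans (_ : 2 * zsum (fun n => power_hardy_wt 1 n * hardy_pot n * v n ^+ 2) -
      zsum (fun n => power_hardy_wt 1 n ^+ 2 * v n ^+ 2) <= _); last by lra.
  rewrite -zsumZ -zsumB; try by fsupp_tac.
  apply: le_zsum => [||n]; try by fsupp_tac.
  case: (eqVneq (v n) 0) => [->|/v2 s22]; first by rewrite expr0n /= !mulr0; lra.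
  rewrite mulrA -mulrBl; apply: ler_wpM2r; first exact: sqr_ge0.
  rewrite /power_hardy_wt expr1 expr2 /hardy_pot; set s := shifted_sqn R n in s22 *.
  have s0 : 0 < s by lra.
  (* As s >= 22 on the support of v, the square subtracted costs at most 1.022 times the main term,
     which leaves 2 - 1.022 >= 0.95. *)
  have e : 22 / s <= 1022 / 1000 * (1000 / (s + 1000)).
    have -> : 1022 / 1000 * (1000 / (s + 1000)) = 1022 / (s + 1000).
      by field; apply: lt0r_neq0; lra.
    by rewrite ler_pdivrMr // mulrAC ler_pdivlMr; lra.
  have q0 : 0 <= 22 / s by rewrite divr_ge0 // ltW.
  have := ler_wpM2l q0 e.
  have : 0 <= 22 / s * (1000 / (s + 1000)) by rewrite mulr_ge0 // divr_ge0 //; lra.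
  lra.
- rewrite /= zsum_mul_lapn //.
  have h1 := K 2%N v isT fv.
  have h0 := K 0%N _ isT fl.
  apply: le_trans (_ : zsum (fun n => power_hardy_wt 0 n * hardy_pot n * lapn v n ^+ 2) <= _); last first.
    apply: le_trans h0 _; rewrite le_eqVlt; apply/orP; left; apply/eqP.
    by apply: eq_zsum => n; rewrite /power_hardy_wt mul1r.
  apply: le_trans (_ : zsum (fun n => 2 * (power_hardy_wt 2 n * v n * lapn v n)) -
      zsum (fun n => power_hardy_wt 2 n ^+ 2 / hardy_pot n * v n ^+ 2) <= _); last first.
    rewrite -zsumB; try by fsupp_tac.
    apply: le_zsum => [||n]; try by fsupp_tac.
    have U0 := hardy_pot_gt0 n.
    rewrite -subr_ge0 /power_hardy_wt expr0 mul1r -/(power_hardy_wt 2 n).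
    have -> : hardy_pot n * lapn v n ^+ 2 - (2 * (power_hardy_wt 2 n * v n * lapn v n) -
       power_hardy_wt 2 n ^+ 2 / hardy_pot n * v n ^+ 2) =
       (hardy_pot n * lapn v n - power_hardy_wt 2 n * v n) ^+ 2 / hardy_pot n.
      by field; exact: lt0r_neq0.
    by rewrite divr_ge0 ?sqr_ge0 // ltW.
  rewrite zsumZ.
  apply: le_trans (_ : 2 * zsum (fun n => power_hardy_wt 2 n * hardy_pot n * v n ^+ 2) -
      zsum (fun n => power_hardy_wt 2 n ^+ 2 / hardy_pot n * v n ^+ 2) <= _); last by lra.
  rewrite -zsumZ -zsumB; try by fsupp_tac.
  apply: le_zsum => [||n]; try by fsupp_tac.
  case: (eqVneq (v n) 0) => [->|/v2 s22]; first by rewrite expr0n /= !mulr0; lra.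
  rewrite mulrA -mulrBl; apply: ler_wpM2r; first exact: sqr_ge0.
  rewrite /power_hardy_wt /hardy_pot; set s := shifted_sqn R n in s22 *.
  have s0 : 0 < s by lra.
  set U := 1000 / (s + 1000); set q := 22 / s.
  have U0 : 0 < U by rewrite divr_gt0 //; lra.
  (* The cost is q^4 / U = q^2 U (q / U)^2, at most 1.05 q^2 U; exactly 0.95 is left. *)
  have e : q / U <= 1022 / 1000.
    have -> : q / U = 22 * (s + 1000) / (1000 * s).
      by rewrite /q /U; field; rewrite !lt0r_neq0 //; lra.
    by rewrite ler_pdivrMr ?mulr_gt0 //; lra.
  have q0 : 0 <= q by rewrite divr_ge0 // ltW.
  set z := q / U in e *.
  have z0 : 0 <= z by rewrite divr_ge0 // ltW.
  have qz : q = z * U by rewrite /z divfK // lt0r_neq0.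
  have -> : (q ^+ 2) ^+ 2 / U = q ^+ 2 * U * z ^+ 2.
    by rewrite qz; field; exact: lt0r_neq0.
  have p0 : 0 <= q ^+ 2 * U by rewrite mulr_ge0 ?sqr_ge0 // ltW.
  have : z ^+ 2 <= 105 / 100 by nra.
  by move=> /(ler_wpM2l p0); lra.
Qed.

End FarBound.

Section FarWeights.
Variables (R : realType).

(* [theta >= l^2 / far_gain - m] must satisfy [theta / 2 < - c1] in
   [hardy_bounds_of_coefs]; these values leave room for that. *)
Definition far_gain (k : nat) : R := nth 0 [:: 37 / 100; 60 / 100; 75 / 100] k.

Lemma far_weights (k : nat) : (k <= 2)%N -> exists N0, forall N, (N0 <= N)%N ->
  forall v : 'rV[int]_N -> R, fsupp v -> (forall n, (sqn n <= 1)%N -> v n = 0) ->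
  110 / 100 * zsum (fun n => v n ^+ 2 * hardy_wt R k.+1 n) +
  far_gain k * zsum (fun n => v n ^+ 2 * ((sqn n == 2) || (sqn n == 4))%:R) <=
  zsum (fun n => v n * iter k.+1 (@lapn R N) v n).
Proof.
move=> k2; have [N0 h] := far_bound R k2.
exists N0 => N hN v fv v0; apply: le_trans (h N hN v fv v0).
rewrite -!zsumZ -zsumD; try by fsupp_tac.
apply: le_zsum => [||n]; try by fsupp_tac.
case: (leqP (sqn n) 1) => [/v0 ->|]; first by rewrite expr0n /=; lra.
move=> r2; have v2 := sqr_ge0 (v n).
rewrite [leLHS](_ : _ = v n ^+ 2 * (110 / 100 * hardy_wt R k.+1 n +
   far_gain k * ((sqn n == 2) || (sqn n == 4))%:R)); last by ring.
rewrite [leRHS]mulrC; apply: ler_wpM2l => //.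
rewrite /power_hardy_wt /hardy_pot /hardy_wt /shifted_sqn; set b := _ || _.
have [e|/negbTE e] := boolP b; last first.
  rewrite mulr0 addr0.
  have : (2 : R) <= (sqn n)%:R by rewrite ler_nat.
  set t : R := (sqn n)%:R => t2.
  rewrite ler_pdivrMr; last by rewrite exprn_gt0 //; lra.
  (* The ratio to the Hardy weight is a product of functions increasing in t, so t = 2 is the worst
     case. *)
  have -> : 95 / 100 * ((22 / (t + 20)) ^+ k * (1000 / (t + 20 + 1000))) * t ^+ k.+1 =
     950 * t / (t + 1020) * (22 * t / (t + 20)) ^+ k.
    rewrite exprSr !expr_div_n exprMn; field.
    by rewrite expf_neq0 /=; [apply: lt0r_neq0; lra | apply: lt0r_neq0; lra].
  have h1 : 110 / 100 <= 950 * t / (t + 1020) by rewrite ler_pdivlMr; lra.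
  apply: le_trans h1 _; rewrite ler_peMr //; first by apply: divr_ge0; lra.
  by apply: exprn_ege1; rewrite ler_pdivlMr; lra.
have : sqn n = 2%N \/ sqn n = 4%N.
  move: e.
  by case/orP => /eqP; [left | right].
have n22 : 2 + 20 = 22 :> R by lra.
have n24 : 4 + 20 = 24 :> R by lra.
have n1022 : 22 + 1000 = 1022 :> R by lra.
have n1024 : 24 + 1000 = 1024 :> R by lra.
by case: k k2 {h} => [|[|[|//]]] _ [] ->;
  rewrite /far_gain /= ?mulr1n !(exprS, expr0) ?n22 ?n24 ?n1022 ?n1024; lra.
Qed.

End FarWeights.

(** * Decay of averages of functions supported near the origin *)

Section Norms.
Variables (R : realType).

Section FixedN.
Variable N : nat.
Local Notation Z := 'rV[int]_N.
Implicit Types (f g v : Z -> R) (n m : Z).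

(** A step away from the origin multiplies t^|n|_1 by t and a step towards it divides by t; the
    latter exists only in nonzero coordinates, of which there are at most |n|_1. *)
Lemma nbsum_geom (t : R) n : 0 < t ->
  nbsum (fun m => t ^+ l1norm m) n <= (2 * N%:R * t + (l1norm n)%:R / t) * t ^+ l1norm n.
Proof.
move=> t0; rewrite mulrDl /l1norm {3}/coord_sum natr_sum !mulr_suml.
have -> : 2 * N%:R * t * t ^+ coord_sum absz n = \sum_(i < N) 2 * t * t ^+ coord_sum absz n.
  by rewrite sumr_const card_ord -[RHS]mulr_natr -!mulrA; congr (2 * _); rewrite mulrC -mulrA.
rewrite -big_split /=; apply: ler_sum => i _.
have := coord_sum_add absz n i; have := coord_sum_sub absz n i.
set A := coord_sum absz (n - _); set C := coord_sum absz (n + _); set D := coord_sum absz n.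
set z := n ord0 i => hA hC.
have pw k : 0 <= t ^+ k by rewrite exprn_ge0 // ltW.
have [z0|z0] := eqVneq z 0.
  rewrite z0 /= in hA hC *.
  have -> : A = D.+1 by lia.
  have -> : C = D.+1 by lia.
  by rewrite exprS mul0r mul0r addr0 -mulrA -mulr2n mulr_natl.
have up : t ^+ D * t^-1 <= `|z|%:R / t * t ^+ D.
  rewrite mulrC; apply: ler_wpM2r => //.
  by rewrite ler_peMl ?invr_ge0 ?(ltW t0) // ler1n; lia.
have [E1|[E1 E2]] : (C = D.+1 /\ A.+1 = D) \/ (C.+1 = D /\ A = D.+1) by lia.
  case: E1 => -> E2; rewrite -E2 in up *.
  have e : t ^+ A.+1 * t^-1 = t ^+ A by rewrite exprSr mulfK // lt0r_neq0.
  rewrite e in up; rewrite exprS; apply: lerD up.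
  by rewrite -mulrA ler_peMl ?mulr_ge0 ?(ltW t0) // ler1n.
rewrite E2 -E1 in up *.
have e : t ^+ C.+1 * t^-1 = t ^+ C by rewrite exprSr mulfK // lt0r_neq0.
rewrite e in up; rewrite [t ^+ C.+2]exprS [leLHS]addrC; apply: lerD up.
by rewrite -mulrA ler_peMl ?mulr_ge0 ?(ltW t0) // ler1n.
Qed.

Lemma l1norm_add n i : (l1norm (n + evec i) <= (l1norm n).+1)%N.
Proof. by have := coord_sum_add absz n i; rewrite -!/(l1norm _); lia. Qed.
Lemma l1norm_sub n i : (l1norm (n - evec i) <= (l1norm n).+1)%N.
Proof. by have := coord_sum_sub absz n i; rewrite -!/(l1norm _); lia. Qed.

Lemma nbsum_supp f j n : (forall m, (j < l1norm m)%N -> f m = 0) -> (j.+1 < l1norm n)%N ->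
  nbsum f n = 0.
Proof.
move=> h jn; rewrite /nbsum big1 // => i _; rewrite !h ?addr0 //.
- have := l1norm_add (n - evec i) i; rewrite subrK; lia.
- have := l1norm_sub (n + evec i) i; rewrite addrK; lia.
Qed.

Lemma avg_supp f j n : (forall m, (j < l1norm m)%N -> f m = 0) -> (j.+1 < l1norm n)%N ->
  avg f n = 0.
Proof. by move=> h jn; rewrite /avg (nbsum_supp h jn) mulr0. Qed.

(** For t = 1/N the factor of [nbsum_geom] becomes, after averaging, 1/N + |n|_1 / 2. Pointwise
    decay N^-|n|_1 thus survives averaging on a bounded support. *)
Lemma avg_geom f (C : R) j n : (0 < N)%N -> 0 <= C -> (forall m, (j < l1norm m)%N -> f m = 0) ->
  (forall m, `|f m| <= C * invN R N ^+ l1norm m) -> 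
  `|avg f n| <= C * (j%:R + 2) * invN R N ^+ l1norm n.
Proof.
move=> N0 C0 hs h.
have N0' : 0 < N%:R :> R by rewrite ltr0n.
have x0 : 0 < invN R N by rewrite invr_gt0.
have x1 : invN R N <= 1 by rewrite invf_le1 // ler1n.
case: (leqP (l1norm n) j.+1) => jn; last first.
  rewrite (avg_supp hs jn) normr0 !mulr_ge0 ?addr_ge0 // exprn_ge0 //; exact: ltW.
rewrite /avg normrM ger0_norm; last by rewrite divr_ge0 // ltW.
apply: (@le_trans _ _ (invN R N / 2 * nbsum (fun m => C * invN R N ^+ l1norm m) n)).
  apply: ler_wpM2l; first by rewrite divr_ge0 // ltW.
  rewrite /nbsum; apply: le_trans (ler_norm_sum _ _ _) _; apply: ler_sum => i _.
  by apply: le_trans (ler_normD _ _) _; apply: lerD.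
rewrite nbsumZ mulrCA -[leRHS]mulrA; apply: ler_wpM2l => //.
have hx : 0 <= invN R N / 2 by rewrite divr_ge0 // ltW.
apply: le_trans (ler_wpM2l hx (nbsum_geom n x0)) _; rewrite mulrA.
apply: ler_wpM2r; first by rewrite exprn_ge0 // ltW.
have -> : invN R N / 2 * (2 * N%:R * invN R N + (l1norm n)%:R / invN R N) =
   invN R N + (l1norm n)%:R / 2.
  by rewrite /invN; field; exact: lt0r_neq0.
have : ((l1norm n)%:R : R) <= j.+1%:R by rewrite ler_nat.
have : 0 <= (l1norm n)%:R :> R by [].
rewrite -natr1; lra.
Qed.

(* Schur's test with weight [t^|n|], [t = N^(-1/2)]: going up one sphere has
   about [2N] choices, going down at most [|n|]. *)
Lemma avg_norm f j : (0 < N)%N -> fsupp f -> (forall m, (j < l1norm m)%N -> f m = 0) ->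
  zsum (fun n => avg f n ^+ 2) <= (j%:R + 3) ^+ 2 * invN R N * zsum (fun n => f n ^+ 2).
Proof.
move=> N0 ff hs; set x := invN R N.
have N0' : 0 < N%:R :> R by rewrite ltr0n.
pose t := Num.sqrt x; have x0 : 0 < x by rewrite invr_gt0.
have t0 : 0 < t by rewrite sqrtr_gt0.
have tt : t ^+ 2 = x by rewrite sqr_sqrtr // ltW.
have Nx : N%:R = t ^- 2 by rewrite tt /x /invN invrK.
set J : R := j%:R + 3; have J0 : 0 < J by rewrite /J ltr_wpDl.
have fB := fsupp_avg ff.
(* Testing against a multiple of [avg f] makes Schur's bilinear bound quadratic. The factor 1 / (J
   t) balances the two squares and yields 4 |B f|^2 <= |B f|^2 + J^2 x |f|^2. *)
pose v n := avg f n / (J * t).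
have fv : fsupp v by rewrite /v; fsupp_tac.
have hv m : (j.+1 < l1norm m)%N -> v m = 0 by move=> jm; rewrite /v (avg_supp hs jm) mul0r.
have := @schur _ _ (fun=> 1) (fun n => t ^+ l1norm n) f v ff fv _ _.
move=> /(_ (fun=> ler01) (fun n => exprn_gt0 _ t0)).
have -> : zsum (fun n => 1 * v n * nbsum f n) = zsum (fun n => v n * nbsum f n).
  by apply: eq_zsum => n; rewrite mul1r.
have -> : zsum (fun n => 1 * f n * nbsum v n) = zsum (fun n => v n * nbsum f n).
  rewrite (eq_zsum (g := fun n => f n * nbsum v n)); last by move=> n; rewrite mul1r.
  by rewrite zsum_mul_nbsum //; apply: eq_zsum => n; rewrite mulrC.
set L := zsum _; set M := zsum _ => hLM.
have fl : fsupp (fun n => v n * nbsum f n) by fsupp_tac.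
have e1 : L = 2 / (x * J * t) * zsum (fun n => avg f n ^+ 2).
  rewrite -zsumZ; apply: eq_zsum => n; rewrite /v /avg -/x; field.
  by rewrite !lt0r_neq0.
have h2 : M <= J / t * (zsum (fun n => v n ^+ 2) + zsum (fun n => f n ^+ 2)).
  rewrite -zsumD; try by fsupp_tac.
  rewrite -zsumZ; apply: le_zsum => [||n]; try by fsupp_tac.
  case: (leqP (l1norm n) j.+1) => jn; last first.
    by rewrite (hv _ jn) hs ?expr0n /= ?addr0 ?mul0r ?mulr0 //; lia.
  have q0 : 0 <= v n ^+ 2 + f n ^+ 2 by rewrite addr_ge0 // sqr_ge0.
  have -> : (fun m => 1 * t ^+ l1norm m) = (fun m => t ^+ l1norm m) by apply: funext => m; rewrite mul1r.
  rewrite mul1r.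
  have hg : nbsum (fun m => t ^+ l1norm m) n / t ^+ l1norm n <= J / t.
    rewrite ler_pdivrMr ?exprn_gt0 //; apply: le_trans (nbsum_geom n t0) _.
    apply: ler_wpM2r; first by rewrite exprn_ge0 // ltW.
    have -> : 2 * N%:R * t + (l1norm n)%:R / t = (2 + (l1norm n)%:R) / t.
      by rewrite Nx; field; exact: lt0r_neq0.
    apply: ler_wpM2r; first by rewrite invr_ge0 ltW.
    have : ((l1norm n)%:R : R) <= j.+1%:R by rewrite ler_nat.
    rewrite -natr1 /J; lra.
  have := ler_wpM2l q0 hg; lra.
have e3 : zsum (fun n => v n ^+ 2) = (J * t) ^- 2 * zsum (fun n => avg f n ^+ 2).
  rewrite -zsumZ; apply: eq_zsum => n; rewrite /v; field.
  by rewrite !lt0r_neq0.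
rewrite e3 e1 in h2 hLM.
set P := zsum (fun n => avg f n ^+ 2) in h2 hLM *.
set Q := zsum (fun n => f n ^+ 2) in h2 *.
have := le_trans hLM h2.
have p : 0 < t ^+ 3 * J by rewrite mulr_gt0 // exprn_gt0.
move=> /(ler_wpM2l (ltW p)).
have -> : t ^+ 3 * J * (2 / (x * J * t) * P + 2 / (x * J * t) * P) = 4 * P.
  by rewrite -tt; field; rewrite !lt0r_neq0.
have -> : t ^+ 3 * J * (J / t * ((J * t) ^- 2 * P + Q)) = P + J ^+ 2 * x * Q.
  by rewrite -tt; field; rewrite !lt0r_neq0.
have : 0 <= J ^+ 2 * x * Q.
  apply: mulr_ge0; first by rewrite mulr_ge0 ?sqr_ge0 // ltW.
  by apply: zsum_ge0 => n; exact: sqr_ge0.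
lra.
Qed.

End FixedN.
End Norms.

(** * Functions of zero mean on the unit sphere *)

Section Shell1.
Variables (R : realType) (N : nat).
Local Notation Z := 'rV[int]_N.
Implicit Types (f g v y : Z -> R) (n m z : Z).

Lemma l1norm_eq1 n : l1norm n = 1%N -> exists (a : 'I_N) (s : int), (s = 1 \/ s = -1) /\ n = s *: evec a.
Proof.
move=> n1.
have [a na] : exists a, n ord0 a != 0.
  apply/existsP; apply: contraT; rewrite negb_exists => /forallP h.
  have : l1norm n = 0%N by rewrite /l1norm /coord_sum big1 // => i _; have := h i; rewrite negbK => /eqP ->.
  by rewrite n1.
move: n1; rewrite /l1norm /coord_sum (bigD1 a) //= => n1.
move: na; rewrite -absz_gt0 => na.
have a1 : `|n ord0 a|%N = 1%N by lia.
move: n1; rewrite a1 add1n => -[] /eqP; rewrite sum_nat_eq0 => /forallP h.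
exists a, (n ord0 a); split; first by lia.
apply/rowP => j; rewrite mxE evecE; have := h j.
by case: (eqVneq a j) => [->|aj]; rewrite ?mulr1 ?mulr0 //= absz_eq0 => /eqP.
Qed.

Lemma l1norm_evec (a : 'I_N) (s : int) : l1norm (s *: evec a) = `|s|%N.
Proof.
have := coord_sum_move absz 0 a s; rewrite add0r mxE add0r -!/(l1norm _) l1norm_0.
by rewrite /=; lia.
Qed.

Definition delta0 n : R := (n == 0)%:R.

Lemma fsupp_delta m : fsupp (fun n => delta0 (n - m)).
Proof.
apply: (sub_finite_set _ (finite_set1 m)) => n /=; rewrite /delta0 subr_eq0.
by case: (eqVneq n m) => //= _; rewrite eqxx.
Qed.

Lemma zsum_delta f m : zsum (fun n => f n * delta0 (n - m)) = f m.
Proof.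
rewrite (@zsum_seq _ _ _ [fset m]%fset) ?big_seq_fset1 /=.
  by rewrite /delta0 subrr eqxx mulr1.
move=> n; rewrite inE /delta0 subr_eq0; case: (eqVneq n m) => //= _.
by rewrite mulr0 eqxx.
Qed.

Lemma nbsum_shift f m n : nbsum (fun n => f (n - m)) n = nbsum f (n - m).
Proof.
by rewrite /nbsum; apply: eq_bigr => i _; rewrite addrAC [n - _ - _]addrAC.
Qed.

Lemma nbsum_delta n : nbsum delta0 n = (l1norm n == 1%N)%:R.
Proof.
rewrite /nbsum /delta0; case: eqP => [/l1norm_eq1[a [s [s1 ->]]]|n1].
  rewrite (bigD1 a) //= big1 ?addr0.
    have e0 : evec a != 0.
      by apply/eqP => /(congr1 (fun w : Z => w ord0 a)); rewrite evecE eqxx mxE.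
    case: s1 => ->; rewrite ?scale1r ?scaleN1r ?addNr ?subrr ?eqxx /=.
      rewrite (_ : _ == 0 = false) ?add0r //; apply/eqP => /(congr1 (fun w : Z => w ord0 a)).
      by rewrite !mxE !eqxx.
    rewrite (_ : (- _ - _) == 0 = false) ?addr0 //; apply/eqP => /(congr1 (fun w : Z => w ord0 a)).
    by rewrite !mxE !eqxx.
  move=> i ia; have nz (w : Z) : w ord0 a = 0 -> (s *: evec a + w == 0) = false.
    move=> w0; apply/eqP => /(congr1 (fun w : Z => w ord0 a)).
    by rewrite !mxE w0 !eqxx /=; lia.
  by rewrite !nz ?addr0 // !mxE !eqxx eq_sym (negbTE ia) ?oppr0.
rewrite big1 // => i _; rewrite addr_eq0 subr_eq0.
have e (s : int) : `|s|%N = 1%N -> n != s *: evec i.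
  by move=> s1; apply/eqP => nn; apply: n1; rewrite nn l1norm_evec.
by rewrite -(scaleN1r (evec i)) -{2}(scale1r (evec i)) !(negbTE (e _ _)) ?addr0.
Qed.

Lemma zsum_shell1 : zsum (fun n : Z => (l1norm n == 1%N)%:R : R) = 2 * N%:R.
Proof.
have -> : zsum (fun n : Z => (l1norm n == 1%N)%:R : R) = zsum (nbsum delta0).
  by apply: eq_zsum => n; rewrite nbsum_delta.
rewrite zsum_nbsum.
  have := zsum_delta (fun=> 1) 0 => h.
  rewrite (_ : zsum delta0 = 1) ?mulr1 // -[RHS]h.
  by apply: eq_zsum => n; rewrite mul1r subr0.
by apply: fsupp_sub (fsupp_delta 0) _ => n; rewrite subr0.
Qed.

(** Counts two-step paths from the origin to z by their last step: 2 for e_i + e_j and 1 for 2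
    e_i. *)
Lemma nbsum2_delta z : l1norm z = 2%N ->
  nbsum (nbsum delta0) z = \sum_i (z ord0 i != 0)%:R.
Proof.
move=> z2; rewrite {1}/nbsum; apply: eq_bigr => i _; rewrite !nbsum_delta.
have := coord_sum_add absz z i; have := coord_sum_sub absz z i; rewrite -!/(l1norm _) z2.
set A := l1norm _; set C := l1norm _; set w := z ord0 i => h1 h2.
have [w0|[w0|w0]] : w = 0 \/ w < 0 \/ 0 < w by lia.
- have -> : (A == 1%N) = false by lia.
  have -> : (C == 1%N) = false by lia.
  by rewrite w0 eqxx /= addr0.
- have -> : (A == 1%N) = false by lia.
  have -> : (C == 1%N) = true by lia.
  have -> : (w != 0) = true by lia.
  by rewrite /= addr0.
- have -> : (A == 1%N) = true by lia.
  have -> : (C == 1%N) = false by lia.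
  have -> : (w != 0) = true by lia.
  by rewrite /= add0r.
Qed.

(** The number of two-step paths from n to m is 2 in general, 1 between antipodal points and 2N for
    a return. *)
Lemma nbsum2_delta_shell1 m n : l1norm m = 1%N -> l1norm n = 1%N ->
  nbsum (nbsum delta0) (m - n) =
    2 - delta0 (m - - n) + (2 * N%:R - 2) * delta0 (m - n).
Proof.
move=> /l1norm_eq1[a [s [s1 ->]]] /l1norm_eq1[b [t [t1 ->]]].
have t0 : t != 0 by lia.
have s0 : s != 0 by lia.
have [<-|ab] := eqVneq a b.
  rewrite -scalerBl opprK -scalerDl /delta0.
  have ez (w : int) : (w *: evec a == 0) = (w == 0).
    apply/eqP/eqP => [/(congr1 (fun w : Z => w ord0 a))|->]; last by rewrite scale0r.
    by rewrite mxE evecE eqxx mulr1 mxE.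
  rewrite !ez; have [st|st] := eqVneq s t.
    rewrite st subrr scale0r (_ : (t + t == 0) = false); last by lia.
    rewrite {1}/nbsum eqxx subr0 mulr1 addrC subrK.
    rewrite (eq_bigr (fun=> 2)); first by rewrite sumr_const card_ord -[LHS]mulr_natr.
    move=> i _; rewrite !nbsum_delta add0r sub0r.
    by rewrite -scaleN1r -[evec i in X in X + _]scale1r !l1norm_evec.
  rewrite nbsum2_delta; last by rewrite l1norm_evec; lia.
  rewrite (bigD1 a) //= big1 ?addr0; last first.
    by move=> i ia; rewrite mxE evecE [a == i]eq_sym (negbTE ia) mulr0 eqxx.
  have hst : (s - t == 0) = false by lia.
  rewrite mxE evecE eqxx mulr1 hst.
  by rewrite (_ : (s + t == 0) = true); [rewrite mulr0 addr0 /=; lra | lia].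
have zc (w : int) : (s *: evec a + w *: evec b) ord0 a = s.
  by rewrite !mxE !eqxx (negbTE ab) mulr0 addr0 mulr1.
have nz (w : int) : delta0 (s *: evec a + w *: evec b) = 0.
  rewrite /delta0; case: eqP => // /(congr1 (fun w : Z => w ord0 a)).
  by rewrite zc mxE => /eqP; rewrite (negbTE s0).
rewrite opprK nz -scaleNr nz mulr0 addr0 subr0.
rewrite nbsum2_delta; last first.
  have := coord_sum_move absz (s *: evec a) b (- t); rewrite -!/(l1norm _) l1norm_evec.
  rewrite mxE evecE (negbTE ab) mulr0 /=. rewrite sub0r abszN addn0 => ->.
  by case: s1 => ->; case: t1 => ->.
have ba : b != a by rewrite eq_sym.
rewrite (bigD1 a) //= (bigD1 b) //= big1 => [|i /andP[ia ib]]; last first.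
  by rewrite !mxE !eqxx (negbTE ia) (negbTE ib) !mulr0 addr0 eqxx.
rewrite zc s0 !mxE !eqxx (negbTE ba) mulr0 add0r mulr1 oppr_eq0 t0 addr0.
by rewrite -natrD.
Qed.

(* On the unit shell the kernel of [nbsum \o nbsum] is the constant 2 up to the
   two points [m = n] and [m = - n], so zero mean removes its large part. *)
Lemma nbsum_norm_shell1 y : fsupp y -> (forall n, l1norm n != 1%N -> y n = 0) ->
  zsum y = 0 -> zsum (fun n => nbsum y n ^+ 2) <= 2 * N%:R * zsum (fun n => y n ^+ 2).
Proof.
move=> fy sy y0.
have fA := fsupp_nbsum fy.
have e n : l1norm n = 1%N -> nbsum (nbsum y) n = (2 * N%:R - 2) * y n - y (- n).
  move=> n1; rewrite -(zsum_delta (nbsum (nbsum y)) n) -zsum_mul_nbsum //.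
  rewrite -zsum_mul_nbsum //.
  rewrite (eq_zsum (g := fun m => 2 * y m - y m * delta0 (m - - n)
     + (2 * N%:R - 2) * (y m * delta0 (m - n)))); last first.
    move=> m; have [m1|m1] := eqVneq (l1norm m) 1%N; last by rewrite sy // !mul0r !mulr0; lra.
    rewrite (_ : nbsum (fun w => delta0 (w - n)) = (fun w => nbsum delta0 (w - n))).
      by rewrite nbsum_shift nbsum2_delta_shell1 //; ring.
    by apply: funext => w; rewrite nbsum_shift.
  rewrite zsumD ?zsumB; try by fsupp_tac.
  by rewrite !zsumZ !zsum_delta y0; ring.
rewrite (eq_zsum (g := fun n => nbsum y n * nbsum y n)); last by move=> n; rewrite expr2.
rewrite -zsum_mul_nbsum //.
pose w n := y (- n).
have fN : fsupp w by apply: (fsupp_reindex (q := -%R)) => // n; rewrite opprK.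
rewrite (eq_zsum (g := fun n => (2 * N%:R - 2) * y n ^+ 2 - y n * w n)); last first.
  move=> n; have [n1|n1] := eqVneq (l1norm n) 1%N; last by rewrite sy // expr0n /=; ring.
  by rewrite e // /w; ring.
apply: le_trans (_ : zsum (fun n => (2 * N%:R - 2) * y n ^+ 2 +
    (1 / 2 * y n ^+ 2 + 1 / 2 * w n ^+ 2)) <= _).
  apply: le_zsum => [||n]; try by fsupp_tac.
  by have := sqr_ge0 (y n + w n); lra.
have e2 : zsum (fun n => w n ^+ 2) = zsum (fun n => y n ^+ 2).
  by apply: (@zsum_reindex _ _ (fun n => y n ^+ 2) -%R -%R) => n; rewrite opprK.
rewrite !zsumD; try by fsupp_tac.
rewrite !zsumZ e2.
have : 0 <= zsum (fun n => y n ^+ 2) by apply: zsum_ge0 => n; exact: sqr_ge0.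
by lra.
Qed.

(** For comparison, the indicator of the unit sphere has ratio about 3 / (2N), the origin of the
    term [3 / 2 * m] in the coefficient c1. *)
Lemma avg_norm_shell1 y : (0 < N)%N -> fsupp y -> (forall n, l1norm n != 1%N -> y n = 0) ->
  zsum y = 0 -> zsum (fun n => avg y n ^+ 2) <= invN R N / 2 * zsum (fun n => y n ^+ 2).
Proof.
move=> N0 fy sy y0; have N0' : 0 < N%:R :> R by rewrite ltr0n.
rewrite (eq_zsum (g := fun n => (invN R N / 2) ^+ 2 * nbsum y n ^+ 2)); last first.
  by move=> n; rewrite /avg exprMn.
rewrite zsumZ; apply: le_trans (ler_wpM2l (sqr_ge0 _) (nbsum_norm_shell1 fy sy y0)) _.
rewrite mulrA le_eqVlt; apply/orP; left; apply/eqP; congr (_ * _).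
by rewrite /invN; field; exact: lt0r_neq0.
Qed.

End Shell1.

(** * Cubic polynomials in the averaging operator *)

Section AvgCubic.
Variables (R : realType) (N : nat).
Local Notation Z := 'rV[int]_N.
Local Notation hN := (invN R N).
Implicit Types (f g v y : Z -> R) (n m z : Z).

(* [(l, m, p)] is [(1, 0, 0)], [(2, 1, 0)] or [(3, 3, 1)] for the first three powers
   of [1 - avg]. *)
Definition avg_cubic (l m p : R) f n : R :=
  f n - l * avg f n + m * avg (avg f) n - p * avg (avg (avg f)) n.

Lemma avgD_fun f g : avg (fun m => f m + g m) = (fun n => avg f n + avg g n).
Proof. by apply: funext => n; rewrite avgD. Qed.
Lemma avgB_fun f g : avg (fun m => f m - g m) = (fun n => avg f n - avg g n).
Proof. by apply: funext => n; rewrite avgB. Qed.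
Lemma avgZ_fun c f : avg (fun m => c * f m) = (fun n => c * avg f n).
Proof. by apply: funext => n; rewrite avgZ. Qed.

Variables l m p : R.
Local Notation K := (avg_cubic l m p).

Lemma fsupp_avg_cubic f : fsupp f -> fsupp (K f).
Proof. by move=> ff; rewrite /avg_cubic; fsupp_tac. Qed.

Lemma avg_cubicD f g n : K (fun m => f m + g m) n = K f n + K g n.
Proof. by rewrite /avg_cubic !avgD_fun; ring. Qed.
Lemma avg_cubicZ c f n : K (fun m => c * f m) n = c * K f n.
Proof. by rewrite /avg_cubic !avgZ_fun; ring. Qed.

Lemma zsum_avg_cubic_expand f g : fsupp f -> zsum (fun n => f n * K g n) =
  zsum (fun n => f n * g n) - l * zsum (fun n => f n * avg g n)
  + m * zsum (fun n => f n * avg (avg g) n) - p * zsum (fun n => f n * avg (avg (avg g)) n).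
Proof.
move=> ff; rewrite -!zsumZ -zsumB; try by fsupp_tac.
rewrite -zsumD; try by fsupp_tac.
rewrite -zsumB; try by fsupp_tac.
by apply: eq_zsum => n; rewrite /avg_cubic; ring.
Qed.

Lemma zsum_mul_avg_cubic f g : fsupp f -> fsupp g ->
  zsum (fun n => f n * K g n) = zsum (fun n => K f n * g n).
Proof.
move=> ff fg; rewrite zsum_avg_cubic_expand //.
rewrite (eq_zsum (f := fun n => K f n * g n) (g := fun n => g n * K f n)); last first.
  by move=> n; rewrite mulrC.
rewrite zsum_avg_cubic_expand //.
have c f1 f2 : zsum (fun n : Z => f1 n * f2 n : R) = zsum (fun n => f2 n * f1 n).
  by apply: eq_zsum => n; rewrite mulrC.
have fa := fsupp_avg ff; have ga := fsupp_avg fg.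
have faa := fsupp_avg fa; have gaa := fsupp_avg ga.
congr (_ - _ * _ + _ * _ - _ * _); first exact: c.
- by rewrite (zsum_mul_avg _ ff); exact: c.
- by rewrite (zsum_mul_avg _ ff) (zsum_mul_avg _ fa); exact: c.
- by rewrite (zsum_mul_avg _ ff) (zsum_mul_avg _ fa) (zsum_mul_avg _ faa); exact: c.
Qed.

End AvgCubic.

Section Parity.
Variables (R : realType) (N : nat).
Local Notation Z := 'rV[int]_N.
Implicit Types (f g v y : Z -> R) (n m z : Z).

Lemma odd_l1norm_add n i : odd (l1norm (n + evec i)) = ~~ odd (l1norm n).
Proof.
have := coord_sum_add absz n i; rewrite -!/(l1norm _) => h.
have [->|->] : l1norm (n + evec i) = (l1norm n).+1 \/ l1norm n = (l1norm (n + evec i)).+1 by lia.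
- by rewrite oddS.
- by rewrite oddS negbK.
Qed.

Lemma odd_l1norm_sub n i : odd (l1norm (n - evec i)) = ~~ odd (l1norm n).
Proof. by have := odd_l1norm_add (n - evec i) i; rewrite subrK => ->; rewrite negbK. Qed.

(** The lattice is bipartite. This removes the odd powers of [avg] from the energy of a function on
    the unit sphere. *)
Lemma avg_parity f (b : bool) : (forall n, odd (l1norm n) = b -> f n = 0) ->
  forall n, odd (l1norm n) = ~~ b -> avg f n = 0.
Proof.
move=> h n nb; rewrite /avg /nbsum big1 ?mulr0 // => i _.
by rewrite !h ?addr0 ?odd_l1norm_add ?odd_l1norm_sub ?nb ?negbK.
Qed.

Lemma odd_sqn n : odd (sqn n) = odd (l1norm n).
Proof.
rewrite /sqn /l1norm /coord_sum; elim/big_rec2: _ => // i a b _ h.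
by rewrite !oddD h oddX.
Qed.

Lemma sqn_l1norm_2 n : l1norm n = 2%N -> (sqn n == 2%N) || (sqn n == 4%N).
Proof.
move=> n2; have := odd_sqn n; have := l1norm_sqn n; have := sqn_l1norm n; rewrite n2.
by case: (sqn n) => [|[|[|[|[|]]]]].
Qed.

(** From |n|^2 <= |n|_1^2 and 2 (k + 1) <= 6: a single exponent serves the three powers. *)
Lemma hardy_wt_ge k n (j : nat) : (k <= 2)%N -> (0 < l1norm n)%N -> (l1norm n <= j)%N ->
  j%:R ^- 6 <= hardy_wt R k.+1 n.
Proof.
move=> k2 n0 nj; have s0 : (0 < sqn n)%N := leq_trans n0 (l1norm_sqn n).
have j0 : (0 < j)%N := leq_trans n0 nj.
rewrite /hardy_wt lef_pV2 ?posrE ?exprn_gt0 ?ltr0n //.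
apply: (@le_trans _ _ ((j ^ 2)%:R ^+ k.+1)).
  rewrite ler_pXn2r ?nnegrE ?ler0n // ler_nat.
  by apply: leq_trans (sqn_l1norm n) _; rewrite leq_sqr.
rewrite natrX -exprM; apply: ler_weXn2l; first by rewrite ler1n.
lia.
Qed.

Lemma hardy_wt_ge0 k n : 0 <= hardy_wt R k n.
Proof. by rewrite /hardy_wt invr_ge0 exprn_ge0. Qed.

End Parity.

Section Gap.
Variables (R : realType) (k : nat) (l m p mu theta : R).
Hypotheses (k2 : (k <= 2)%N) (mu0 : 0 < mu) (theta0 : 0 <= theta)
  (hth : l ^+ 2 / mu - m <= theta).

(** In [gap], 640^2 = 100 * 4^6 is the price of a cross term paid with 1/100 of the Hardy weight,
    which is at least 4^-6 at norms up to 4; 25/2 and 450 bound |B^2 y|^2 and |B^3 y|^2 on the unit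
    sphere part. *)
Definition gap_const : R := 640 ^+ 2 * (25 / 2 * m ^+ 2 + 450 * p ^+ 2).

Variable N : nat.
Local Notation Z := 'rV[int]_N.
Local Notation hN := (invN R N).
Hypothesis N0 : (0 < N)%N.
Hypothesis far : forall v : Z -> R, fsupp v -> (forall n, (sqn n <= 1)%N -> v n = 0) ->
  110 / 100 * zsum (fun n => v n ^+ 2 * hardy_wt R k.+1 n) +
  mu * zsum (fun n => v n ^+ 2 * ((sqn n == 2) || (sqn n == 4))%:R) <=
  zsum (fun n => v n * avg_cubic l m p v n).

(* Without the radial mode, the second-order correction on the unit sphere costs
   only [theta / 2 * hN], strictly less than [- c1 * hN]. *)
Lemma gap (y : Z -> R) : fsupp y -> y 0 = 0 ->
  zsum (fun n => (l1norm n == 1%N)%:R * y n) = 0 ->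
  (1 - theta / 2 * hN - gap_const * hN ^+ 2) * zsum (fun n => (l1norm n == 1%N)%:R * y n ^+ 2) +
  108 / 100 * zsum (fun n => (2 <= l1norm n)%N%:R * y n ^+ 2 * hardy_wt R k.+1 n) <=
  zsum (fun n => y n * avg_cubic l m p y n).
Proof.
move=> fy y0 ys.
pose y1 (n : Z) := (l1norm n == 1%N)%:R * y n.
pose v (n : Z) := (2 <= l1norm n)%N%:R * y n.
have f1 : fsupp y1 by apply: fsuppMr.
have fv : fsupp v by apply: fsuppMr.
have yE : y = fun n => y1 n + v n.
  apply: funext => n; rewrite /y1 /v.
  have [n0|n0] := eqVneq (l1norm n) 0%N; first by rewrite (l1norm_eq0 n0) y0; ring.
  case: (eqVneq (l1norm n) 1%N) => [->|n1]; first by rewrite mul1r mul0r addr0.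
  by rewrite mul0r add0r (_ : (1 < l1norm n)%N = true) ?mul1r //; lia.
pose b1 := avg y1; pose b2 := avg b1; pose b3 := avg b2.
have fb1 : fsupp b1 := fsupp_avg f1.
have fb2 : fsupp b2 := fsupp_avg fb1.
have fb3 : fsupp b3 := fsupp_avg fb2.
have s1 n : l1norm n != 1%N -> y1 n = 0 by move=> /negbTE h; rewrite /y1 h mul0r.
have s1' n : (1 < l1norm n)%N -> y1 n = 0 by move=> h; apply: s1; lia.
have sb1 n : (2 < l1norm n)%N -> b1 n = 0 := avg_supp s1'.
have sb2 n : (3 < l1norm n)%N -> b2 n = 0 := avg_supp sb1.
have sb3 n : (4 < l1norm n)%N -> b3 n = 0 := avg_supp sb2.
have o1 n : odd (l1norm n) = false -> y1 n = 0.
  by move=> h; apply: s1; apply/eqP => h1; rewrite h1 in h.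
have ob1 n : odd (l1norm n) = true -> b1 n = 0 by move: n; exact: avg_parity o1.
have ob2 n : odd (l1norm n) = false -> b2 n = 0 by move: n; exact: avg_parity ob1.
have ob3 n : odd (l1norm n) = true -> b3 n = 0 by move: n; exact: avg_parity ob2.
pose Y := zsum (fun n => y1 n ^+ 2).
have Y0 : 0 <= Y by apply: zsum_ge0 => n; exact: sqr_ge0.
have x0 : 0 < hN by rewrite invr_gt0 ltr0n.
have x1 : hN <= 1 by rewrite invf_le1 ?ltr0n // ler1n.
pose B1 := zsum (fun n => b1 n ^+ 2).
pose B2 := zsum (fun n => b2 n ^+ 2).
pose B3 := zsum (fun n => b3 n ^+ 2).
have hB1 : B1 <= hN / 2 * Y by apply: avg_norm_shell1.
have hB2 : B2 <= 25 * hN * B1.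
  have := avg_norm N0 fb1 sb1; rewrite -/b2 -/B2 -/B1.
  by rewrite (_ : (2%:R + 3) ^+ 2 = 25 :> R) //; lra.
have hB3 : B3 <= 36 * hN * B2.
  have := avg_norm N0 fb2 sb2; rewrite -/b3 -/B3 -/B2.
  by rewrite (_ : (3%:R + 3) ^+ 2 = 36 :> R) //; lra.
have xY : 0 <= hN ^+ 2 * Y by rewrite mulr_ge0 // sqr_ge0.
have hB2' : B2 <= 25 / 2 * (hN ^+ 2 * Y).
  have := ler_wpM2l (ltac:(lra) : 0 <= 25 * hN) hB1; lra.
have hB3' : B3 <= 450 * (hN ^+ 2 * Y).
  have h := ler_wpM2l (ltac:(lra) : 0 <= 36 * hN) hB2'.
  have h' := ler_wpM2r xY x1; lra.
(* The terms in l and p vanish by parity. *)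
have e11 : zsum (fun n => y1 n * avg_cubic l m p y1 n) = Y + m * B1.
  rewrite zsum_avg_cubic_expand //.
  have -> : zsum (fun n => y1 n * avg y1 n) = 0.
    rewrite -[RHS](@zsum0 R Z); apply: eq_zsum => n.
    by case h : (odd (l1norm n)); rewrite -/b1; [rewrite ob1 ?mulr0 | rewrite o1 ?mul0r].
  have -> : zsum (fun n => y1 n * avg (avg (avg y1)) n) = 0.
    rewrite -[RHS](@zsum0 R Z); apply: eq_zsum => n.
    by case h : (odd (l1norm n)); rewrite -/b1 -/b2 -/b3; [rewrite ob3 ?mulr0 | rewrite o1 ?mul0r].
  rewrite zsum_mul_avg // -/b1.
  rewrite (eq_zsum (g := fun n => y1 n ^+ 2)); last by move=> n; rewrite expr2.
  rewrite (eq_zsum (f := fun n => b1 n * b1 n) (g := fun n => b1 n ^+ 2)); last by move=> n; rewrite expr2.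
  by rewrite -/Y -/B1; ring.
pose D := zsum (fun n => v n ^+ 2 * ((sqn n == 2) || (sqn n == 4))%:R).
pose V := zsum (fun n => v n ^+ 2 * hardy_wt R k.+1 n).
have v0 n : (l1norm n <= 1)%N -> v n = 0.
  by move=> h; rewrite /v ltnNge h mul0r.
(* The only cross term of leading order. [b1] lives on norms up to 2, where v is nonzero only on the
   second sphere, so the gain mu D of the far region completes the square; together with the term m
   B1 the cost is (l^2 / mu - m) B1 <= theta B1. *)
have c1 : 2 * l * zsum (fun n => v n * b1 n) <= mu * D + l ^+ 2 / mu * B1.
  rewrite -!zsumZ -zsumD; try by fsupp_tac.
  apply: le_zsum => [||n]; try by fsupp_tac.
  have q0 : 0 <= l ^+ 2 / mu * b1 n ^+ 2.
    by rewrite mulr_ge0 ?sqr_ge0 // divr_ge0 ?sqr_ge0 // ltW.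
  have [n1|n1] := leqP (l1norm n) 1; first by rewrite (v0 _ n1) expr0n /=; lra.
  have [n2|n2] := leqP 3 (l1norm n).
    rewrite sb1 // expr0n /= !mulr0 addr0 mulr_ge0 ?(ltW mu0) //.
    by rewrite mulr_ge0 // sqr_ge0.
  have n3 : l1norm n = 2%N by apply/eqP; rewrite eqn_leq n1 -ltnS n2.
  rewrite (sqn_l1norm_2 n3) mulr1 -subr_ge0.
  have -> : mu * v n ^+ 2 + l ^+ 2 / mu * b1 n ^+ 2 - 2 * l * (v n * b1 n) =
     (mu * v n - l * b1 n) ^+ 2 / mu by field; exact: lt0r_neq0.
  by rewrite divr_ge0 ?sqr_ge0 // ltW.
have c2 (q : R) (b : Z -> R) : fsupp b -> (forall n, (4 < l1norm n)%N -> b n = 0) ->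
   2 * q * zsum (fun n => v n * b n) <= 1 / 100 * V + 640 ^+ 2 * q ^+ 2 * zsum (fun n => b n ^+ 2).
  move=> fb sb; rewrite -!zsumZ -zsumD; try by fsupp_tac.
  apply: le_zsum => [||n]; try by fsupp_tac.
  have q0 : 0 <= 640 ^+ 2 * q ^+ 2 * b n ^+ 2 by apply: mulr_ge0; [apply: mulr_ge0|]; apply: sqr_ge0.
  have [n1|n1] := leqP (l1norm n) 1; first by rewrite (v0 _ n1) expr0n /=; lra.
  have [n2|n2] := ltnP 4 (l1norm n).
    rewrite sb // expr0n /= !mulr0 addr0; apply: mulr_ge0; first by lra.
    by apply: mulr_ge0; [exact: sqr_ge0 | exact: hardy_wt_ge0].
  have w0 := hardy_wt_ge R k2 (ltnW n1) n2.
  have := ler_wpM2l (sqr_ge0 (v n)) w0.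
  have -> : 4%:R ^- 6 = 1 / 4096 :> R by rewrite !exprS expr0; field.
  have := sqr_ge0 (v n / 640 - 640 * (q * b n)); lra.
have c3 : zsum (fun n => v n * avg_cubic l m p y1 n) =
   - (l * zsum (fun n => v n * b1 n)) + m * zsum (fun n => v n * b2 n)
   - p * zsum (fun n => v n * b3 n).
  rewrite zsum_avg_cubic_expand // -/b1 -/b2 -/b3.
  rewrite (_ : zsum (fun n => v n * y1 n) = 0) ?sub0r //.
  rewrite -[RHS](@zsum0 R Z); apply: eq_zsum => n.
  by have [n1|n1] := leqP (l1norm n) 1; [rewrite (v0 n n1) mul0r | rewrite (s1' n n1) mulr0].
have fK := fsupp_avg_cubic l m p fv; have fK1 := fsupp_avg_cubic l m p f1.
have tot : zsum (fun n => y n * avg_cubic l m p y n) =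
   zsum (fun n => y1 n * avg_cubic l m p y1 n) + 2 * zsum (fun n => v n * avg_cubic l m p y1 n)
   + zsum (fun n => v n * avg_cubic l m p v n).
  have sy : zsum (fun n => v n * avg_cubic l m p y1 n) = zsum (fun n => y1 n * avg_cubic l m p v n).
    by rewrite zsum_mul_avg_cubic //; apply: eq_zsum => n; rewrite mulrC.
  rewrite mulr_natl mulr2n {2}sy -!zsumD; try by fsupp_tac.
  by apply: eq_zsum => n; rewrite {2}yE avg_cubicD yE; ring.
have fr := far fv.
have -> : zsum (fun n => (l1norm n == 1%N)%:R * y n ^+ 2) = Y.
  apply: eq_zsum => n; rewrite /y1 exprMn -natrX.
  by case: (l1norm n == 1%N); rewrite ?expr0n ?expr1n.
have -> : zsum (fun n => (2 <= l1norm n)%N%:R * y n ^+ 2 * hardy_wt R k.+1 n) = V.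
  apply: eq_zsum => n; rewrite /v exprMn -natrX.
  by case: (2 <= l1norm n)%N; rewrite ?expr0n ?expr1n.
rewrite tot e11 c3.
have h2 := c2 (- m) _ fb2 (fun n h => sb2 n (ltnW h)).
have h3 := c2 p _ fb3 sb3.
have fr' : 110 / 100 * V + mu * D <= zsum (fun n => v n * avg_cubic l m p v n).
  by apply: fr => n h; apply: v0; exact: leq_trans (l1norm_sqn n) h.
have B10 : 0 <= B1 by apply: zsum_ge0 => n; exact: sqr_ge0.
have t1 := ler_wpM2r B10 hth.
have t2 := ler_wpM2l theta0 hB1.
have t3 := ler_wpM2l (sqr_ge0 m) hB2'.
have t4 := ler_wpM2l (sqr_ge0 p) hB3'.
rewrite -/B2 in h2; rewrite -/B3 in h3.
move: h2 h3 c1 fr' t1 t2 t3 t4; rewrite sqrrN /gap_const.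
set q1 := zsum (fun n => v n * b1 n); set q2 := zsum (fun n => v n * b2 n).
set q3 := zsum (fun n => v n * b3 n); set q4 := zsum _.
move: B1 B2 B3 V D Y q1 q2 q3 q4 {e11 c2 c3 tot fr hB1 hB2 hB3 Y0 hB2' hB3' xY B10} => *.
lra.
Qed.

End Gap.

(** * Functions depending only on the multiset of absolute coordinates *)

Section Types.
Variables (R : realType) (N : nat).
Local Notation Z := 'rV[int]_N.
Local Notation hN := (invN R N).
Implicit Types (f g v y : Z -> R) (n m z : Z).

Definition abs_count (j : nat) n : nat := coord_sum (fun a => `|a|%N == j : nat) n.

Definition typefun := nat -> nat -> nat -> nat -> nat -> R.

Definition at_type (F : typefun) n : R :=
  F (abs_count 1 n) (abs_count 2 n) (abs_count 3 n) (abs_count 4 n) (abs_count 5 n).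

(* One coordinate of absolute value [u] becomes [w]; the truncated subtraction is
   harmless because it is only used when such a coordinate exists. *)
Definition retype (F : typefun) (u w a b c d e : nat) : R :=
  F (a + (w == 1) - (u == 1))%coq_nat
    (b + (w == 2) - (u == 2))%coq_nat
    (c + (w == 3) - (u == 3))%coq_nat
    (d + (w == 4) - (u == 4))%coq_nat
    (e + (w == 5) - (u == 5))%coq_nat.

(* Tests [a] before multiplying, so that simplification discards empty classes. *)
Definition wscale (a : nat) (t : R) : R := if a is 0%N then 0 else a%:R * t.

Lemma wscaleE a t : wscale a t = a%:R * t.
Proof. by case: a => //=; rewrite mul0r. Qed.

(** A zero coordinate moves to absolute value 1 in two ways, a nonzero one moves once up and once
    down. The [coq_nat] operations let simplification evaluate concrete types. *)
Definition type_nbsum (F : typefun) : typefun := fun a b c d e =>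
  (N%:R - (a + b + c + d)%coq_nat%:R) * (2 * retype F 0 1 a b c d e) +
  wscale a (retype F 1 2 a b c d e + retype F 1 0 a b c d e) +
  wscale b (retype F 2 3 a b c d e + retype F 2 1 a b c d e) +
  wscale c (retype F 3 4 a b c d e + retype F 3 2 a b c d e) +
  wscale d (retype F 4 5 a b c d e + retype F 4 3 a b c d e).

Lemma sum_by_abs (G : nat -> R) n : (forall i, `|n ord0 i| <= 4)%N ->
  \sum_i G `|n ord0 i|%N = \sum_(j < 5) (abs_count j n)%:R * G j.
Proof.
move=> h.
have -> : \sum_(j < 5) (abs_count j n)%:R * G j =
   \sum_(j < 5) \sum_i (`|n ord0 i|%N == j)%:R * G j.
  by apply: eq_bigr => j _; rewrite /abs_count /coord_sum natr_sum mulr_suml.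
rewrite exchange_big /=; apply: eq_bigr => i _.
have := h i; case: (`|n ord0 i|%N) => [|[|[|[|[|//]]]]] _;
  by rewrite !big_ord_recr big_ord0 /= ?mul0r ?mul1r ?addr0 ?add0r.
Qed.

Lemma retypeP (F : typefun) n m (u w : nat) :
  (forall j, abs_count j m + (u == j) = abs_count j n + (w == j))%N ->
  at_type F m = retype F u w (abs_count 1 n) (abs_count 2 n) (abs_count 3 n) (abs_count 4 n) (abs_count 5 n).
Proof.
move=> h; rewrite /at_type /retype.
have e j : abs_count j m = (abs_count j n + (w == j) - (u == j))%coq_nat.
  have := h j.
  lia.
by rewrite !e.
Qed.

Definition has_type (M : nat) f (F : typefun) :=
  forall n, (forall i, `|n ord0 i| <= M)%N -> f n = at_type F n.

Lemma abs_move_le (M : nat) n i j a : (forall i, `|n ord0 i| <= M)%N -> (`|a| <= 1)%N ->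
  (`|(n + a *: evec i)%R ord0 j| <= M.+1)%N.
Proof.
move=> h a1; rewrite !mxE eqxx /=; have := h j; case: (j == i) => /=; rewrite ?mulr1 ?mulr0; lia.
Qed.

(* Only coordinates up to 5 are counted, so each neighbour sum costs one unit of
   validity. *)
Lemma has_type_nbsum M f F : (M <= 4)%N -> has_type M.+1 f F ->
  has_type M (nbsum f) (type_nbsum F).
Proof.
move=> M4 hf n hn.
pose a := abs_count 1 n; pose b := abs_count 2 n; pose c := abs_count 3 n; pose d := abs_count 4 n; pose e := abs_count 5 n.
pose G u := if u is u'.+1 then retype F u u.+1 a b c d e + retype F u u' a b c d e
            else 2 * retype F 0 1 a b c d e.
have hn4 i : (`|n ord0 i| <= 4)%N by exact: leq_trans (hn i) M4.
have fG i : f (n + evec i) + f (n - evec i) = G `|n ord0 i|%N.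
  have mv (s : int) : (`|s| <= 1)%N -> f (n + s *: evec i) =
     retype F `|n ord0 i|%N `|(n ord0 i + s)%R|%N a b c d e.
    move=> s1; rewrite hf; last by move=> j; apply: abs_move_le.
    apply: retypeP => j; exact: coord_sum_move.
  have := mv 1 isT; have := mv (-1) isT; rewrite scale1r scaleN1r => -> ->.
  move: (n ord0 i) => z.
  case e0 : (`|z|%N) => [|u] /=.
    have -> : z = 0 by lia.
    by rewrite /= mulr_natl mulr2n.
  have [z0|z0] : z = u.+1%:Z \/ z = - u.+1%:Z by lia.
    have -> : `|(z + 1)%R|%N = u.+2 by lia.
    by have -> : `|(z + -1)%R|%N = u by lia.
  have -> : `|(z + 1)%R|%N = u by lia.
  have -> : `|(z + -1)%R|%N = u.+2 by lia.
  by rewrite addrC.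
rewrite /nbsum (eq_bigr _ (fun i _ => fG i)) sum_by_abs //.
rewrite !big_ord_recr big_ord0 /= add0r.
have N4 : N%:R = (abs_count 0 n)%:R + (abs_count 1 n)%:R + (abs_count 2 n)%:R + (abs_count 3 n)%:R + (abs_count 4 n)%:R :> R.
  have := sum_by_abs (fun=> 1) hn4; rewrite sumr_const card_ord => ->.
  by rewrite !big_ord_recr big_ord0 /= !mulr1 add0r.
rewrite /at_type /type_nbsum !wscaleE -/a -/b -/c -/d -/e.
have -> : N%:R - (a + b + c + d)%coq_nat%:R = (abs_count 0 n)%:R :> R.
  rewrite N4 -/a -/b -/c -/d.
  have -> : (a + b + c + d)%coq_nat = (a + b + c + d)%N by lia.
  by rewrite !natrD; ring.
by [].
Qed.

Lemma coord_sum_by_abs (h : nat -> nat) n : h 0%N = 0%N -> (forall i, `|n ord0 i| <= 5)%N ->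
  coord_sum (fun a => h `|a|%N) n = (h 1 * abs_count 1 n + h 2 * abs_count 2 n + h 3 * abs_count 3 n +
    h 4 * abs_count 4 n + h 5 * abs_count 5 n)%N.
Proof.
move=> h0 hn; rewrite /abs_count /coord_sum !big_distrr /= -!big_split /=.
apply: eq_bigr => i _; have := hn i.
by case: (`|n ord0 i|%N) => [|[|[|[|[|[|//]]]]]] _ /=; rewrite ?h0; lia.
Qed.

(* Value at l1-norm [i] and squared norm [r]: 1 at [e_i], [al] at [e_i + e_j],
   [be] at [2 e_i], [ga] at [e_i + e_j + e_k] (up to signs). *)
Definition profile_val (al be ga : R) (i r : nat) : R :=
  match i, r with
  | 1%N, 1%N => 1 | 2%N, 2%N => al | 2%N, 4%N => be | 3%N, 3%N => ga | _, _ => 0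
  end.

Definition profile al be ga n : R := profile_val al be ga (l1norm n) (sqn n).

Definition profile_type al be ga : typefun := fun a b c d e =>
  profile_val al be ga (a + 2 * b + 3 * c + 4 * d + 5 * e)%coq_nat
    (a + 4 * b + 9 * c + 16 * d + 25 * e)%coq_nat.

Lemma has_type_profile al be ga : has_type 5 (profile al be ga) (profile_type al be ga).
Proof.
move=> n hn; rewrite /profile /at_type /profile_type; congr profile_val.
  by rewrite /l1norm (coord_sum_by_abs (h := id)) //; lia.
rewrite /sqn (coord_sum_by_abs (h := fun k => (k ^ 2)%N)) //; lia.
Qed.

Lemma l1norm_coord n i : (`|n ord0 i| <= l1norm n)%N.
Proof. by rewrite /l1norm /coord_sum (bigD1 i) //= leq_addr. Qed.

Lemma abs_count_small n : (l1norm n <= 3)%N ->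
  [/\ l1norm n = (abs_count 1 n + 2 * abs_count 2 n + 3 * abs_count 3 n)%N,
      sqn n = (abs_count 1 n + 4 * abs_count 2 n + 9 * abs_count 3 n)%N, abs_count 4 n = 0%N & abs_count 5 n = 0%N].
Proof.
move=> n3; have hn i : (`|n ord0 i| <= 5)%N by have := l1norm_coord n i; lia.
have h1 : l1norm n = _ := coord_sum_by_abs (h := id) erefl hn.
have h2 : sqn n = _ := coord_sum_by_abs (h := fun k => (k ^ 2)%N) erefl hn.
by split; lia.
Qed.

Lemma abs_count_ex j n : abs_count j n != 0%N -> exists i, `|n ord0 i|%N = j.
Proof.
move=> h; have : [exists i, `|n ord0 i|%N == j].
  apply: contraNT h; rewrite negb_exists => /forallP h.
  by rewrite /abs_count /coord_sum big1 // => i _; have := h i => /negbTE ->.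
by case/existsP => i /eqP; exists i.
Qed.

Variables (l m p al be ga : R).
Hypothesis N0 : (0 < N)%N.
Local Notation ps := (profile al be ga).
Local Notation F0 := (profile_type al be ga).

(** Three neighbour sums use up three of the five units of validity, which leaves coordinates of
    absolute value at most 2. *)
Lemma avg_cubic_profile n : (l1norm n <= 2)%N \/ (forall i, `|n ord0 i| <= 2)%N ->
  avg_cubic l m p ps n = at_type F0 n - l * (hN / 2) * at_type (type_nbsum F0) n
   + m * (hN / 2) ^+ 2 * at_type (type_nbsum (type_nbsum F0)) n
   - p * (hN / 2) ^+ 3 * at_type (type_nbsum (type_nbsum (type_nbsum F0))) n.
Proof.
move=> hn'; have hn i : (`|n ord0 i| <= 2)%N.
  by case: hn' => // h; exact: leq_trans (l1norm_coord n i) h.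
have t0 := has_type_profile al be ga.
have t1 := has_type_nbsum (M := 4) isT t0.
have t2 := has_type_nbsum (M := 3) isT t1.
have t3 := has_type_nbsum (M := 2) isT t2.
have lt (M : nat) : (2 <= M)%N -> forall i, (`|n ord0 i| <= M)%N.
  by move=> h i; exact: leq_trans (hn i) h.
rewrite -(t0 _ (lt 5%N isT)) -(t1 _ (lt 4%N isT)) -(t2 _ (lt 3%N isT)) -(t3 _ hn).
have e1 : avg ps = (fun n => hN / 2 * nbsum ps n) by [].
have e2 : avg (avg ps) = (fun n => (hN / 2) ^+ 2 * nbsum (nbsum ps) n).
  by apply: funext => k; rewrite {1}/avg e1 nbsumZ; ring.
have e3 : avg (avg (avg ps)) = (fun n => (hN / 2) ^+ 3 * nbsum (nbsum (nbsum ps)) n).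
  by apply: funext => k; rewrite {1}/avg e2 nbsumZ; ring.
by rewrite /avg_cubic e3 e2 e1; ring.
Qed.

End Types.

(** * Expansion in powers of 1/N on the perturbed indicator *)

Section Values.
Variables (R : realType) (N : nat).
Local Notation Z := 'rV[int]_N.
Local Notation hN := (invN R N).
Implicit Types (n : Z).
Variables (l m p a1 a2 b1 g1 : R).
Hypothesis N0 : (0 < N)%N.
Local Notation x := hN.
Local Notation al := (a1 * hN + a2 * hN ^+ 2).
Local Notation be := (b1 * hN).
Local Notation ga := (g1 * hN ^+ 2).
Local Notation ps := (profile al be ga).

Lemma natr_invN : N%:R = x^-1 :> R. Proof. by rewrite /invN invrK. Qed.
Lemma invN_neq0 : x != 0. Proof. by rewrite invr_eq0 pnatr_eq0 -lt0n. Qed.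

Ltac profile_value := rewrite /type_nbsum /retype /wscale /profile_type /profile_val /= natr_invN.

(** With N written as x^-1 the value is a polynomial in x. Its low orders are those to be cancelled
    by [E1] and [E2]; the remainder is left in Horner form for a bound uniform in N. *)
Lemma avg_cubic_profile_1 n : l1norm n = 1%N -> avg_cubic l m p ps n =
   1 + x * (- (l * a1) + 3 / 2 * m)
   + x ^+ 2 * (l * a1 - l * a2 - l * b1 / 2 + m * g1 - 3 / 4 * m - 3 * p * a1)
   + x ^+ 3 * ((l * a2 - 3 * m * g1 + 6 * p * a1 - 3 * p * a2 - 3 / 2 * p * b1) +
        x * ((2 * m * g1 - 3 * p * a1 + 6 * p * a2 + p * b1) + x * (- (3 * p * a2)))).
Proof.
move=> n1.
have [|h1 h2 h4 h5] := @abs_count_small _ n; first by rewrite n1.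
rewrite avg_cubic_profile; last by left; rewrite n1.
rewrite n1 in h1; rewrite /at_type h4 h5.
have -> : abs_count 1 n = 1%N by lia.
have -> : abs_count 2 n = 0%N by lia.
have -> : abs_count 3 n = 0%N by lia.
profile_value.
by field; exact: invN_neq0.
Qed.

Lemma avg_cubic_profile_11 n : l1norm n = 2%N -> sqn n = 2%N -> avg_cubic l m p ps n =
   x * (a1 - l) + x ^+ 2 * (a2 - l * g1 + 5 / 2 * m * a1 - 3 * p)
   + x ^+ 3 * ((2 * l * g1 - 7 / 2 * m * a1 + 5 / 2 * m * a2 + m * b1 - 9 / 2 * p * g1 + 3 * p) +
        x * ((69 / 4 * p * g1 - 7 / 2 * m * a2) + x * (- (33 / 2 * p * g1)))).
Proof.
move=> n1 n2.
have [|h1 h2 h4 h5] := @abs_count_small _ n; first by rewrite n1.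
rewrite avg_cubic_profile; last by left; rewrite n1.
rewrite n1 n2 in h1 h2; rewrite /at_type h4 h5.
have -> : abs_count 1 n = 2%N by lia.
have -> : abs_count 2 n = 0%N by lia.
have -> : abs_count 3 n = 0%N by lia.
profile_value.
by field; exact: invN_neq0.
Qed.

Lemma avg_cubic_profile_2 n : l1norm n = 2%N -> sqn n = 4%N -> avg_cubic l m p ps n =
   x * (b1 - l / 2) + x ^+ 2 * ((m * a1 + m * b1 / 2 - 3 / 2 * p)
   + x * ((m * a2 - m * a1 - 3 / 2 * p * g1 + p) +
        x * ((9 / 2 * p * g1 - m * a2) + x * (- (3 * p * g1))))).
Proof.
move=> n1 n2.
have [|h1 h2 h4 h5] := @abs_count_small _ n; first by rewrite n1.
rewrite avg_cubic_profile; last by left; rewrite n1.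
rewrite n1 n2 in h1 h2; rewrite /at_type h4 h5.
have -> : abs_count 1 n = 0%N by lia.
have -> : abs_count 2 n = 1%N by lia.
have -> : abs_count 3 n = 0%N by lia.
profile_value.
by field; exact: invN_neq0.
Qed.

Lemma avg_cubic_profile_111 n : l1norm n = 3%N -> sqn n = 3%N -> avg_cubic l m p ps n =
   x ^+ 2 * (g1 - 3 / 2 * l * a1 + 3 / 2 * m)
   + x ^+ 3 * ((7 / 2 * m * g1 - 3 / 2 * l * a2 - 27 / 4 * p * a1) +
        x * ((99 / 8 * p * a1 - 33 / 4 * m * g1 - 27 / 4 * p * a2 - 9 / 4 * p * b1)
          + x * (99 / 8 * p * a2))).
Proof.
move=> n1 n2.
have [|h1 h2 h4 h5] := @abs_count_small _ n; first by rewrite n1.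
rewrite n1 n2 in h1 h2.
have c1 : abs_count 1 n = 3%N by lia.
have c2 : abs_count 2 n = 0%N by lia.
have c3 : abs_count 3 n = 0%N by lia.
rewrite avg_cubic_profile.
  rewrite /at_type h4 h5 c1 c2 c3.
  profile_value.
  by field; exact: invN_neq0.
right=> i; have := l1norm_coord n i; rewrite n1; case e : (`|n ord0 i|%N) => [|[|[|[|//]]]] // _.
have : (0 < abs_count 3 n)%N by rewrite /abs_count /coord_sum (bigD1 i) //= e.
by rewrite c3.
Qed.

Definition profile_bound : R := 1 + `|a1| + `|a2| + `|b1| + `|g1|.

Lemma profile_bound_ge1 : 1 <= profile_bound.
Proof. by rewrite /profile_bound -!addrA lerDl !addr_ge0. Qed.

Lemma invN_gt0 : 0 < x. Proof. by rewrite invr_gt0 ltr0n. Qed.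
Lemma invN_le1 : x <= 1. Proof. by rewrite invf_le1 ?ltr0n // ler1n. Qed.

Lemma profile_al_le : `|al| <= profile_bound * x.
Proof.
have x0 := invN_gt0; have x1 := invN_le1.
apply: le_trans (ler_normD _ _) _; rewrite !normrM (ger0_norm (ltW x0)).
have : `|a2| * x ^+ 2 <= `|a2| * x by apply: ler_wpM2l => //; rewrite expr2 ler_piMl // ltW.
have : 0 <= (1 + `|b1| + `|g1|) * x by rewrite mulr_ge0 ?addr_ge0 // ltW.
rewrite /profile_bound; lra.
Qed.

Lemma profile_be_le : `|be| <= profile_bound * x.
Proof.
have x0 := invN_gt0.
rewrite normrM (ger0_norm (ltW x0)); apply: ler_wpM2r; first exact: ltW.
rewrite /profile_bound; have := normr_ge0 a1; have := normr_ge0 a2; have := normr_ge0 g1; lra.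
Qed.

Lemma profile_ga_le : `|ga| <= profile_bound * x ^+ 2.
Proof.
rewrite normrM (ger0_norm (exprn_ge0 2 (ltW invN_gt0))); apply: ler_wpM2r; first exact: sqr_ge0.
rewrite /profile_bound; have := normr_ge0 a1; have := normr_ge0 a2; have := normr_ge0 b1; lra.
Qed.

Lemma profile_supp n : (3 < l1norm n)%N -> ps n = 0.
Proof. by rewrite /profile; case: (l1norm n) => [|[|[|[|i]]]]. Qed.

(** The sizes 1, x and x^2 at norms 1, 2 and 3 are all N x^|n|_1, the shape that [avg_geom]
    propagates. *)
Lemma profile_le n : `|ps n| <= profile_bound * N%:R * x ^+ l1norm n.
Proof.
have x0 := invN_gt0; have A1 := profile_bound_ge1.
have e k : profile_bound * N%:R * x ^+ k.+1 = profile_bound * x ^+ k.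
  by rewrite exprS natr_invN; field; exact: lt0r_neq0.
have p0 : 0 <= profile_bound * N%:R * x ^+ l1norm n.
  by rewrite !mulr_ge0 ?exprn_ge0 // ?ltW //; lra.
rewrite /profile /profile_val.
case: (l1norm n) p0 => [|[|[|[|i]]]] p0; rewrite ?normr0 //.
- by case: (sqn n) => [|[|i]]; rewrite ?normr0 // e expr0 normr1 mulr1.
- case: (sqn n) => [|[|[|[|[|i]]]]]; rewrite ?normr0 // e expr1; [exact: profile_al_le|exact: profile_be_le].
- by case: (sqn n) => [|[|[|[|i]]]]; rewrite ?normr0 // e; exact: profile_ga_le.
Qed.

(** 5, 30 = 5 * 6 and 210 = 5 * 6 * 7 are products of the factors j + 2 of [avg_geom], for supports
    of radius 3, 4 and 5. *)
Definition avg_cubic_bound : R := profile_bound * (1 + 5 * `|l| + 30 * `|m| + 210 * `|p|).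

Lemma avg_cubic_profile_le n : `|avg_cubic l m p ps n| <= avg_cubic_bound * N%:R * x ^+ l1norm n.
Proof.
have A1 := profile_bound_ge1; have x0 := invN_gt0.
have A0 : 0 <= profile_bound * N%:R by rewrite mulr_ge0 //; lra.
have h1 w := avg_geom w N0 A0 profile_supp profile_le.
have s1 k : (4 < l1norm k)%N -> avg ps k = 0 := avg_supp profile_supp.
have A2 : 0 <= profile_bound * N%:R * (3%:R + 2) by apply: mulr_ge0 => //; lra.
have h2 w := avg_geom w N0 A2 s1 h1.
have s2 k : (5 < l1norm k)%N -> avg (avg ps) k = 0 := avg_supp s1.
have A3 : 0 <= profile_bound * N%:R * (3%:R + 2) * (4%:R + 2) by apply: mulr_ge0 => //; lra.
have h3 w := avg_geom w N0 A3 s2 h2.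
rewrite /avg_cubic; set X := x ^+ l1norm n.
have k0 := profile_le n; have k1 := h1 n; have k2 := h2 n; have k3 := h3 n.
apply: le_trans (ler_normB _ _) _.
apply: le_trans (lerD (ler_normD _ _) (lexx _)) _.
apply: le_trans (lerD (lerD (ler_normB _ _) (lexx _)) (lexx _)) _.
rewrite (normrM l) (normrM m) (normrM p) /avg_cubic_bound -/X.
have := ler_wpM2l (normr_ge0 l) k1.
have := ler_wpM2l (normr_ge0 m) k2.
have := ler_wpM2l (normr_ge0 p) k3.
rewrite -/X; move: k0; rewrite -/X; lra.
Qed.

Lemma avg_cubic_profile_supp n : (6 < l1norm n)%N -> avg_cubic l m p ps n = 0.
Proof.
move=> h.
have s1 k : (4 < l1norm k)%N -> avg ps k = 0 := avg_supp profile_supp.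
have s2 k : (5 < l1norm k)%N -> avg (avg ps) k = 0 := avg_supp s1.
have s3 k : (6 < l1norm k)%N -> avg (avg (avg ps)) k = 0 := avg_supp s2.
rewrite /avg_cubic profile_supp ?s1 ?s2 ?s3 ?mulr0 //; last by lia.
- by ring.
- by lia.
- by lia.
Qed.

End Values.

(** * Counting lattice points on spheres *)

Section Shells.
Variables (R : realType) (N : nat).
Local Notation Z := 'rV[int]_N.
Implicit Types (f : Z -> R) (n : Z).

(** Serves to dominate the indicator of a sphere by the neighbour sum of the indicator of the
    previous one; since [nbsum] multiplies totals by 2N, cardinalities follow. *)
Lemma step_down f n i : (forall n, 0 <= f n) -> n ord0 i != 0 ->
  exists m, [/\ (l1norm m).+1 = l1norm n, (sqn m + 2 * `|n ord0 i| = (sqn n).+1)%N & f m <= nbsum f n].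
Proof.
move=> f0 ni; pose s : int := if 0 < n ord0 i then -1 else 1.
exists (n + s *: evec i); split.
- have := coord_sum_move absz n i s; rewrite -!/(l1norm _) /s; case: ifP => h; lia.
- have := coord_sum_move (fun a => `|a|%N ^ 2)%N n i s; rewrite -!/(sqn _) /s; case: ifP => h h'.
    have : `|n ord0 i|%N = `|(n ord0 i + -1)%R|.+1 by lia.
    by move: h'; set u := `|n ord0 i|%N; set w := `|_|%N => h' uw; nia.
  have : `|n ord0 i|%N = `|(n ord0 i + 1)%R|.+1 by lia.
  by move: h'; set u := `|n ord0 i|%N; set w := `|_|%N => h' uw; nia.
rewrite /nbsum (bigD1 i) //=.
have r0 : 0 <= \sum_(j < N | j != i) (f (n + evec j) + f (n - evec j)).
  by apply: sumr_ge0 => j _; apply: addr_ge0.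
have := f0 (n + evec i); have := f0 (n - evec i).
rewrite /s; case: ifP => _; rewrite ?scaleN1r ?scale1r; lra.
Qed.

Definition shell (k : nat) n : R := (l1norm n == k)%:R.
Definition shell_sqn (k r : nat) n : R := ((l1norm n == k) && (sqn n == r))%:R.
Definition shell3_rest n : R := ((l1norm n == 3%N) && (sqn n != 3%N))%:R.

Lemma indicator_dominated (f g : Z -> R) : (forall n, 0 <= f n) -> (forall n, f n <= g n) -> fsupp g ->
  fsupp f /\ zsum f <= zsum g.
Proof.
move=> f0 fg gs; have ff : fsupp f.
  by apply: fsupp_sub gs _ => n gn; apply/eqP; rewrite eq_le f0 -gn fg.
by split=> //; apply: le_zsum.
Qed.

Lemma shell_sum k : fsupp (shell k) /\ zsum (shell k) <= (2 * N%:R) ^+ k.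
Proof.
elim: k => [|k [fk IH]].
  have e : shell 0 = @delta0 R N.
    apply: funext => n; rewrite /shell /delta0; congr (_%:R); congr nat_of_bool.
    by apply/eqP/eqP => [/l1norm_eq0|->] //; exact: l1norm_0.
  rewrite e; split.
    by apply: fsupp_sub (fsupp_delta R 0) _ => n; rewrite subr0.
  rewrite expr0 -(zsum_delta (fun=> 1) (0 : Z)) le_eqVlt; apply/orP; left; apply/eqP.
  by apply: eq_zsum => n; rewrite mul1r subr0.
have [|||h1 h2] := @indicator_dominated (shell k.+1) (nbsum (shell k)).
- by move=> n; rewrite /shell.
- move=> n; rewrite {1}/shell; case: eqP => nk; last first.
    rewrite /nbsum; apply: sumr_ge0 => i _; by rewrite /shell addr_ge0.
  have [i ni] : exists i, n ord0 i != 0.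
    apply/existsP; apply: contraT; rewrite negb_exists => /forallP h.
    have : l1norm n = 0%N by rewrite /l1norm /coord_sum big1 // => i _; have := h i; rewrite negbK => /eqP ->.
    by rewrite nk.
  have [|w [w1 _ w2]] := @step_down (shell k) n i _ ni; first by move=> ?; rewrite /shell.
  apply: le_trans w2; rewrite /shell (_ : l1norm w == k) //; apply/eqP; lia.
- exact: fsupp_nbsum.
split=> //; apply: le_trans h2 _; rewrite zsum_nbsum // exprS.
by apply: ler_wpM2l => //; rewrite mulr_ge0.
Qed.

(** These points are 2 e_i and - 2 e_i; their scarcity permits a larger residual there. *)
Lemma shell24_sum : fsupp (shell_sqn 2 4) /\ zsum (shell_sqn 2 4) <= 2 * N%:R.
Proof.
pose g n : R := \sum_i (delta0 R (n - 2 *: evec i) + delta0 R (n - (-2) *: evec i)).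
have fg i : fsupp (fun n => delta0 R (n - 2 *: evec i) + delta0 R (n - (-2) *: evec i)).
  by apply: fsuppD; exact: fsupp_delta.
have d1 (w : Z) : zsum (fun n => delta0 R (n - w)) = 1.
  by rewrite -[RHS](zsum_delta (fun=> 1) w); apply: eq_zsum => n; rewrite mul1r.
have eg : zsum g = 2 * N%:R.
  rewrite zsum_sum // (eq_bigr (fun=> 2)) ?sumr_const ?card_ord; first by rewrite -[LHS]mulr_natr.
  by move=> i _; rewrite zsumD ?d1; try exact: fsupp_delta.
have [|||h1 h2] := @indicator_dominated (shell_sqn 2 4) g.
- by move=> n; rewrite /shell_sqn.
- have g0 n : 0 <= g n by apply: sumr_ge0 => i _; rewrite addr_ge0.
  move=> n; rewrite {1}/shell_sqn; case: andP => [[/eqP n1 /eqP n2]|] //.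
  have [|e1 e2 _ _] := @abs_count_small _ n; first by rewrite n1.
  rewrite n1 n2 in e1 e2.
  have [|i ni] := @abs_count_ex _ 2 n; first by lia.
  have : n - 2 *: evec i = 0 \/ n - (-2) *: evec i = 0.
    have h (s : int) : n ord0 i = s -> n - s *: evec i = 0.
      move=> si; apply: l1norm_eq0; have := coord_sum_move absz n i (- s).
      rewrite -!/(l1norm _) scaleNr n1 ni si subrr absz0 addn0 => /eqP.
      by rewrite -[X in _ == X]add0n eqn_add2r => /eqP.
    have [/h|/h] : n ord0 i = 2 \/ n ord0 i = -2 by lia.
      by left.
    by right.
  rewrite /g (bigD1 i) //=.
  have r0 : 0 <= \sum_(j < N | j != i) (delta0 R (n - 2 *: evec j) + delta0 R (n - (-2) *: evec j)).
    by apply: sumr_ge0 => j _; rewrite addr_ge0.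
  have q1 : 0 <= delta0 R (n - 2 *: evec i) by [].
  have q2 : 0 <= delta0 R (n - (-2) *: evec i) by [].
  have q3 : delta0 R (0 : Z) = 1 by rewrite /delta0 eqxx.
  by case=> h; rewrite h q3 in q1 q2 *; lra.
- exact: fsupp_sum.
by rewrite -eg.
Qed.

Lemma shell3_rest_sum : fsupp shell3_rest /\ zsum shell3_rest <= 4 * N%:R ^+ 2.
Proof.
have [f2 h2] := shell24_sum.
have [|||h1 h3] := @indicator_dominated shell3_rest (nbsum (shell_sqn 2 4)).
- by move=> n; rewrite /shell3_rest.
- move=> n; rewrite {1}/shell3_rest; case: andP => [[/eqP n1 n2]|_]; last first.
    rewrite /nbsum; apply: sumr_ge0 => i _; by rewrite /shell_sqn addr_ge0.
  have [|e1 e2 _ _] := @abs_count_small _ n; first by rewrite n1.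
  rewrite n1 in e1.
  have hx i : n ord0 i != 0 -> (sqn n + 1 = 4 + 2 * `|n ord0 i|)%N ->
     1 <= nbsum (shell_sqn 2 4) n.
    move=> ni hi; have [|w [w1 w3 w2]] := @step_down (shell_sqn 2 4) n i _ ni.
      by move=> ?; rewrite /shell_sqn.
    have hw : (l1norm w == 2%N) && (sqn w == 4%N) by apply/andP; split; apply/eqP; lia.
    by apply: le_trans w2; rewrite /shell_sqn hw.
  (* Up to signs n is 2 e_i + e_j or 3 e_i; deleting the unit coordinate, respectively lowering 3 to
     2, leads to 2 e_i. *)
  have [c1|c1] : (abs_count 1 n = 1%N /\ sqn n = 5%N) \/ (abs_count 3 n = 1%N /\ sqn n = 9%N).
    by move: n2; rewrite e2; lia.
    have [|i ni] := @abs_count_ex _ 1 n; first by case: c1 => ->.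
    by apply: (hx i); rewrite ?(proj2 c1) ?ni // -absz_eq0 ni.
  have [|i ni] := @abs_count_ex _ 3 n; first by case: c1 => ->.
  by apply: (hx i); rewrite ?(proj2 c1) ?ni // -absz_eq0 ni.
- exact: fsupp_nbsum.
split=> //; apply: le_trans h3 _; rewrite zsum_nbsum //.
have N0 : 0 <= N%:R :> R by [].
have := ler_wpM2l (ltac:(lra) : 0 <= 2 * N%:R :> R) h2; lra.
Qed.

End Shells.

(** * The trial function and its residual *)

Section Residual.
Variables (R : realType) (k : nat) (l m p a1 a2 b1 g1 c1 c2 : R).
Local Notation w j := (j%:R ^- k.+1 : R).
(* The vanishing of the residual at order [N^-1], [N^-2] on the unit sphere ([E1],
   [E2]), at [e_i + e_j] ([E3], [E4]), at [2 e_i] ([E5]) and at [e_i + e_j + e_k]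
   ([E6]). *)
Hypotheses (E1 : c1 = - (l * a1) + 3 / 2 * m)
  (E2 : c2 = l * a1 - l * a2 - l * b1 / 2 + m * g1 - 3 / 4 * m - 3 * p * a1)
  (E3 : a1 - l = a1 * w 2)
  (E4 : a2 - l * g1 + 5 / 2 * m * a1 - 3 * p = (a1 * c1 + a2) * w 2)
  (E5 : b1 - l / 2 = b1 * w 4)
  (E6 : g1 - 3 / 2 * l * a1 + 3 / 2 * m = g1 * w 3).

Definition ratio_approx N : R := 1 + c1 * invN R N + c2 * invN R N ^+ 2.
Definition trial N : 'rV[int]_N -> R :=
  profile (a1 * invN R N + a2 * invN R N ^+ 2) (b1 * invN R N) (g1 * invN R N ^+ 2).
Definition residual N (n : 'rV[int]_N) : R :=
  avg_cubic l m p (@trial N) n - ratio_approx N * hardy_wt R k.+1 n * trial n.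

Lemma horner_bound (x u v t : R) : 0 <= x -> x <= 1 ->
  `|u + x * (v + x * t)| <= `|u| + `|v| + `|t|.
Proof.
move=> x0 x1.
have h (y z : R) : `|y + x * z| <= `|y| + `|z|.
  apply: le_trans (ler_normD _ _) _; rewrite lerD2l normrM (ger0_norm x0).
  by rewrite ler_piMl.
by apply: le_trans (h _ _) _; rewrite -addrA lerD2l.
Qed.

Lemma trial_1 N (n : 'rV[int]_N) : l1norm n = 1%N -> sqn n = 1%N /\ trial n = 1.
Proof.
move=> n1; have [|e1 e2 _ _] := @abs_count_small _ n; first by rewrite n1.
have s1 : sqn n = 1%N by lia.
by rewrite /trial /profile n1 s1.
Qed.

(** That the residual is constant on the unit sphere matters as much as its size: it makes it
    orthogonal there to functions of zero mean. *)
Lemma residual_1 : exists Q, forall N, (0 < N)%N -> exists E, `|E| <= Q * invN R N ^+ 3 /\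
  forall n : 'rV[int]_N, l1norm n = 1%N -> residual n = E.
Proof.
pose Q := `|l * a2 - 3 * m * g1 + 6 * p * a1 - 3 * p * a2 - 3 / 2 * p * b1|
  + `|2 * m * g1 - 3 * p * a1 + 6 * p * a2 + p * b1| + `|- (3 * p * a2)|.
exists Q => N N0; have x0 := invN_gt0 R N0; have x1 := invN_le1 R N0.
exists (invN R N ^+ 3 * ((l * a2 - 3 * m * g1 + 6 * p * a1 - 3 * p * a2 - 3 / 2 * p * b1)
  + invN R N * ((2 * m * g1 - 3 * p * a1 + 6 * p * a2 + p * b1) + invN R N * (- (3 * p * a2))))).
split.
  rewrite normrM ger0_norm ?exprn_ge0 // ?(ltW x0) // mulrC; apply: ler_wpM2r.
    by rewrite exprn_ge0 // ltW.
  by apply: horner_bound => //; exact: ltW.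
move=> n n1; have [s1 t1] := trial_1 n1.
rewrite /residual t1 avg_cubic_profile_1 // /hardy_wt s1 expr1n invr1 /ratio_approx E1 E2; ring.
Qed.

Lemma residual_11 : exists Q, forall N, (0 < N)%N -> 
  forall n : 'rV[int]_N, l1norm n = 2%N -> sqn n = 2%N -> `|residual n| <= Q * invN R N ^+ 3.
Proof.
pose Q := `|(2 * l * g1 - 7 / 2 * m * a1 + 5 / 2 * m * a2 + m * b1 - 9 / 2 * p * g1 + 3 * p)
    - (a1 * c2 + a2 * c1) * w 2|
  + `|69 / 4 * p * g1 - 7 / 2 * m * a2 - a2 * c2 * w 2| + `|- (33 / 2 * p * g1)|.
exists Q => N N0 n n1 n2; have x0 := invN_gt0 R N0; have x1 := invN_le1 R N0.
have -> : residual n = invN R N ^+ 3 * (((2 * l * g1 - 7 / 2 * m * a1 + 5 / 2 * m * a2 + m * b1 - 9 / 2 * p * g1 + 3 * p)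
    - (a1 * c2 + a2 * c1) * w 2) + invN R N * ((69 / 4 * p * g1 - 7 / 2 * m * a2 - a2 * c2 * w 2) 
     + invN R N * (- (33 / 2 * p * g1)))).
  rewrite /residual /trial avg_cubic_profile_11 // E3 E4 /hardy_wt /profile n1 n2 /= /ratio_approx; ring.
rewrite normrM ger0_norm ?exprn_ge0 // ?(ltW x0) // mulrC; apply: ler_wpM2r.
  by rewrite exprn_ge0 // ltW.
by apply: horner_bound => //; exact: ltW.
Qed.

(** One order less than at e_i + e_j: the value b1 x has no second-order coefficient that could
    cancel the next term. *)
Lemma residual_2 : exists Q, forall N, (0 < N)%N -> 
  forall n : 'rV[int]_N, l1norm n = 2%N -> sqn n = 4%N -> `|residual n| <= Q * invN R N ^+ 2.
Proof.
pose u := m * a1 + m * b1 / 2 - 3 / 2 * p - b1 * c1 * w 4.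
pose v := m * a2 - m * a1 - 3 / 2 * p * g1 + p - b1 * c2 * w 4.
pose t := 9 / 2 * p * g1 - m * a2.
pose s := - (3 * p * g1).
exists (`|u| + (`|v| + `|t| + `|s|)) => N N0 n n1 n2; have x0 := invN_gt0 R N0; have x1 := invN_le1 R N0.
have -> : residual n = invN R N ^+ 2 * (u + invN R N * (v + invN R N * (t + invN R N * s))).
  rewrite /residual /trial avg_cubic_profile_2 // E5 /hardy_wt /profile n1 n2 /= /ratio_approx /u /v /t /s; ring.
rewrite normrM ger0_norm ?exprn_ge0 // ?(ltW x0) // mulrC; apply: ler_wpM2r.
  by rewrite exprn_ge0 // ltW.
apply: le_trans (ler_normD _ _) _; rewrite lerD2l normrM (ger0_norm (ltW x0)).
have h := @horner_bound _ v t s (ltW x0) x1.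
by apply: le_trans h; rewrite ler_piMl.
Qed.

Lemma residual_111 : exists Q, forall N, (0 < N)%N -> 
  forall n : 'rV[int]_N, l1norm n = 3%N -> sqn n = 3%N -> `|residual n| <= Q * invN R N ^+ 3.
Proof.
pose u := 7 / 2 * m * g1 - 3 / 2 * l * a2 - 27 / 4 * p * a1 - g1 * c1 * w 3.
pose v := 99 / 8 * p * a1 - 33 / 4 * m * g1 - 27 / 4 * p * a2 - 9 / 4 * p * b1 - g1 * c2 * w 3.
pose t := 99 / 8 * p * a2.
exists (`|u| + `|v| + `|t|) => N N0 n n1 n2; have x0 := invN_gt0 R N0; have x1 := invN_le1 R N0.
have -> : residual n = invN R N ^+ 3 * (u + invN R N * (v + invN R N * t)).
  rewrite /residual /trial avg_cubic_profile_111 // E6 /hardy_wt /profile n1 n2 /= /ratio_approx /u /v /t; ring.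
rewrite normrM ger0_norm ?exprn_ge0 // ?(ltW x0) // mulrC; apply: ler_wpM2r.
  by rewrite exprn_ge0 // ltW.
by apply: horner_bound => //; exact: ltW.
Qed.

Lemma residual_far : exists Q, forall N, (0 < N)%N -> 
  forall n : 'rV[int]_N, (3 < l1norm n)%N || ((l1norm n == 3%N) && (sqn n != 3%N)) ->
  `|residual n| <= Q * (N%:R * invN R N ^+ l1norm n).
Proof.
exists (avg_cubic_bound l m p a1 a2 b1 g1) => N N0 n h.
have t0 : trial n = 0.
  case/orP: h => [h|/andP[/eqP h h']]; first exact: profile_supp.
  rewrite /trial /profile h; move: h'; case: (sqn n) => [|[|[|[|i]]]] //.
by rewrite /residual t0 mulr0 subr0 mulrA; exact: avg_cubic_profile_le.
Qed.

Lemma residual_bounds : exists Q, 1 <= Q /\ forall N, (0 < N)%N -> 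
  (exists E, `|E| <= Q * invN R N ^+ 3 /\ forall n : 'rV[int]_N, l1norm n = 1%N -> residual n = E) /\
  forall n : 'rV[int]_N, [/\
    l1norm n = 2%N -> sqn n = 2%N -> `|residual n| <= Q * invN R N ^+ 3,
    l1norm n = 2%N -> sqn n = 4%N -> `|residual n| <= Q * invN R N ^+ 2,
    l1norm n = 3%N -> sqn n = 3%N -> `|residual n| <= Q * invN R N ^+ 3 &
    (3 < l1norm n)%N || ((l1norm n == 3%N) && (sqn n != 3%N)) ->
      `|residual n| <= Q * (N%:R * invN R N ^+ l1norm n)].
Proof.
have [Q1 h1] := residual_1; have [Q2 h2] := residual_11; have [Q3 h3] := residual_2.
have [Q4 h4] := residual_111; have [Q5 h5] := residual_far.
pose Q := 1 + `|Q1| + `|Q2| + `|Q3| + `|Q4| + `|Q5|.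
have := normr_ge0 Q1; have := normr_ge0 Q2; have := normr_ge0 Q3.
have := normr_ge0 Q4; have := normr_ge0 Q5 => n5 n4 n3 n2 n1.
exists Q; split=> [|N N0]; first by rewrite /Q; lra.
have x0 := invN_gt0 R N0.
have up (q y z : R) : q <= Q -> 0 <= z -> y <= q * z -> y <= Q * z.
  by move=> qQ z0 /le_trans; apply; apply: ler_wpM2r.
have xk j : 0 <= invN R N ^+ j by rewrite exprn_ge0 // ltW.
have := ler_norm Q1; have := ler_norm Q2; have := ler_norm Q3.
have := ler_norm Q4; have := ler_norm Q5 => m5 m4 m3 m2 m1.
split.
  have [E [e1 e2]] := h1 N N0; exists E; split=> //.
  by apply: up e1 => //; rewrite /Q; lra.
move=> n; split.
- by move=> u v; apply: up (h2 N N0 n u v) => //; rewrite /Q; lra.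
- by move=> u v; apply: up (h3 N N0 n u v) => //; rewrite /Q; lra.
- by move=> u v; apply: up (h4 N N0 n u v) => //; rewrite /Q; lra.
- move=> u; apply: up (h5 N N0 n u) => //; first by rewrite /Q; lra.
  by rewrite mulr_ge0.
Qed.

Lemma fsupp_shell N j : fsupp (@shell R N j). Proof. exact: (shell_sum R N j).1. Qed.

Lemma fsupp_trial N : fsupp (@trial N).
Proof.
have f : fsupp (fun n : 'rV[int]_N => shell R 1 n + (shell R 2 n + shell R 3 n)).
  by apply: fsuppD; [|apply: fsuppD]; exact: fsupp_shell.
apply: fsupp_sub f _ => n; rewrite /shell /trial /profile.
case: (l1norm n) => [|[|[|[|i]]]] //= /eqP; rewrite ?add0r ?addr0 ?oner_eq0 //.
Qed.

Lemma residual_sums : exists C, forall N, (0 < N)%N ->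
  zsum (fun n : 'rV[int]_N => (2 <= l1norm n)%N%:R * residual n ^+ 2) <= C * invN R N ^+ 2 /\
  `|zsum (fun n : 'rV[int]_N => trial n * residual n)| <= C * invN R N ^+ 2.
Proof.
have [Q [Q1 hQ]] := residual_bounds.
pose A := profile_bound a1 a2 b1 g1; have A1 : 1 <= A := profile_bound_ge1 _ _ _ _.
exists (130 * Q ^+ 2 + 16 * A * Q) => N N0.
have [[E [e1 e2]] hn] := hQ N N0.
have x0 := invN_gt0 R N0; have x1 := invN_le1 R N0; set x := invN R N in x0 x1 e1 hn *.
have NE : N%:R = x^-1 :> R by exact: natr_invN.
have xn := lt0r_neq0 x0.
have xk j : 0 <= x ^+ j by rewrite exprn_ge0 // ltW.
have [fX hX] := shell24_sum R N; have [f3 h3] := shell3_rest_sum R N.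
have fs j := (shell_sum R N j).1; have hs j := (shell_sum R N j).2.
have ft := fsupp_trial N.
have fr : fsupp (@residual N).
  have fK := fsupp_avg_cubic l m p ft.
  by apply: fsuppD => //; apply: fsuppN; apply: fsuppMr.
have x32 : x ^+ 3 <= x ^+ 2 by apply: ler_wiXn2l => //; exact: ltW.
have x42 : x ^+ 4 <= x ^+ 2 by apply: ler_wiXn2l => //; exact: ltW.
have sq (y z : R) : `|y| <= z -> y ^+ 2 <= z ^+ 2.
  move=> yz; rewrite -[y ^+ 2]real_normK ?num_real // lerXn2r ?nnegrE //.
  exact: le_trans yz.
have QQ : 0 <= Q ^+ 2 by exact: sqr_ge0.
have AQ : 0 <= A * Q by rewrite mulr_ge0 //; lra.
split.
  (* Each coefficient is the square of the order of the residual on that set; the totals add up to 4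
     + 8 + 16 + 2 + 4 + 32 + 64 = 130 times x^2. *)
  pose G (n : 'rV[int]_N) : R := x ^+ 6 * shell R 2 n + (x ^+ 6 * shell R 3 n +
     (x ^+ 6 * shell R 4 n + (x ^+ 4 * shell_sqn R 2 4 n + (x ^+ 4 * shell3_rest R n +
     (x ^+ 8 * shell R 5 n + x ^+ 10 * shell R 6 n))))).
  have fG : fsupp G by rewrite /G; fsupp_tac.
  have hG : zsum G <= 130 * x ^+ 2.
    rewrite /G !zsumD ?zsumZ; try by fsupp_tac.
    have b2 : x ^+ 6 * zsum (@shell R N 2) <= 4 * x ^+ 4.
      by apply: le_trans (ler_wpM2l (xk 6%N) (hs 2%N)) _; rewrite NE le_eqVlt; apply/orP; left; apply/eqP; field.
    have b3 : x ^+ 6 * zsum (@shell R N 3) <= 8 * x ^+ 3.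
      by apply: le_trans (ler_wpM2l (xk 6%N) (hs 3%N)) _; rewrite NE le_eqVlt; apply/orP; left; apply/eqP; field.
    have b4 : x ^+ 6 * zsum (@shell R N 4) <= 16 * x ^+ 2.
      by apply: le_trans (ler_wpM2l (xk 6%N) (hs 4%N)) _; rewrite NE le_eqVlt; apply/orP; left; apply/eqP; field.
    have b5 : x ^+ 8 * zsum (@shell R N 5) <= 32 * x ^+ 3.
      by apply: le_trans (ler_wpM2l (xk 8%N) (hs 5%N)) _; rewrite NE le_eqVlt; apply/orP; left; apply/eqP; field.
    have b6 : x ^+ 10 * zsum (@shell R N 6) <= 64 * x ^+ 4.
      by apply: le_trans (ler_wpM2l (xk 10%N) (hs 6%N)) _; rewrite NE le_eqVlt; apply/orP; left; apply/eqP; field.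
    have b7 : x ^+ 4 * zsum (@shell_sqn R N 2 4) <= 2 * x ^+ 3.
      by apply: le_trans (ler_wpM2l (xk 4%N) hX) _; rewrite NE le_eqVlt; apply/orP; left; apply/eqP; field.
    have b8 : x ^+ 4 * zsum (@shell3_rest R N) <= 4 * x ^+ 2.
      by apply: le_trans (ler_wpM2l (xk 4%N) h3) _; rewrite NE le_eqVlt; apply/orP; left; apply/eqP; field.
    lra.
  have : zsum (fun n : 'rV[int]_N => (2 <= l1norm n)%N%:R * residual n ^+ 2) <= Q ^+ 2 * zsum G.
    rewrite -zsumZ; apply: le_zsum => [||n].
    - by apply: fsuppMr; apply: fsuppX.
    - exact: fsuppMr.
    have [r2 r24 r3 rf] := hn n.
    have G1 (g r : R) : `|r| <= Q * g -> 1 * r ^+ 2 <= Q ^+ 2 * (g ^+ 2).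
      by move=> /sq; rewrite mul1r exprMn.
    have Nx j : N%:R * x ^+ j.+1 = x ^+ j by rewrite NE exprS mulKf.
    rewrite /G /shell /shell_sqn /shell3_rest.
    case e : (l1norm n) => [|[|[|[|[|[|[|i]]]]]]] /=; rewrite ?mul0r ?mulr0 ?mulr1 ?add0r ?addr0 ?mulr0.
    + by [].
    + by [].
    + have [s2|s4] := orP (sqn_l1norm_2 e).
        move/eqP: s2 => s2; rewrite s2 /= mulr0 addr0.
        by apply: le_trans (G1 _ _ (r2 e s2)) _; rewrite -exprM.
      move/eqP: s4 => s4; rewrite s4 /= mulr1.
      apply: le_trans (G1 _ _ (r24 e s4)) _; rewrite -exprM; apply: ler_wpM2l => //.
      by rewrite lerDr.
    + have [s3|s3] := eqVneq (sqn n) 3%N.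
        by rewrite mulr0 addr0; apply: le_trans (G1 _ _ (r3 e s3)) _; rewrite -exprM.
      have := rf; rewrite e s3 Nx => /(_ isT) /G1 h.
      apply: le_trans h _; rewrite -exprM /= mulr1; apply: ler_wpM2l => //.
      by rewrite lerDr.
    + have := rf; rewrite e Nx => /(_ isT) /G1 h.
      by apply: le_trans h _; rewrite -exprM.
    + have := rf; rewrite e Nx => /(_ isT) /G1 h.
      by apply: le_trans h _; rewrite -exprM.
    + have := rf; rewrite e Nx => /(_ isT) /G1 h.
      by apply: le_trans h _; rewrite -exprM.
    rewrite /residual avg_cubic_profile_supp ?e //.
    have -> : trial n = 0 by apply: profile_supp; rewrite e.
    by rewrite mulr0 subr0 expr0n /= !mulr0.
  have := ler_wpM2l QQ hG.
  have := mulr_ge0 AQ (xk 2%N).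
  by lra.
(* Each coefficient is the order of the trial function times that of the residual; the totals are 2
   + 4 + 2 + 8 = 16 times x^2. *)
pose H (n : 'rV[int]_N) : R := x ^+ 3 * shell R 1 n + (x ^+ 4 * shell R 2 n +
     (x ^+ 3 * shell_sqn R 2 4 n + x ^+ 5 * shell R 3 n)).
have fH : fsupp H by rewrite /H; fsupp_tac.
have hH : zsum H <= 16 * x ^+ 2.
  rewrite /H !zsumD ?zsumZ; try by fsupp_tac.
  have b1' : x ^+ 3 * zsum (@shell R N 1) <= 2 * x ^+ 2.
    by apply: le_trans (ler_wpM2l (xk 3%N) (hs 1%N)) _; rewrite NE le_eqVlt; apply/orP; left; apply/eqP; field.
  have b2 : x ^+ 4 * zsum (@shell R N 2) <= 4 * x ^+ 2.
    by apply: le_trans (ler_wpM2l (xk 4%N) (hs 2%N)) _; rewrite NE le_eqVlt; apply/orP; left; apply/eqP; field.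
  have b3 : x ^+ 5 * zsum (@shell R N 3) <= 8 * x ^+ 2.
    by apply: le_trans (ler_wpM2l (xk 5%N) (hs 3%N)) _; rewrite NE le_eqVlt; apply/orP; left; apply/eqP; field.
  have b7 : x ^+ 3 * zsum (@shell_sqn R N 2 4) <= 2 * x ^+ 2.
    by apply: le_trans (ler_wpM2l (xk 3%N) hX) _; rewrite NE le_eqVlt; apply/orP; left; apply/eqP; field.
  lra.
have pt n : `|trial n * residual n| <= A * Q * H n.
  have [r2 r24 r3 rf] := hn n.
  have M (y z u v : R) : `|y| <= A * u -> `|z| <= Q * v -> `|y * z| <= A * Q * (u * v).
    by move=> hy hz; rewrite normrM mulrACA; apply: ler_pM.
  rewrite /H /shell /shell_sqn.
  have al := profile_al_le a1 a2 b1 g1 N0; have be := profile_be_le a1 a2 b1 g1 N0.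
  have ga := profile_ga_le a1 a2 b1 g1 N0.
  rewrite -/x -/A in al be ga.
  have t1 : (`|1| : R) <= A * 1 by rewrite normr1 mulr1.
  case e : (l1norm n) => [|[|[|[|i]]]] /=; rewrite ?mul0r ?mulr0 ?mulr1 ?add0r ?addr0 ?mulr0.
  + by rewrite /trial /profile e mul0r normr0.
  + have [_ ->] := trial_1 e; rewrite (e2 _ e).
    by apply: le_trans (M _ _ _ _ t1 e1) _; rewrite mul1r.
  + have [s2|s4] := orP (sqn_l1norm_2 e).
      move/eqP: s2 => s2; rewrite s2 /= mulr0 addr0.
      rewrite {1}/trial /profile e s2 /= -/x.
      by apply: le_trans (M _ _ _ _ al (r2 e s2)) _; rewrite -exprS.
    move/eqP: s4 => s4; rewrite s4 /= mulr1.
    rewrite {1}/trial /profile e s4 /= -/x.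
    apply: le_trans (M _ _ _ _ be (r24 e s4)) _; rewrite -exprS; apply: ler_wpM2l => //.
    by rewrite lerDr.
  + have [s3|s3] := eqVneq (sqn n) 3%N.
      rewrite {1}/trial /profile e s3 /= -/x.
      by apply: le_trans (M _ _ _ _ ga (r3 e s3)) _; rewrite -exprD.
    have -> : trial n = 0.
      by rewrite /trial /profile e; move: s3; case: (sqn n) => [|[|[|[|i]]]].
    by rewrite mul0r normr0 mulr_ge0.
  by rewrite /trial profile_supp ?e // mul0r normr0.
have fT : fsupp (fun n : 'rV[int]_N => trial n * residual n) by exact: fsuppMl.
apply: (@le_trans _ _ (A * Q * zsum H)).
  rewrite ler_norml -zsumZ -zsumN; apply/andP; split.
    apply: le_zsum => [||n]; [by apply: fsuppN; apply: fsuppMr | done |].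
    by have := pt n; rewrite ler_norml => /andP[].
  apply: le_zsum => [||n]; [done | exact: fsuppMr |].
  by have := pt n; rewrite ler_norml => /andP[].
have := ler_wpM2l AQ hH.
have := mulr_ge0 QQ (xk 2%N).
by lra.
Qed.

End Residual.

(** * Two-sided bounds from the residual and the gap *)

Section Assembly.
Variables (R : realType) (k : nat) (l m p a1 a2 b1 g1 c1 c2 mu theta : R).
Local Notation w j := (j%:R ^- k.+1 : R).
Hypotheses (k2 : (k <= 2)%N)
  (E1 : c1 = - (l * a1) + 3 / 2 * m)
  (E2 : c2 = l * a1 - l * a2 - l * b1 / 2 + m * g1 - 3 / 4 * m - 3 * p * a1)
  (E3 : a1 - l = a1 * w 2)
  (E4 : a2 - l * g1 + 5 / 2 * m * a1 - 3 * p = (a1 * c1 + a2) * w 2)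
  (E5 : b1 - l / 2 = b1 * w 4)
  (E6 : g1 - 3 / 2 * l * a1 + 3 / 2 * m = g1 * w 3)
  (mu0 : 0 < mu) (theta0 : 0 <= theta) (hth : l ^+ 2 / mu - m <= theta)
  (hc1 : theta / 2 < - c1)
  (far : exists N0, forall N, (N0 <= N)%N ->
    forall v : 'rV[int]_N -> R, fsupp v -> (forall n, (sqn n <= 1)%N -> v n = 0) ->
    110 / 100 * zsum (fun n => v n ^+ 2 * hardy_wt R k.+1 n) +
    mu * zsum (fun n => v n ^+ 2 * ((sqn n == 2) || (sqn n == 4))%:R) <=
    zsum (fun n => v n * avg_cubic l m p v n)).

Local Notation cv N := (ratio_approx c1 c2 N).
Local Notation tr N := (@trial R a1 a2 b1 g1 N).
Local Notation rs N := (@residual R k l m p a1 a2 b1 g1 c1 c2 N).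

Lemma ratio_approx_large : exists N0, forall N, (N0 <= N)%N ->
  cv N <= 1 - theta / 2 * invN R N - gap_const m p * invN R N ^+ 2 /\ cv N <= 103 / 100.
Proof.
have [D DE D0] : exists2 D, D = - c1 - theta / 2 & 0 < D.
  by exists (- c1 - theta / 2); rewrite // subr_gt0.
(* Beyond the first summand the spare D x dominates all terms in x^2; beyond the second, (|c1| +
   |c2|) x <= 3/100. *)
pose M := (`|c2| + `|gap_const m p|) / D + 100 / 3 * (`|c1| + `|c2|) + 1.
exists (Num.truncn M).+1 => N hN.
have NM : M < N%:R.
  apply: lt_le_trans (_ : (Num.truncn M).+1%:R <= _); last by rewrite ler_nat.
  by rewrite truncnS_gt.
have N0 : (0 < N)%N by exact: leq_trans hN.
have x0 := invN_gt0 R N0; have x1 := invN_le1 R N0; set x := invN R N in x0 x1 *.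
have NE : N%:R * x = 1 by rewrite /x /invN mulfV // pnatr_eq0 -lt0n.
have p1 : 0 <= (`|c2| + `|gap_const m p|) / D by rewrite divr_ge0 ?addr_ge0 // ltW.
have p2 := normr_ge0 c1; have p3 := normr_ge0 c2.
have p4 : 0 <= 100 / 3 * (`|c1| + `|c2|) by rewrite mulr_ge0 ?addr_ge0 // divr_ge0.
have n1 : (`|c2| + `|gap_const m p|) / D <= N%:R.
  by apply: le_trans (ltW NM); rewrite /M -addrA lerDl addr_ge0.
have n2 : 100 / 3 * (`|c1| + `|c2|) <= N%:R.
  by apply: le_trans (ltW NM); rewrite /M addrAC lerDr addr_ge0.
have := ler_wpM2r (ltW x0) n1; rewrite NE mulrAC ler_pdivrMr // mul1r => h1.
have := ler_wpM2r (ltW x0) n2; rewrite NE => h2.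
rewrite /ratio_approx -/x; split.
  have := ler_wpM2l (ltW x0) h1.
  have := ler_wpM2r (sqr_ge0 x) (ler_norm c2).
  have := ler_wpM2r (sqr_ge0 x) (ler_norm (gap_const m p)).
  rewrite DE; lra.
have : c1 * x <= `|c1| * x by apply: ler_wpM2r (ltW x0) _ _ (ler_norm _).
have : c2 * x ^+ 2 <= `|c2| * x.
  apply: le_trans (ler_wpM2r (sqr_ge0 x) (ler_norm c2)) _; apply: ler_wpM2l => //.
  by rewrite expr2 ler_piMl // ltW.
lra.
Qed.

Lemma hardy_wt_l1norm_1 N (n : 'rV[int]_N) : l1norm n = 1%N -> hardy_wt R k.+1 n = 1.
Proof.
by move=> n1; have [s1 _] := trial_1 a1 a2 b1 g1 n1; rewrite /hardy_wt s1 expr1n invr1.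
Qed.

Lemma weight_split N (y : 'rV[int]_N -> R) : fsupp y -> y 0 = 0 ->
  zsum (fun n => y n ^+ 2 * hardy_wt R k.+1 n) =
  zsum (fun n => (l1norm n == 1%N)%:R * y n ^+ 2) +
  zsum (fun n => (2 <= l1norm n)%N%:R * y n ^+ 2 * hardy_wt R k.+1 n).
Proof.
move=> fy y0; rewrite -zsumD; try by fsupp_tac.
apply: eq_zsum => n; case e : (l1norm n) => [|[|i]] /=.
- by rewrite (l1norm_eq0 e) y0 expr0n /=; ring.
- by rewrite (hardy_wt_l1norm_1 e); ring.
- by ring.
Qed.

(* [u = s * trial + y] with [y] of zero mean on the unit sphere: the gap absorbs
   the cross term, which only sees the residual. *)
Lemma avg_cubic_lower : exists C N0, forall N, (N0 <= N)%N ->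
  forall u : 'rV[int]_N -> R, fsupp u -> u 0 = 0 ->
  (cv N - C * invN R N ^+ 3) * zsum (fun n => u n ^+ 2 * hardy_wt R k.+1 n) <=
  zsum (fun n => u n * avg_cubic l m p u n).
Proof.
have [N1 hfar] := far; have [N2 hcv] := ratio_approx_large.
have [C hC] := residual_sums E1 E2 E3 E4 E5 E6.
(* 20 comes from completing the square against 5/100 of the Hardy weight, 6^6 from that weight on
   the support of the residual, which has radius 3 + 3, and 1/2 from s^2 <= (x / 2) sum |u|^2 /
   |n|^(2l). *)
exists (C * (1 + 20 * 6 ^+ 6) / 2), (N1 + N2 + 1)%N => N hN u fu u0.
have N0 : (0 < N)%N by lia.
have h1 : (N1 <= N)%N by lia.
have h2 : (N2 <= N)%N by lia.
have [cv1 cv2] := hcv N h2; have [C1 C2] := hC N N0.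
have [Q [_ hQ]] := residual_bounds E1 E2 E3 E4 E5 E6.
have [[E [_ e2]] _] := hQ N N0.
have x0 := invN_gt0 R N0; set x := invN R N in cv1 C1 C2 x0 *.
have NE : N%:R = x^-1 :> R by exact: natr_invN.
have xn := lt0r_neq0 x0.
set c := cv N in cv1 cv2 *.
pose sh (n : 'rV[int]_N) : R := (l1norm n == 1%N)%:R.
pose f2 (n : 'rV[int]_N) : R := (2 <= l1norm n)%N%:R.
have ft : fsupp (tr N) := fsupp_trial a1 a2 b1 g1 N.
have fsh : fsupp sh by exact: fsupp_shell.
have fr : fsupp (rs N).
  have fK := fsupp_avg_cubic l m p ft.
  by apply: fsuppD => //; apply: fsuppN; apply: fsuppMr.
(* The mean of u over the 2N points of the unit sphere, where the trial function is 1. *)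
pose s := zsum (fun n => sh n * u n) * (x / 2).
have sE : zsum (fun n => sh n * u n) = s * (2 * N%:R) by rewrite /s NE; field.
pose y n := u n - s * tr N n.
have fy : fsupp y by apply: fsuppD => //; apply: fsuppN; apply: fsuppMr.
have t0 : tr N 0 = 0 by rewrite /trial /profile l1norm_0.
have y0 : y 0 = 0 by rewrite /y u0 t0; ring.
have ys : zsum (fun n => sh n * y n) = 0.
  rewrite (eq_zsum (g := fun n => sh n * u n - s * sh n)).
    by rewrite zsumB ?zsumZ ?zsum_shell1 ?sE; [ring | fsupp_tac | fsupp_tac].
  move=> n; rewrite /y /sh; case: eqP => [n1|_] /=; last by ring.
  by have [_ ->] := trial_1 a1 a2 b1 g1 n1; ring.
have gy := gap k2 mu0 theta0 hth N0 (hfar N h1) fy y0 ys.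
have Y0 : 0 <= zsum (fun n => sh n * y n ^+ 2).
  by apply: zsum_ge0 => n; rewrite mulr_ge0 ?sqr_ge0.
have W0 : 0 <= zsum (fun n => f2 n * y n ^+ 2 * hardy_wt R k.+1 n).
  by apply: zsum_ge0 => n; rewrite mulr_ge0 ?hardy_wt_ge0 // mulr_ge0 // sqr_ge0.
have wy := weight_split fy y0.
rewrite -/(sh _) in gy wy.
set W2 := zsum (fun n => f2 n * y n ^+ 2 * hardy_wt R k.+1 n) in W0.
rewrite -/W2 -/x in gy wy.
set Y1 := zsum (fun n => sh n * y n ^+ 2) in Y0.
rewrite -/Y1 in gy wy.
(* The spare 5/100 is 108/100 from [gap] minus the bound 103/100 on c. *)
have hyy : 5 / 100 * W2 <= zsum (fun n => y n * avg_cubic l m p y n) -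
    c * zsum (fun n => y n ^+ 2 * hardy_wt R k.+1 n).
  have := ler_wpM2r Y0 cv1; have := ler_wpM2r W0 cv2; rewrite wy; lra.
have fKy := fsupp_avg_cubic l m p fy; have fKt := fsupp_avg_cubic l m p ft.
have sym : zsum (fun n => tr N n * avg_cubic l m p y n) = zsum (fun n => y n * avg_cubic l m p (tr N) n).
  by rewrite zsum_mul_avg_cubic //; apply: eq_zsum => n; rewrite mulrC.
have huu : zsum (fun n => u n * avg_cubic l m p u n) - c * zsum (fun n => u n ^+ 2 * hardy_wt R k.+1 n)
  = (zsum (fun n => y n * avg_cubic l m p y n) - c * zsum (fun n => y n ^+ 2 * hardy_wt R k.+1 n))
   + 2 * s * zsum (fun n => y n * rs N n) + s ^+ 2 * zsum (fun n => tr N n * rs N n).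
  have uE : u = fun n => y n + s * tr N n by apply: funext => n; rewrite /y; ring.
  have -> : zsum (fun n => y n * rs N n) = zsum (fun n => y n * avg_cubic l m p (tr N) n)
      - c * zsum (fun n => y n * (hardy_wt R k.+1 n * tr N n)).
    rewrite -zsumZ -zsumB; try by fsupp_tac.
    by apply: eq_zsum => n; rewrite /residual -/c; ring.
  have -> : 2 * s * (zsum (fun n => y n * avg_cubic l m p (tr N) n)
      - c * zsum (fun n => y n * (hardy_wt R k.+1 n * tr N n))) =
     s * zsum (fun n => y n * avg_cubic l m p (tr N) n) + s * zsum (fun n => tr N n * avg_cubic l m p y n) -
     2 * s * c * zsum (fun n => y n * (hardy_wt R k.+1 n * tr N n)).
    by rewrite sym; ring.
  rewrite -!zsumZ -!zsumB; try by fsupp_tac.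
  rewrite -!zsumD; try by fsupp_tac.
  rewrite -!zsumB; try by fsupp_tac.
  rewrite -!zsumD; try by fsupp_tac.
  apply: eq_zsum => n.
  have -> : avg_cubic l m p u n = avg_cubic l m p y n + s * avg_cubic l m p (tr N) n.
    by rewrite {1}uE avg_cubicD avg_cubicZ.
  have -> : u n = y n + s * tr N n by rewrite /y; ring.
  rewrite /residual -/c.
  move: (avg_cubic l m p y n) (avg_cubic l m p (tr N) n) (y n) (tr N n) (hardy_wt R k.+1 n) => q1 q2 q3 q4 q5; ring.
have cross : - (5 / 100 * W2 + 20 * 6 ^+ 6 * s ^+ 2 * (C * x ^+ 2)) <= 2 * s * zsum (fun n => y n * rs N n).
  (* The unit sphere contributes E times the sum of y there, which is zero, and the origin
     contributes nothing since y vanishes. *)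
  have -> : zsum (fun n => y n * rs N n) = zsum (fun n => f2 n * (y n * rs N n)).
    rewrite (eq_zsum (g := fun n => E * (sh n * y n) + f2 n * (y n * rs N n))).
      by rewrite zsumD ?zsumZ ?ys ?mulr0 ?add0r //; fsupp_tac.
    move=> n; rewrite /sh /f2; case e : (l1norm n) => [|[|i]] /=; last by ring.
      by rewrite (l1norm_eq0 e) y0; ring.
    by rewrite (e2 _ e); ring.
  have s20 : 0 <= 20 * 6 ^+ 6 * s ^+ 2 by rewrite mulr_ge0 ?sqr_ge0 // mulr_ge0 // exprn_ge0.
  have pt (n : 'rV[int]_N) : - (5 / 100 * (f2 n * y n ^+ 2 * hardy_wt R k.+1 n) +
     20 * 6 ^+ 6 * s ^+ 2 * (f2 n * rs N n ^+ 2)) <= 2 * s * (f2 n * (y n * rs N n)).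
    rewrite /f2; case: (leqP 2 (l1norm n)) => n2 /=; last by lra.
    case: (leqP (l1norm n) 6) => n6; last first.
      have -> : rs N n = 0.
        have hK : avg_cubic l m p (tr N) n = 0 by exact: avg_cubic_profile_supp.
        have ht : tr N n = 0 by apply: profile_supp; exact: leq_ltn_trans n6.
        by rewrite /residual hK ht mulr0 subr0.
      rewrite expr0n /= !mulr0 addr0 oppr_le0; apply: mulr_ge0; first by rewrite divr_ge0.
      by apply: mulr_ge0; [rewrite mulr_ge0 ?sqr_ge0 | exact: hardy_wt_ge0].
    have w6 := hardy_wt_ge R k2 (ltnW n2) n6.
    have := ler_wpM2l (sqr_ge0 (y n)) w6.
    set Y := y n; set r := rs N n; set W := hardy_wt R k.+1 n.
    have s6 : (6%:R : R) ^+ 6 = 216 ^+ 2 by ring.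
    rewrite s6 => hw.
    have hW : 0 <= 5 / 100 * (Y / 216 + 20 * 216 * (s * r)) ^+ 2.
      by apply: mulr_ge0; [rewrite divr_ge0 | exact: sqr_ge0].
    have e3 : 5 / 100 * (Y / 216 + 20 * 216 * (s * r)) ^+ 2 =
      5 / 100 * (Y ^+ 2 / 216 ^+ 2) + 2 * s * (Y * r) + 20 * 216 ^+ 2 * s ^+ 2 * r ^+ 2 by field.
    lra.
  have := ler_wpM2l s20 C1; rewrite -/f2.
  have : - (5 / 100 * W2 + 20 * 6 ^+ 6 * s ^+ 2 * zsum (fun n => f2 n * rs N n ^+ 2)) <=
     2 * s * zsum (fun n => f2 n * (y n * rs N n)).
    rewrite -!zsumZ -zsumD; try by fsupp_tac.
    rewrite -zsumN; apply: le_zsum => [||n]; try by fsupp_tac.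
    exact: pt.
  set q1 := zsum (fun n => f2 n * rs N n ^+ 2); set q2 := zsum _.
  move: (20 * 6 ^+ 6 * s ^+ 2) => q3; lra.
(* The variance of u on the unit sphere is nonnegative. The factor x gained here turns the error s^2
   O(x^2) into O(x^3). *)
have s2 : s ^+ 2 <= x / 2 * zsum (fun n => u n ^+ 2 * hardy_wt R k.+1 n).
  have h0 : 0 <= zsum (fun n => sh n * (u n - s) ^+ 2).
    by apply: zsum_ge0 => n; rewrite mulr_ge0 ?sqr_ge0.
  have e : zsum (fun n => sh n * (u n - s) ^+ 2) =
     zsum (fun n => sh n * u n ^+ 2) - 2 * N%:R * s ^+ 2.
    rewrite (eq_zsum (g := fun n => sh n * u n ^+ 2 - 2 * s * (sh n * u n) + s ^+ 2 * sh n)).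
      rewrite zsumD ?zsumB ?zsumZ; try by fsupp_tac.
      rewrite sE (zsum_shell1 R N); ring.
    by move=> n; ring.
  have -> : zsum (fun n => u n ^+ 2 * hardy_wt R k.+1 n) = zsum (fun n => sh n * u n ^+ 2) +
       zsum (fun n => f2 n * u n ^+ 2 * hardy_wt R k.+1 n) by exact: weight_split.
  have w0 : 0 <= zsum (fun n => f2 n * u n ^+ 2 * hardy_wt R k.+1 n).
    by apply: zsum_ge0 => n; rewrite mulr_ge0 ?hardy_wt_ge0 // mulr_ge0 // sqr_ge0.
  have x20 : 0 <= x / 2 by rewrite divr_ge0 // ltW.
  have := ler_wpM2l x20 w0.
  rewrite e NE in h0; have := ler_wpM2l x20 h0.
  have -> : x / 2 * (zsum (fun n => sh n * u n ^+ 2) - 2 * x^-1 * s ^+ 2) =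
    x / 2 * zsum (fun n => sh n * u n ^+ 2) - s ^+ 2 by field.
  lra.
move: C2; rewrite ler_norml => /andP[C2 _].
have s20 : 0 <= s ^+ 2 by exact: sqr_ge0.
have k1 := ler_wpM2l s20 C2.
have Cx : 0 <= C * x ^+ 2.
  apply: le_trans C1; apply: zsum_ge0 => n; by rewrite mulr_ge0 // sqr_ge0.
have q0 : 0 <= C * x ^+ 2 * (1 + 20 * 6 ^+ 6).
  by apply: mulr_ge0 => //; apply: addr_ge0 => //; apply: mulr_ge0 => //; exact: exprn_ge0.
have k3 := ler_wpM2l q0 s2.
rewrite -/x; set U := zsum (fun n => u n ^+ 2 * _) in huu k3 *.
have -> : (c - C * (1 + 20 * 6 ^+ 6) / 2 * x ^+ 3) * U = c * U - C * x ^+ 2 * (1 + 20 * 6 ^+ 6) * (x / 2 * U) by field.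
move: huu cross hyy k1 k3.
set q1 := zsum (fun n => u n * _); set q2 := zsum (fun n => y n * _) - _; set q3 := 2 * s * _.
set q4 := zsum (fun n => tr N n * rs N n); set q5 := _ * (x / 2 * U).
move: (20 * 6 ^+ 6 : R) => q6.
move: q1 q2 q3 q4 q5 => q1 q2 q3 q4 q5; lra.
Qed.

(** The unit sphere alone gives W >= 2N, so the O(x^2) product of trial function and residual is
    O(x^3) relative to W. *)
Lemma avg_cubic_trial_upper : exists C, forall N, (0 < N)%N ->
  let W := zsum (fun n => tr N n ^+ 2 * hardy_wt R k.+1 n) in
  0 < W /\ zsum (fun n => tr N n * avg_cubic l m p (tr N) n) <= (cv N + C * invN R N ^+ 3) * W.
Proof.
have [C hC] := residual_sums E1 E2 E3 E4 E5 E6.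
exists (C / 2) => N N0 W; have [C1 C2] := hC N N0.
have x0 := invN_gt0 R N0; set x := invN R N in C1 C2 x0 *.
have NE : N%:R = x^-1 :> R by exact: natr_invN.
have xn := lt0r_neq0 x0.
have ft : fsupp (tr N) := fsupp_trial a1 a2 b1 g1 N.
have fKt := fsupp_avg_cubic l m p ft.
have W1 : 2 * N%:R <= W.
  rewrite -(zsum_shell1 R N) /W; apply: le_zsum => [||n]; [exact: fsupp_shell | by fsupp_tac |].
  case: eqP => [n1|_]; last by rewrite mulr_ge0 ?sqr_ge0 ?hardy_wt_ge0.
  by rewrite (hardy_wt_l1norm_1 n1); have [_ ->] := trial_1 a1 a2 b1 g1 n1; rewrite expr1n mulr1.
split; first by apply: lt_le_trans W1; rewrite mulr_gt0 // ltr0n.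
have e : zsum (fun n => tr N n * avg_cubic l m p (tr N) n) = cv N * W + zsum (fun n => tr N n * rs N n).
  have fr : fsupp (rs N) by apply: fsuppD => //; apply: fsuppN; apply: fsuppMr.
  rewrite -zsumZ -zsumD; try by fsupp_tac.
  by apply: eq_zsum => n; rewrite /residual; ring.
move: C2; rewrite e ler_norml => /andP[_ C2].
have Cx : 0 <= C * x ^+ 2.
  by apply: le_trans C1; apply: zsum_ge0 => n; rewrite mulr_ge0 // sqr_ge0.
have := ler_wpM2l (mulr_ge0 Cx (ltac:(by rewrite divr_ge0 // ltW) : 0 <= x / 2)) W1.
have -> : C * x ^+ 2 * (x / 2) * (2 * N%:R) = C * x ^+ 2 by rewrite NE; field.
lra.
Qed.

End Assembly.

(** * Coefficients for the first three powers *)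

Section MainBounds.
Variable R : realType.

Lemma iter_lapn1 N (f : 'rV[int]_N -> R) : iter 1 (@lapn R N) f = avg_cubic 1 0 0 f.
Proof. by apply: funext => n; rewrite /avg_cubic /= /lapn; ring. Qed.

Lemma lapnE N (f : 'rV[int]_N -> R) : lapn f = (fun n => f n - avg f n).
Proof. by []. Qed.

Lemma iter_lapn2 N (f : 'rV[int]_N -> R) : iter 2 (@lapn R N) f = avg_cubic 2 1 0 f.
Proof. by apply: funext => n; rewrite /avg_cubic /= !lapnE avgB_fun; ring. Qed.

Lemma iter_lapn3 N (f : 'rV[int]_N -> R) : iter 3 (@lapn R N) f = avg_cubic 3 3 1 f.
Proof. by apply: funext => n; rewrite /avg_cubic /= !lapnE !avgB_fun; ring. Qed.

(** Real functions suffice, since numerator and denominator of the quotient both split into a real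
    and an imaginary part. *)
Definition hardy_bounds (k : nat) (c1 c2 : R) := exists C N0, 0 <= C /\
  forall N, (N0 <= N)%N -> (0 < N)%N ->
  (forall u : 'rV[int]_N -> R, fsupp u -> u 0 = 0 ->
    (ratio_approx c1 c2 N - C * invN R N ^+ 3) * zsum (fun n => u n ^+ 2 * hardy_wt R k.+1 n) <=
    zsum (fun n => u n * iter k.+1 (@lapn R N) u n)) /\
  exists u : 'rV[int]_N -> R, [/\ fsupp u, u 0 = 0,
    0 < zsum (fun n => u n ^+ 2 * hardy_wt R k.+1 n) &
    zsum (fun n => u n * iter k.+1 (@lapn R N) u n) <=
    (ratio_approx c1 c2 N + C * invN R N ^+ 3) * zsum (fun n => u n ^+ 2 * hardy_wt R k.+1 n)].

Lemma hardy_bounds_of_coefs (k : nat) (l m p a1 a2 b1 g1 c1 c2 theta : R) :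
  (k <= 2)%N ->
  (forall N (f : 'rV[int]_N -> R), iter k.+1 (@lapn R N) f = avg_cubic l m p f) ->
  c1 = - (l * a1) + 3 / 2 * m ->
  c2 = l * a1 - l * a2 - l * b1 / 2 + m * g1 - 3 / 4 * m - 3 * p * a1 ->
  a1 - l = a1 * 2%:R ^- k.+1 ->
  a2 - l * g1 + 5 / 2 * m * a1 - 3 * p = (a1 * c1 + a2) * 2%:R ^- k.+1 ->
  b1 - l / 2 = b1 * 4%:R ^- k.+1 ->
  g1 - 3 / 2 * l * a1 + 3 / 2 * m = g1 * 3%:R ^- k.+1 ->
  0 < far_gain R k -> 0 <= theta -> l ^+ 2 / far_gain R k - m <= theta -> theta / 2 < - c1 ->
  hardy_bounds k c1 c2.
Proof.
move=> k2 hK E1 E2 E3 E4 E5 E6 mu0 th0 hth hc1.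
have far : exists N0, forall N, (N0 <= N)%N ->
    forall v : 'rV[int]_N -> R, fsupp v -> (forall n, (sqn n <= 1)%N -> v n = 0) ->
    110 / 100 * zsum (fun n => v n ^+ 2 * hardy_wt R k.+1 n) +
    far_gain R k * zsum (fun n => v n ^+ 2 * ((sqn n == 2) || (sqn n == 4))%:R) <=
    zsum (fun n => v n * avg_cubic l m p v n).
  have [N0 h] := far_weights R k2; exists N0 => N hN v fv v0.
  by have := h N hN v fv v0; rewrite hK.
have [C1 [N1 h1]] := avg_cubic_lower k2 E1 E2 E3 E4 E5 E6 mu0 th0 hth hc1 far.
have [C2 h2] := avg_cubic_trial_upper E1 E2 E3 E4 E5 E6.
exists (`|C1| + `|C2|), N1; split=> [|N hN N0]; first exact: addr_ge0.
have x30 : 0 <= invN R N ^+ 3 by rewrite exprn_ge0 // invN_ge0.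
have w0 (u : 'rV[int]_N -> R) : 0 <= zsum (fun n => u n ^+ 2 * hardy_wt R k.+1 n).
  by apply: zsum_ge0 => n; apply: mulr_ge0; [exact: sqr_ge0 | exact: hardy_wt_ge0].
split=> [u fu u0|].
  rewrite hK; apply: le_trans (h1 N hN u fu u0); apply: ler_wpM2r => //.
  rewrite lerB // ler_wpM2r //.
  by apply: le_trans (ler_norm C1) _; rewrite lerDl.
have [W0 h] := h2 N N0.
exists (@trial R a1 a2 b1 g1 N); split=> //; first exact: fsupp_trial.
  by rewrite /trial /profile l1norm_0.
rewrite hK; apply: le_trans h _; apply: ler_wpM2r => //.
rewrite lerD // ler_wpM2r //.
by apply: le_trans (ler_norm C2) _; rewrite lerDr.
Qed.

(* The coefficients solve the equations of [hardy_bounds_of_coefs] successively: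
   [a1], [b1], then [g1], [c1], then [a2], [c2]. *)
Lemma hardy_bounds1 : hardy_bounds 0 (- 2) (- (10 / 3)).
Proof.
(* The last argument is theta: 100/37 <= 3 and 3/2 < 2. For the next powers theta is 6 and 9, the
   latter being exactly 9 / (75/100) - 3. *)
apply: (@hardy_bounds_of_coefs 0 1 0 0 2 5 (2 / 3) (9 / 2) _ _ 3) => //;
  rewrite ?expr1 /far_gain /=; try by [lra | field].
by move=> N f; rewrite -iter_lapn1.
Qed.

Lemma hardy_bounds2 : hardy_bounds 1 (- (23 / 6)) (- (7729 / 2160)).
Proof.
apply: (@hardy_bounds_of_coefs 1 2 1 0 (8 / 3) (389 / 54) (16 / 15) (117 / 16) _ _ 6) => //;
  rewrite ?expr2 /far_gain /=; try by [lra | field].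
by move=> N f; rewrite -iter_lapn2.
Qed.

Lemma hardy_bounds3 : hardy_bounds 2 (- (81 / 14)) (- (7505 / (2 * 4459))).
Proof.
apply: (@hardy_bounds_of_coefs 2 3 3 1 (24 / 7) (438 * 103 / 4459) (32 / 21) (4131 / 364) _ _ 9) => //;
  rewrite ?exprS ?expr0 /far_gain /=; try by [lra | field].
by move=> N f; rewrite -iter_lapn3.
Qed.

End MainBounds.

From mathcomp Require Import complex all_classical all_reals all_analysis.
Import numFieldNormedType.Exports.

(** * Hardy constants *)

Section ComplexFunctions.
Variable R : realType.
Local Notation C := (complex.complex R).
Local Notation Re := (@complex.Re R).
Local Notation Im := (@complex.Im R).

Lemma ReD (a b : C) : Re (a + b) = Re a + Re b. Proof. by case: a; case: b. Qed.
Lemma ImD (a b : C) : Im (a + b) = Im a + Im b. Proof. by case: a; case: b. Qed.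
Lemma ReB (a b : C) : Re (a - b) = Re a - Re b. Proof. by case: a; case: b. Qed.
Lemma ImB (a b : C) : Im (a - b) = Im a - Im b. Proof. by case: a; case: b. Qed.
Lemma Re_sum (I : Type) (r : seq I) (P : pred I) (F : I -> C) :
  Re (\sum_(i <- r | P i) F i) = \sum_(i <- r | P i) Re (F i).
Proof. by apply: (big_morph Re ReD). Qed.
Lemma Im_sum (I : Type) (r : seq I) (P : pred I) (F : I -> C) :
  Im (\sum_(i <- r | P i) F i) = \sum_(i <- r | P i) Im (F i).
Proof. by apply: (big_morph Im ImD). Qed.

Lemma ReMn (k : nat) (a : C) : Re (k%:R * a) = k%:R * Re a.
Proof.
rewrite mulr_natl mulr_natl; elim: k => [|k IH]; first by rewrite !mulr0n.
by rewrite !mulrS ReD IH.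
Qed.
Lemma ImMn (k : nat) (a : C) : Im (k%:R * a) = k%:R * Im a.
Proof.
rewrite mulr_natl mulr_natl; elim: k => [|k IH]; first by rewrite !mulr0n.
by rewrite !mulrS ImD IH.
Qed.

Lemma Re_conjM (a b : C) : Re (a^* * b) = Re a * Re b + Im a * Im b.
Proof. by case: a => a1 a2; case: b => b1 b2 /=; ring. Qed.

Lemma normc_sqr (a : C) : Normc.normc a ^+ 2 = Re a ^+ 2 + Im a ^+ 2.
Proof. by case: a => a b; rewrite /= sqr_sqrtr // addr_ge0 // sqr_ge0. Qed.

Section FixedN.
Variable N : nat.
Local Notation Z := 'rV[int]_N.

Lemma enorm_sqr (n : Z) : enorm R n ^+ 2 = (sqn n)%:R.
Proof.
by rewrite /enorm sqr_sqrtr ?sqn_real //; apply: sumr_ge0 => i _; exact: sqr_ge0.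
Qed.

(** Over the integers |n|_1 <= |n|^2 <= |n|_1^2, so both norms take the value 1 at the same
    points. *)
Lemma enorm_eq1 (n : Z) : enorm R n = 1 <-> l1norm n = 1%N.
Proof.
have e0 : 0 <= enorm R n by exact: sqrtr_ge0.
split=> h.
  have : (sqn n)%:R = 1 :> R by rewrite -enorm_sqr h expr1n.
  move/eqP; rewrite pnatr_eq1 => /eqP s1.
  have := l1norm_sqn n; have := sqn_l1norm n; rewrite s1.
  by case: (l1norm n) => [|[|]].
have s1 : sqn n = 1%N.
  by have := l1norm_sqn n; have := sqn_l1norm n; rewrite h; lia.
by apply/eqP; rewrite -(@eqrXn2 _ 2) // enorm_sqr s1 expr1n.
Qed.

Lemma unit_sphere (n : Z) :
  [set m | enorm R (m - n) = 1] =
  [set` [seq n + evec i | i <- enum 'I_N] ++ [seq n - evec i | i <- enum 'I_N]].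
Proof.
apply/seteqP; split=> m /=.
  move/enorm_eq1 => /l1norm_eq1[a [s [s1 h]]].
  have mE : m = n + s *: evec a by rewrite -h addrC subrK.
  rewrite mem_cat; apply/orP; case: s1 mE => -> ->; [left | right].
    by apply/mapP; exists a; rewrite ?mem_enum // scale1r.
  by apply/mapP; exists a; rewrite ?mem_enum // scaleN1r.
rewrite mem_cat => /orP[] /mapP[a _ ->]; apply/enorm_eq1; rewrite addrAC subrr add0r.
  by rewrite -[evec a]scale1r l1norm_evec.
by rewrite -scaleN1r l1norm_evec.
Qed.

Lemma uniq_unit_sphere (n : Z) :
  uniq ([seq n + evec i | i <- enum 'I_N] ++ [seq n - evec i | i <- enum 'I_N]).
Proof.
have inj (i j : 'I_N) : evec i = evec j -> i = j.
  move=> /(congr1 (fun w : Z => w ord0 i)); rewrite !evecE eqxx.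
  by case: eqVneq => [->|].
have u1 : uniq [seq n + evec i | i <- enum 'I_N].
  by rewrite map_inj_uniq ?enum_uniq // => i j /addrI /inj.
have u2 : uniq [seq n - evec i | i <- enum 'I_N].
  by rewrite map_inj_uniq ?enum_uniq // => i j /addrI /oppr_inj /inj.
rewrite cat_uniq u1 u2 andbT /=; apply/hasPn => m /mapP[a _ ->].
apply/mapP => -[b _] /addrI /(congr1 (fun w : Z => w ord0 a)).
by rewrite mxE !evecE eqxx; case: (b == a).
Qed.

Lemma laplacianE (u : Z -> C) n : laplacian u n =
  (2 * N)%:R * u n - \sum_i (u (n + evec i) + u (n - evec i)).
Proof.
rewrite /laplacian unit_sphere -fsbig_seq ?uniq_unit_sphere //.
have e (F : 'I_N -> C) : \sum_(i <- enum 'I_N) F i = \sum_i F i by rewrite big_enum.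
by rewrite big_cat /= (big_map (fun i => n + evec i)) (big_map (fun i => n - evec i)) big_split /= !e.
Qed.

Hypothesis N0 : (0 < N)%N.

Lemma Re_iter_laplacian k (u : Z -> C) n : Re (iter k (@laplacian R N) u n) =
  (2 * N%:R) ^+ k * iter k (@lapn R N) (fun n => Re (u n)) n.
Proof.
have N0' : N%:R != 0 :> R by rewrite pnatr_eq0 -lt0n.
elim: k n => [|k IH] n; first by rewrite expr0 mul1r.
rewrite /= laplacianE ReB ReMn Re_sum IH.
rewrite (eq_bigr (fun i => (2 * N%:R) ^+ k * (iter k (@lapn R N) (fun n => Re (u n)) (n + evec i)
   + iter k (@lapn R N) (fun n => Re (u n)) (n - evec i)))); last first.
  by move=> i _; rewrite ReD !IH; ring.
rewrite -mulr_sumr /lapn /avg /nbsum /invN exprS natrM; field; exact: N0'.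
Qed.

Lemma Im_iter_laplacian k (u : Z -> C) n : Im (iter k (@laplacian R N) u n) =
  (2 * N%:R) ^+ k * iter k (@lapn R N) (fun n => Im (u n)) n.
Proof.
have N0' : N%:R != 0 :> R by rewrite pnatr_eq0 -lt0n.
elim: k n => [|k IH] n; first by rewrite expr0 mul1r.
rewrite /= laplacianE ImB ImMn Im_sum IH.
rewrite (eq_bigr (fun i => (2 * N%:R) ^+ k * (iter k (@lapn R N) (fun n => Im (u n)) (n + evec i)
   + iter k (@lapn R N) (fun n => Im (u n)) (n - evec i)))); last first.
  by move=> i _; rewrite ImD !IH; ring.
rewrite -mulr_sumr /lapn /avg /nbsum /invN exprS natrM; field; exact: N0'.
Qed.

Lemma Cc_Re (u : Z -> C) : Cc u -> fsupp (fun n => Re (u n)).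
Proof.
by apply: sub_finite_set => n /=; apply: contra_neq => ->.
Qed.
Lemma Cc_Im (u : Z -> C) : Cc u -> fsupp (fun n => Im (u n)).
Proof.
by apply: sub_finite_set => n /=; apply: contra_neq => ->.
Qed.

Lemma Re_inner (u v : Z -> C) : Cc u -> Re (inner u v) =
  zsum (fun n => Re (u n) * Re (v n)) + zsum (fun n => Im (u n) * Im (v n)).
Proof.
move=> cu; have fr := Cc_Re cu; have fi := Cc_Im cu.
rewrite -zsumD; [|exact: fsuppMl|exact: fsuppMl].
pose D := fset_set [set n | u n != 0].
have hD n : n \notin D -> u n = 0.
  by rewrite in_fset_set // => h; apply/eqP; apply: contraNT h => h; rewrite inE.
rewrite /inner (fsbigTE D); last by move=> n /hD ->; rewrite rmorph0 mul0r.
rewrite /zsum (fsbigTE D); last by move=> n /hD -> /=; rewrite !mul0r addr0.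
by rewrite Re_sum; apply: eq_bigr => n _; exact: Re_conjM.
Qed.

Lemma hardy_weightE k (u : Z -> C) : Cc u -> hardy_weight k.+1 u =
  zsum (fun n => Re (u n) ^+ 2 * hardy_wt R k.+1 n) + zsum (fun n => Im (u n) ^+ 2 * hardy_wt R k.+1 n).
Proof.
move=> cu; have fr := Cc_Re cu; have fi := Cc_Im cu.
rewrite -zsumD; [|by apply: fsuppMl; exact: fsuppX|by apply: fsuppMl; exact: fsuppX].
have e n : Normc.normc (u n) ^+ 2 / enorm R n ^+ (2 * k.+1) =
   Re (u n) ^+ 2 * hardy_wt R k.+1 n + Im (u n) ^+ 2 * hardy_wt R k.+1 n.
  by rewrite normc_sqr exprM enorm_sqr /hardy_wt mulrDl.
rewrite /hardy_weight /zsum.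
rewrite (eq_fsbigr (fun n => Re (u n) ^+ 2 * hardy_wt R k.+1 n + Im (u n) ^+ 2 * hardy_wt R k.+1 n)); last first.
  by move=> n _; exact: e.
apply: fsbig_widen => // n /= [_ /negP /negPn /eqP ->].
by rewrite /hardy_wt sqn0 expr0n /= invr0 !mulr0 addr0.
Qed.

Lemma inner_laplacian k (u : Z -> C) : Cc u ->
  Re (inner u (iter k (@laplacian R N) u)) = (2 * N%:R) ^+ k *
   (zsum (fun n => Re (u n) * iter k (@lapn R N) (fun n => Re (u n)) n) +
    zsum (fun n => Im (u n) * iter k (@lapn R N) (fun n => Im (u n)) n)).
Proof.
move=> cu; rewrite Re_inner // mulrDr -!zsumZ; congr (_ + _); apply: eq_zsum => n.
  by rewrite Re_iter_laplacian; ring.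
by rewrite Im_iter_laplacian; ring.
Qed.

Lemma hardy_weight_gt0 k (u : Z -> C) : Cc u -> u 0 = 0 -> u <> (fun=> 0) ->
  0 < hardy_weight k.+1 u.
Proof.
move=> cu u0 un; rewrite hardy_weightE //.
have fr := Cc_Re cu; have fi := Cc_Im cu.
have w0 (f : Z -> R) : 0 <= zsum (fun n => f n ^+ 2 * hardy_wt R k.+1 n).
  by apply: zsum_ge0 => n; apply: mulr_ge0; [exact: sqr_ge0 | exact: hardy_wt_ge0].
rewrite lt_neqAle addr_ge0 // andbT eq_sym; apply/eqP => h; apply: un.
have z (f : Z -> R) : fsupp f -> f 0 = 0 -> zsum (fun n => f n ^+ 2 * hardy_wt R k.+1 n) = 0 -> forall n, f n = 0.
  move=> ff f0 hz n; have [->//|nn] := eqVneq n 0.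
  have := zsum_eq0 _ _ hz n; move=> /(_ (fsuppMl _ (fsuppX _ ff))).
  move=> /(_ (fun n => mulr_ge0 (sqr_ge0 _) (hardy_wt_ge0 _ _ _)))/eqP.
  rewrite mulf_eq0 sqrf_eq0 /hardy_wt invr_eq0 expf_eq0 /= pnatr_eq0 => /orP[/eqP//|/eqP s0].
  by move: nn; rewrite (l1norm_eq0 (n := n)) ?eqxx //; have := l1norm_sqn n; rewrite s0; case: (l1norm n).
have hr : zsum (fun n => Re (u n) ^+ 2 * hardy_wt R k.+1 n) = 0.
  by apply/eqP; rewrite eq_le w0 andbT -h lerDl w0.
have hi : zsum (fun n => Im (u n) ^+ 2 * hardy_wt R k.+1 n) = 0.
  by apply/eqP; rewrite eq_le w0 andbT -h lerDr w0.
apply: funext => n; apply/eqP; rewrite eq_complex.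
rewrite (z _ fr _ hr n) ?u0 // (z _ fi _ hi n) ?u0 //=.
by rewrite !eqxx.
Qed.

End FixedN.

(** Restoring the factor (2N)^(k+1) turns the relative error O(N^-3) into O(N^(k-2)), the three
    error terms of the theorem. *)
Lemma hardy_constant_bound k (c1 c2 : R) : hardy_bounds k c1 c2 -> exists Q N0, 0 <= Q /\
  forall N, (N0 <= N)%N -> (0 < N)%N ->
  `|hardy_constant R k.+1 N - (2 * N%:R) ^+ k.+1 * ratio_approx c1 c2 N| <=
     (2 * N%:R) ^+ k.+1 * (Q * invN R N ^+ 3).
Proof.
move=> [Q [N0 [Q0 h]]]; exists Q, N0; split=> // N hN Np.
have [lo [u [fu u0 W0 up]]] := h N hN Np.
set c := ratio_approx c1 c2 N in lo up *; set r := Q * _ in lo up *.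
have M0 : 0 < (2 * N%:R) ^+ k.+1 :> R by rewrite exprn_gt0 // mulr_gt0 // ltr0n.
set M := (2 * N%:R) ^+ k.+1 in M0 *.
rewrite /hardy_constant; set E := [set _ | _ in _].
have lb : lbound E (M * (c - r)).
  move=> _ [v [cv v0 vn] <-].
  rewrite ler_pdivlMr ?hardy_weight_gt0 // inner_laplacian // -/M -mulrA ler_pM2l //.
  rewrite hardy_weightE // mulrDr; apply: lerD.
    by apply: lo; [exact: Cc_Re | rewrite v0].
  by apply: lo; [exact: Cc_Im | rewrite v0].
pose U (n : 'rV[int]_N) : C := complex.Complex (u n) 0.
have cU : Cc U.
  apply: sub_finite_set fu => n /=; apply: contra_neq => un; rewrite /U un //.
have U0 : U 0 = 0 by rewrite /U u0.
have WU : hardy_weight k.+1 U = zsum (fun n => u n ^+ 2 * hardy_wt R k.+1 n).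
  rewrite hardy_weightE // [X in _ + X](_ : _ = 0) ?addr0 //.
  by rewrite -[RHS](@zsum0 R 'rV[int]_N); apply: eq_zsum => n; rewrite /= expr0n mul0r.
have Un : U <> (fun=> 0).
  move=> e; move: W0; rewrite -WU /hardy_weight fsbig1 ?ltxx // => n _.
  by rewrite e Normc.normc0 expr0n mul0r.
have EU : E (complex.Re (inner U (iter k.+1 (@laplacian R N) U)) / hardy_weight k.+1 U).
  by exists U.
have ub : complex.Re (inner U (iter k.+1 (@laplacian R N) U)) / hardy_weight k.+1 U <= M * (c + r).
  rewrite WU ler_pdivrMr // inner_laplacian // -/M -mulrA ler_pM2l //.
  apply: le_trans up; rewrite [X in _ + X](_ : _ = 0) ?addr0 //.
  by rewrite -[RHS](@zsum0 R 'rV[int]_N); apply: eq_zsum => n; rewrite /= mul0r.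
have i1 : M * (c - r) <= inf E by apply: lb_le_inf => //; eexists; exact: EU.
have i2 : inf E <= M * (c + r).
  by apply: le_trans ub; apply: ge_inf => //; eexists; exact: lb.
by rewrite ler_distl; apply/andP; split; lra.
Qed.

Lemma eqaddO_oo (f g e : nat -> R) (Q : R) (N0 : nat) :
  (forall N, (N0 <= N)%N -> `|f N - g N| <= Q * `|e N|) -> f = g +O_\oo e.
Proof.
move=> h; apply/eqaddOP/bigO_exP; exists (`|Q| + 1); first by rewrite ltr_wpDl.
exists N0 => // N /= hN; apply: le_trans (h N hN) _; apply: ler_wpM2r => //.
by apply: le_trans (ler_norm Q) _; rewrite lerDl.
Qed.

End ComplexFunctions.

(* 3002 * 10 stands for 30020, too large for a unary literal *)
Theorem corollary7p3 (R : realType) :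
  [/\ (fun N : nat => hardy_constant R 1 N) =
        (fun N : nat => 2 * N%:R - 4 - 20 / (3 * N%:R))
        +O_\oo (fun N : nat => N%:R ^- 2 : R),
      (fun N : nat => hardy_constant R 2 N) =
        (fun N : nat => 4 * N%:R ^+ 2 - 46 / 3 * N%:R - 7729 / 540)
        +O_\oo (fun N : nat => N%:R ^-1 : R)
    & (fun N : nat => hardy_constant R 3 N) =
        (fun N : nat => 8 * N%:R ^+ 3 - 324 / 7 * N%:R ^+ 2
                        - (3002 * 10) / 4459 * N%:R)
        +O_\oo (fun N : nat => 1 : R)].
Proof.
split.
- have [Q [N0 [Q0 h]]] := hardy_constant_bound (hardy_bounds1 R).
  (* Starting at [N0.+1] keeps N positive, as the divisions by N require. *)
  apply: (@eqaddO_oo _ _ _ _ (2 * Q) N0.+1) => N hN.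
  have Np : (0 < N)%N by exact: leq_trans hN.
  have Np' : N%:R != 0 :> R by rewrite pnatr_eq0 -lt0n.
  have := h N (ltnW hN) Np; rewrite /ratio_approx /invN.
  have -> : (2 * N%:R) ^+ 1 * (1 + - 2 * N%:R^-1 + - (10 / 3) * N%:R^-1 ^+ 2) =
     2 * N%:R - 4 - 20 / (3 * N%:R) :> R by field.
  have -> : (2 * N%:R) ^+ 1 * (Q * N%:R^-1 ^+ 3) = 2 * Q * N%:R ^- 2 :> R by field.
  by rewrite (ger0_norm (_ : 0 <= N%:R ^- 2 :> R)) // invr_ge0 exprn_ge0.
- have [Q [N0 [Q0 h]]] := hardy_constant_bound (hardy_bounds2 R).
  apply: (@eqaddO_oo _ _ _ _ (4 * Q) N0.+1) => N hN.
  have Np : (0 < N)%N by exact: leq_trans hN.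
  have Np' : N%:R != 0 :> R by rewrite pnatr_eq0 -lt0n.
  have := h N (ltnW hN) Np; rewrite /ratio_approx /invN.
  have -> : (2 * N%:R) ^+ 2 * (1 + - (23 / 6) * N%:R^-1 + - (7729 / 2160) * N%:R^-1 ^+ 2) =
     4 * N%:R ^+ 2 - 46 / 3 * N%:R - 7729 / 540 :> R by field.
  have -> : (2 * N%:R) ^+ 2 * (Q * N%:R^-1 ^+ 3) = 4 * Q * N%:R ^-1 :> R by field.
  by rewrite (ger0_norm (_ : 0 <= N%:R ^-1 :> R)) // invr_ge0.
- have [Q [N0 [Q0 h]]] := hardy_constant_bound (hardy_bounds3 R).
  apply: (@eqaddO_oo _ _ _ _ (8 * Q) N0.+1) => N hN.
  have Np : (0 < N)%N by exact: leq_trans hN.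
  have Np' : N%:R != 0 :> R by rewrite pnatr_eq0 -lt0n.
  have := h N (ltnW hN) Np; rewrite /ratio_approx /invN.
  have -> : (2 * N%:R) ^+ 3 * (1 + - (81 / 14) * N%:R^-1 + - (7505 / (2 * 4459)) * N%:R^-1 ^+ 2) =
     8 * N%:R ^+ 3 - 324 / 7 * N%:R ^+ 2 - (3002 * 10) / 4459 * N%:R :> R by field.
  have -> : (2 * N%:R) ^+ 3 * (Q * N%:R^-1 ^+ 3) = 8 * Q :> R by field.
  by rewrite normr1 mulr1.
Qed.
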